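(* Let $\mathcal{C}$ be a concept class over a domain $\mathcal{X}$ and let $\mathcal{A}$ be an $(\varepsilon,0.01)$-TDS learner for $\mathcal{C}$ that runs in time $T_{\mathcal{A}}(\varepsilon)$ and has total (training plus test) sample complexity $m_{\mathcal{A}}(\varepsilon)$. Then there is an algorithm with oracle access to $\mathcal{A}$ that, for every $\delta\in(0,1)$, is a PQ learner for $\mathcal{C}$ up to error $O(\varepsilon)$, rejection rate $O(\varepsilon)$ and probability of failure $\delta$ (i.e. with probability at least $1-\delta$ it outputs $h,g$ with $\Pr_{\mathbf{x}\sim\mathcal{D}^{\mathsf{test}}}[f(\mathbf{x})\neq h(\mathbf{x}),\,g(\mathbf{x})=1]\le O(\varepsilon)$ and $\Pr_{\mathbf{x}\sim\mathcal{D}^{\mathsf{train}}}[g(\mathbf{x})=0]\le O(\varepsilon)$). Moreover, this algorithm calls $\mathcal{A}$ at most $\mathrm{poly}(m_{\mathcal{A}},1/\varepsilon,\log(1/\delta))$ times, uses $\mathrm{poly}(m_{\mathcal{A}},1/\varepsilon,\log(1/\delta))$ additional samples from the training and test distributions, and runs in time $T_{\mathcal{A}}\cdot \mathrm{poly}(m_{\mathcal{A}},1/\varepsilon,\log(1/\delta))$.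
   Context: A concept class $\mathcal{C}$ over $\mathcal{X}$ is a set of functions $c:\mathcal{X}\to\{\pm1\}$. In both learning models below, the learner has labeled sample access to a training distribution $\bar{\mathcal{D}}^{\mathsf{train}}$ (pairs $(\mathbf{x},f(\mathbf{x}))$ with $\mathbf{x}\sim\mathcal{D}^{\mathsf{train}}$) labeled by some unknown $f\in\mathcal{C}$, and unlabeled sample access to a test distribution $\mathcal{D}^{\mathsf{test}}$ over $\mathcal{X}$; no assumption relates $\mathcal{D}^{\mathsf{train}}$ and $\mathcal{D}^{\mathsf{test}}$, and the guarantees must hold for all such distributions and all $f\in\mathcal{C}$. TDS learner: $\mathcal{A}$ is a TDS learner for $\mathcal{C}$ up to error $\varepsilon$ and failure probability $\delta$ if it outputs either REJECT, or ACCEPT together with a hypothesis $h:\mathcal{X}\to\{\pm1\}$, such that with probability at least $1-\delta$: (soundness) upon acceptance, $\Pr_{\mathbf{x}\sim\mathcal{D}^{\mathsf{test}}}[f(\mathbf{x})\neq h(\mathbf{x})]\le\varepsilon$; (completeness) if $\mathcal{D}^{\mathsf{train}}=\mathcal{D}^{\mathsf{test}}$, the algorithm accepts. An $(\varepsilon,0.01)$-TDS learner is one with error $\varepsilon$ and failure probability $0.01$. PQ learner: $\mathcal{A}$ is a PQ learner for $\mathcal{C}$ up to error $\varepsilon$ (rejection rate $\eta$) and failure probability $\delta$ if with probability at least $1-\delta$ it outputs a hypothesis $h:\mathcal{X}\to\{\pm1\}$ and a selector $g:\mathcal{X}\to\{0,1\}$ with $\Pr_{\mathbf{x}\sim\mathcal{D}^{\mathsf{test}}}[f(\mathbf{x})\neq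 h(\mathbf{x})\text{ and }g(\mathbf{x})=1]\le\varepsilon$ and $\Pr_{\mathbf{x}\sim\mathcal{D}^{\mathsf{train}}}[g(\mathbf{x})=0]\le\eta$. The output hypothesis and selector are allowed to be randomized functions (whose evaluation may invoke $\mathcal{A}$), in which case probabilities are also over their internal randomness. *)

(* Defs.v *)
From HB Require Import structures.
From mathcomp Require Import all_boot all_order all_algebra.
From mathcomp Require Import all_classical all_reals all_analysis.

Set Implicit Arguments.
Unset Strict Implicit.
Unset Printing Implicit Defensive.

Import Order.TTheory GRing.Theory Num.Theory.

Local Open Scope classical_set_scope.
Local Open Scope ring_scope.

Section iid.
Context {d : measure_display} {T : measurableType d} {R : realType}.

Definition tcons (n : nat) (p : T * n.-tuple T) : n.+1.-tuple T :=
  [the n.+1.-tuple T of p.1 :: p.2].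

Lemma measurable_tcons n : measurable_fun setT (@tcons n).
Proof. exact: measurable_cons. Qed.

HB.instance Definition _ n :=
  isMeasurableFun.Build _ _ _ _ (@tcons n) (@measurable_tcons n).

Fixpoint iid (P : probability T R) (n : nat) : probability (n.-tuple T) R :=
  if n is n'.+1 then distribution (P \x iid P n')%E (@tcons n')
  else dirac [tuple].

End iid.

(* The labels +1 and -1 are encoded as true and false. *)
Definition concept (X : Type) := X -> bool.

(* A randomized learner: it reads a labeled training sample and an unlabeled
   test sample, uses internal randomness drawn from [seed_law], and answers
   REJECT ([None]) or ACCEPT together with a hypothesis. *)
Record learner (R : realType) (d : measure_display) (X : measurableType d) := Learner {
  ntrain : nat;
  ntest : nat;
  seed_display : measure_display;
  seed : measurableType seed_display;
  seed_law : probability seed R;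
  output : ntrain.-tuple (X * bool) -> ntest.-tuple X -> seed -> option (concept X);
  measurable_accept : measurable
    [set z : ntrain.-tuple (X * bool) * ntest.-tuple X * seed |
      output z.1.1 z.1.2 z.2 : bool];
  measurable_hypothesis : measurable
    [set z : ntrain.-tuple (X * bool) * ntest.-tuple X * seed * X |
      if output z.1.1.1 z.1.1.2 z.1.2 is Some h then h z.2 else false] }.

Definition sample_complexity {R d X} (A : @learner R d X) : nat :=
  (ntrain A + ntest A)%N.

Definition label_with {X : Type} (f : concept X) {n} (S : n.-tuple X) :
  n.-tuple (X * bool) := [tuple of [seq (x, f x) | x <- S]].

Definition TDS_learner (R : realType) (d : measure_display) (X : measurableType d)
    (C : set (concept X)) (A : learner R X) (eps delta : R) : Prop :=
  forall (Dtrain Dtest : probability X R) (f : concept X), C f ->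
  ((1 - delta)%:E <=
    (iid Dtrain (ntrain A) \x iid Dtest (ntest A) \x seed_law A)
      [set z | let out := output (label_with f z.1.1) z.1.2 z.2 in
        (forall h, out = Some h -> Dtest [set x | f x != h x] <= eps%:E) /\
        ((forall U, measurable U -> Dtrain U = Dtest U) -> out <> None)])%E.

(* Oracle algorithms: while-programs over a random access memory of natural
   numbers. Domain points and hypotheses returned by the oracle are opaque and
   are only accessed through handles, so a program does not depend on the
   domain. Addition and truncated subtraction are the only arithmetic
   primitives: with unit-cost multiplication the step count would not be
   polynomially related to Turing machine time. *)
Inductive expr : Type :=
| Cst of nat
| Deref of expr
| Add of expr & expr
| Sub of expr & expr.

Fixpoint eval (m : nat -> nat) (e : expr) : nat :=
  match e with
  | Cst n => n
  | Deref a => m (eval m a)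
  | Add a b => (eval m a + eval m b)%N
  | Sub a b => (eval m a - eval m b)%N
  end.

(* [Assign a e]: put the value of e at address a;
   [DrawTrain a b]: draw a labeled training example, put the handle of the point
     at address a and its label at address b;
   [DrawTest a]: draw a test point, put its handle at address a;
   [Flip a]: put a fair coin flip at address a;
   [PushTrain p b], [PushTest p]: append the labeled example (p, b != 0), resp.
     the point p, to the pending training, resp. test, input of the oracle;
   [CallOracle a]: run the oracle, with fresh internal randomness, on the
     pending input and clear it; put at address a either 0 (REJECT) or a
     positive handle for the returned hypothesis; an input of the wrong size is
     rejected;
   [Query a h p]: put at address a the value of hypothesis h at point p.
   Invalid handles are ignored. *)
Inductive cmd : Type :=
| Skip
| Assign of expr & expr
| Seq of cmd & cmd
| If of expr & cmd & cmd
| While of expr & cmd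
| DrawTrain of expr & expr
| DrawTest of expr
| Flip of expr
| PushTrain of expr & expr
| PushTest of expr
| CallOracle of expr
| Query of expr & expr & expr.

Fixpoint sample_free (p : cmd) : bool :=
  match p with
  | Seq p1 p2 | If _ p1 p2 => sample_free p1 && sample_free p2
  | While _ p1 => sample_free p1
  | DrawTrain _ _ | DrawTest _ => false
  | _ => true
  end.

Record store (X : Type) := Store {
  mem : nat -> nat;
  pts : seq X;
  hyps : seq (concept X);
  pend_train : seq (X * bool);
  pend_test : seq X;
  calls : nat;
  draws : nat;
  time : nat }.

Definition upd (m : nat -> nat) (a v : nat) : nat -> nat :=
  fun b => if b == a then v else m b.

Section semantics.
Context {R : realType} {d : measure_display} {X : measurableType d}.
Variables (A : learner R X) (T : nat) (f : concept X).

(* The fresh randomness offered to a single machine step: a training point, a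
   test point, a coin and a seed of the oracle. A step ignores the components
   it does not need. *)
Definition noise : Type := (X * X * bool * seed A)%type.

Definition call_oracle (S : seq (X * bool)) (U : seq X) (r : seed A) :
    option (concept X) :=
  if insub S is Some S' then
    if insub U is Some U' then @output _ _ _ A S' U' r else None
  else None.

(* Every step costs one unit of time; running the oracle, and evaluating a
   hypothesis that it returned, cost T more. *)
Definition step (w : noise) (c : seq cmd * store X) : seq cmd * store X :=
  let: (xtrain, xtest, coin, r) := w in
  let: (k, Store m ps hs tr te nc nd t) := c in
  if k is p :: k then
    match p with
    | Skip => (k, Store m ps hs tr te nc nd t.+1)
    | Assign a e => (k, Store (upd m (eval m a) (eval m e)) ps hs tr te nc nd t.+1)
    | Seq p1 p2 => ([:: p1, p2 & k], Store m ps hs tr te nc nd t.+1)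
    | If e p1 p2 =>
        ((if eval m e != 0%N then p1 else p2) :: k, Store m ps hs tr te nc nd t.+1)
    | While e p1 =>
        (if eval m e != 0%N then [:: p1, While e p1 & k] else k,
         Store m ps hs tr te nc nd t.+1)
    | DrawTrain a b =>
        (k, Store (upd (upd m (eval m a) (size ps)) (eval m b) (f xtrain))
              (rcons ps xtrain) hs tr te nc nd.+1 t.+1)
    | DrawTest a =>
        (k, Store (upd m (eval m a) (size ps)) (rcons ps xtest) hs tr te nc nd.+1 t.+1)
    | Flip a => (k, Store (upd m (eval m a) coin) ps hs tr te nc nd t.+1)
    | PushTrain e b =>
        (k, Store m ps hs
              (if onth ps (eval m e) is Some x then rcons tr (x, eval m b != 0%N)
               else tr) te nc nd t.+1)
    | PushTest e =>
        (k, Store m ps hs tr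
              (if onth ps (eval m e) is Some x then rcons te x else te) nc nd t.+1)
    | CallOracle a =>
        (k, if call_oracle tr te r is Some h
            then Store (upd m (eval m a) (size hs).+1) ps (rcons hs h) [::] [::]
                   nc.+1 nd (t.+1 + T)
            else Store (upd m (eval m a) 0) ps hs [::] [::] nc.+1 nd (t.+1 + T))
    | Query a e1 e2 =>
        let oh := if eval m e1 is n.+1 then onth hs n else None in
        let v := if (oh, onth ps (eval m e2)) is (Some h, Some x) then h x else false in
        (k, Store (upd m (eval m a) v) ps hs tr te nc nd (t.+1 + T))
    end
  else c.

Definition run (p : cmd) (s : store X) (ws : seq noise) : seq cmd * store X :=
  foldl (fun c w => step w c) ([:: p], s) ws.

(* The evaluation of a learned function at x starts from the final store of the
   learning phase, with the handle of x at address 0 and counters reset; its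
   value is read at address 0. *)
Definition query_store (s : store X) (x : X) : store X :=
  Store (upd (mem s) 0 (size (pts s))) (rcons (pts s) x) (hyps s)
    (pend_train s) (pend_test s) 0 0 0.

Definition evaluate (p : cmd) (s : store X) (ws : seq noise) (x : X) : bool :=
  mem (run p (query_store s x) ws).2 0 != 0%N.

Definition noise_law (Dtrain Dtest : probability X R) : probability noise R :=
  (Dtrain \x Dtest \x bernoulli_prob 2^-1 \x seed_law A)%E.

End semantics.

Definition PQ_guarantee (R : realType) (d d' : measure_display)
    (X : measurableType d) (W : measurableType d') (Dtrain Dtest : probability X R)
    (f : concept X) (Q : probability W R) (h g : W -> X -> bool) (err rej : R) : Prop :=
  ((Dtest \x Q \x Q) [set z | f z.1.1 != h z.1.2 z.1.1 /\ g z.2 z.1.1] <= err%:E)%E /\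
  ((Dtrain \x Q) [set z | ~~ g z.2 z.1] <= rej%:E)%E.

(* [learn] is the learning phase, [hyp] and [sel] evaluate the hypothesis h and
   the selector g. *)
Record PQ_program := PQProgram {
  learn : cmd;
  hyp : cmd;
  sel : cmd;
  hyp_sample_free : sample_free hyp;
  sel_sample_free : sample_free sel }.

Definition ceiln {R : realType} (x : R) : nat := `|Num.ceil x|%N.

(* Inputs of the learning phase, at addresses 0, 1, 2 and 3. *)
Definition init_store {R : realType} {d} {X : measurableType d} (A : learner R X)
    (eps delta : R) : store X :=
  Store (nth 0%N [:: ntrain A; ntest A; ceiln eps^-1; ceiln delta^-1])
    [::] [::] [::] [::] 0 0 0.

(* N is the length of the randomness offered to each phase; it must be large
   enough for all the phases to halt, see [resources_within]. *)
Definition PQ_learner (R : realType) (d : measure_display) (X : measurableType d)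
    (C : set (concept X)) (P : PQ_program) (A : learner R X) (T N : nat)
    (eps err rej delta : R) : Prop :=
  forall (Dtrain Dtest : probability X R) (f : concept X), C f ->
  let W := iid (noise_law A Dtrain Dtest) N in
  ((1 - delta)%:E <=
    W [set w | let s := (run T f (learn P) (init_store A eps delta) w).2 in
         PQ_guarantee Dtrain Dtest f W
           (evaluate T f (hyp P) s) (evaluate T f (sel P) s) err rej])%E.

Definition halts_within {R : realType} {X : Type} (T : nat) (B : R)
    (c : seq cmd * store X) : Prop :=
  [/\ c.1 = [::], (calls c.2)%:R <= B, (draws c.2)%:R <= B
    & (time c.2)%:R <= T%:R * B].

(* Worst-case bounds: for every labeling concept and all outcomes of the
   sampling and of the internal randomness. *)
Definition resources_within (R : realType) (d : measure_display)
    (X : measurableType d) (C : set (concept X)) (P : PQ_program)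
    (A : learner R X) (T N : nat) (eps delta B : R) : Prop :=
  forall (f : concept X) (w : N.-tuple (noise A)), C f ->
  let c := run T f (learn P) (init_store A eps delta) w in
  halts_within T B c /\
  forall (x : X) (v : N.-tuple (noise A)),
    halts_within T B (run T f (hyp P) (query_store c.2 x) v) /\
    halts_within T B (run T f (sel P) (query_store c.2 x) v).

(* Main.v *)
From HB Require Import structures.
From mathcomp Require Import all_boot all_order all_algebra.
From mathcomp Require Import all_classical all_reals all_analysis.
From mathcomp Require Import measurable_realfun ring lra zify.
Require Import Defs.

Set Implicit Arguments.
Unset Strict Implicit.
Unset Printing Implicit Defensive.

Import Order.TTheory GRing.Theory Num.Theory.

Local Open Scope classical_set_scope.
Local Open Scope ring_scope.


(* A PQ learner keeps a random integer counter v(x) for every point x, evaluated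
   by rerunning the oracle, and two weights u(v) = q^max(-v, 0) and
   g(v) = q^max(v, 0). In a round the oracle is called on samples of the training
   law reweighted by u and of the test law reweighted by g, obtained by rejection
   sampling; the acceptance by g is the selector of the round, and the returned
   hypothesis is its hypothesis. If the oracle rejects the reweighted pair too
   often, then it distinguishes hybrids between the two laws, and adding its
   answers on a hybrid to the counters decreases the energy
   lambda E_train U(v) + E_test U(-v), where U(v + 1) - U(v) = u(v + 1); extra
   increments keep the masses lambda E_train u and E_test g balanced. Otherwise
   soundness of the oracle gives a round with small test error on accepted points,
   and the balance gives a small rejection rate on the training law. An
   exponential supermartingale in the energy and in the number of bad rounds shows
   that with probability 1 - delta at most a sixth of the rounds is bad, and a
   majority vote over the rounds, rejecting the points that a quarter of the
   rounds rejects, is then a PQ learner. *)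

(** No mass and no rejection probability is ever estimated. The sign of a round is the difference of
    two oracle answers, on a reweighted test sample and on a second reweighted training sample, and
    the function added to the counters comes from an independent record. If s is the expected sign,
    that function integrated against lambda u Dtrain - g Dtest telescopes to about -s E_test g plus
    an imbalance term, so the product with the sign contributes -s^2 E_test g, whatever the sign of
    s. Likewise two coin tosses with increments kappa and kappa * lambda have expected difference
    -kappa D, with D = lambda E_train u - E_test g, and contribute -kappa D^2. Squares need no
    decision about which case holds. The evaluation programs may not draw samples, so all records
    are stored and replayed with fresh oracle randomness; only the law of a counter is meaningful,
    hence the expectations over it. Events of a run need not be measurable: their probabilities are
    bounded by a program logic that carries a bounded measurable bound through each step. *)

Section expectation.
Context {R : realType}.

(** A class stable under all operations used below and integrable for every probability measure, so
    that the real-valued [mean] is linear and monotone on it without further side conditions. *)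
Definition bm {d} {T : measurableType d} (f : T -> R) : Prop :=
  measurable_fun setT f /\ exists M, forall x, `|f x| <= M.

Definition mean {d} {T : measurableType d} (P : probability T R) (f : T -> R) : R :=
  fine (\int[P]_x (f x)%:E)%E.

Lemma mem_setb {T : Type} (b : T -> bool) x : (x \in [set x | b x]) = b x.
Proof. by apply/idP/idP; rewrite inE. Qed.

(** * Expectations of bounded measurable functions, products and i.i.d. samples *)

Section bounded_measurable.
Context {d} {T : measurableType d}.
Implicit Types f g : T -> R.

Lemma bm_cst (r : R) : bm (fun _ : T => r).
Proof. by split; [exact: measurable_cst | exists `|r|]. Qed.

Lemma bmD f g : bm f -> bm g -> bm (fun x => f x + g x).
Proof.
move=> [mf [M fM]] [mg [N gN]]; split; first exact: measurable_funD.
by exists (M + N) => x; rewrite (le_trans (ler_normD _ _))// lerD.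
Qed.

Lemma bmM f g : bm f -> bm g -> bm (fun x => f x * g x).
Proof.
move=> [mf [M fM]] [mg [N gN]]; split; first exact: measurable_funM.
by exists (M * N) => x; rewrite normrM ler_pM.
Qed.

Lemma bmZ (r : R) f : bm f -> bm (fun x => r * f x).
Proof. exact/bmM/bm_cst. Qed.

Lemma bmN f : bm f -> bm (fun x => - f x).
Proof. by move=> /(bmZ (-1)); under eq_fun do rewrite mulN1r. Qed.

Lemma bmB f g : bm f -> bm g -> bm (fun x => f x - g x).
Proof. by move=> bf /bmN; exact: bmD. Qed.

Lemma bm_sum (I : Type) (s : seq I) (F : I -> T -> R) :
  (forall i, bm (F i)) -> bm (fun x => \sum_(i <- s) F i x).
Proof.
move=> bF; elim: s => [|i s IH].
  by under eq_fun do rewrite big_nil; exact: bm_cst.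
by under eq_fun do rewrite big_cons; exact: bmD.
Qed.

Lemma bm_max0 f : bm f -> bm (fun x => Num.max (f x) 0).
Proof.
move=> [mf [M fM]]; split.
  exact: (measurable_maxr mf (measurable_cst _)).
exists M => x; rewrite (le_trans _ (fM x))// /Num.max; case: ifP => // _.
by rewrite normr0.
Qed.

Lemma bm_indic (b : T -> bool) : measurable [set x | b x] ->
  bm (fun x => (b x)%:R : R).
Proof.
move=> mb; split.
  rewrite (_ : (fun x => _) = (\1_[set x | b x] : T -> R)).
    exact: measurable_indic.
  by apply/funext => x; rewrite indicE mem_setb.
by exists 1 => x; case: (b x); rewrite ?normr1// normr0.
Qed.

Lemma bm_comp {d'} {T' : measurableType d'} (g : T' -> T) (f : T -> R) :
  measurable_fun setT g -> bm f -> bm (fun x => f (g x)).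
Proof.
by move=> mg [mf [M fM]]; split; [exact: measurableT_comp | exists M].
Qed.

End bounded_measurable.

Section mean.
Context {d} {T : measurableType d}.
Variable P : probability T R.
Implicit Types f g : T -> R.

Lemma bm_integrable f : bm f -> P.-integrable setT (EFin \o f).
Proof.
move=> [mf [M fM]]; apply: measurable_bounded_integrable => //.
  by rewrite (le_lt_trans (probability_le1 _ _))// ltry.
by exists M; split; [exact: num_real | move=> N MN x _; exact/(le_trans (fM x))/ltW].
Qed.

Lemma EFin_mean f : bm f -> (\int[P]_x (f x)%:E)%E = (mean P f)%:E.
Proof.
by move=> bf; rewrite /mean fineK//; exact: integrable_fin_num (bm_integrable bf).
Qed.

Lemma eq_mean f g : f =1 g -> mean P f = mean P g.
Proof. by move=> fg; congr fine; apply: eq_integral => x _; rewrite fg. Qed.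

Lemma mean_cst r : mean P (fun=> r) = r.
Proof. by rewrite /mean integral_cst//= probability_setT mule1. Qed.

Lemma meanD f g : bm f -> bm g -> mean P (fun x => f x + g x) = mean P f + mean P g.
Proof. by move=> bf bg; apply: RintegralD => //; exact: bm_integrable. Qed.

Lemma meanB f g : bm f -> bm g -> mean P (fun x => f x - g x) = mean P f - mean P g.
Proof. by move=> bf bg; apply: RintegralB => //; exact: bm_integrable. Qed.

Lemma meanZ r f : bm f -> mean P (fun x => r * f x) = r * mean P f.
Proof. by move=> bf; apply: RintegralZl => //; exact: bm_integrable. Qed.

Lemma mean_sum (I : Type) (s : seq I) (F : I -> T -> R) :
  (forall i, bm (F i)) ->
  mean P (fun x => \sum_(i <- s) F i x) = \sum_(i <- s) mean P (F i).
Proof.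
move=> bF; elim: s => [|i s IH].
  by rewrite big_nil -[RHS]mean_cst; apply: eq_mean => x; rewrite big_nil.
rewrite big_cons -IH -meanD//; last exact: bm_sum.
by apply: eq_mean => x; rewrite big_cons.
Qed.

Lemma le_mean f g : bm f -> bm g -> (forall x, f x <= g x) -> mean P f <= mean P g.
Proof.
by move=> bf bg fg; apply: le_Rintegral => //; exact: bm_integrable.
Qed.

Lemma mean_ge0 f : (forall x, 0 <= f x) -> 0 <= mean P f.
Proof. by move=> f0; apply: Rintegral_ge0. Qed.

Lemma mean_le1 f : bm f -> (forall x, f x <= 1) -> mean P f <= 1.
Proof. by move=> bf f1; rewrite -(mean_cst 1); apply: le_mean => //; exact: bm_cst. Qed.

Lemma mean_dist f g (e : R) : bm f -> bm g -> (forall x, `|f x - g x| <= e) ->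
  `|mean P f - mean P g| <= e.
Proof.
move=> bf bg fg; have bfg := bmB bf bg; rewrite -meanB// ler_norml.
have h x : - e <= f x - g x <= e by rewrite -ler_norml.
apply/andP; split; [rewrite -(mean_cst (- e))|rewrite -[leRHS](mean_cst e)].
  by apply: le_mean => // [|x]; [exact: bm_cst | case/andP: (h x)].
by apply: le_mean => // [|x]; [exact: bm_cst | case/andP: (h x)].
Qed.

Lemma mean_indic (b : T -> bool) : measurable [set x | b x] ->
  (mean P (fun x => (b x)%:R))%:E = P [set x | b x].
Proof.
move=> mb; rewrite -EFin_mean; last exact: bm_indic.
rewrite -[[set x | b x]]setIT -integral_indic//.
by apply: eq_integral => x _; rewrite indicE mem_setb.
Qed.

(* The integral of a nonnegative function is a supremum over the simple
   functions below it, hence is monotone without any measurability. *)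
Lemma le_integral_nonmeas (f g : T -> \bar R) : (forall x, 0 <= f x)%E ->
  (forall x, f x <= g x)%E -> (\int[P]_x f x <= \int[P]_x g x)%E.
Proof.
move=> f0 fg; have g0 x : (0 <= g x)%E := le_trans (f0 x) (fg x).
rewrite !ge0_integralTE//; apply: le_ereal_sup => _ [h /= hf <-].
by exists h => // x; rewrite (le_trans (hf x)).
Qed.

End mean.

Section mean_prod.
Context {d1 d2} {T1 : measurableType d1} {T2 : measurableType d2}.
Variables (P : probability T1 R) (Q : probability T2 R).
Variable f : T1 * T2 -> R.
Hypothesis bf : bm f.

Lemma bm_pair1 x : bm (fun y => f (x, y)).
Proof. exact: bm_comp bf. Qed.

Lemma bm_pair2 y : bm (fun x => f (x, y)).
Proof. exact: bm_comp bf. Qed.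

Lemma bm_mean : bm (fun x => mean Q (fun y => f (x, y))).
Proof.
have [mf [M fM]] := bf; split; last first.
  exists M => x.
  rewrite -[mean _ _]subr0 -(mean_cst Q 0); apply: mean_dist.
  - exact: bm_pair1.
  - exact: bm_cst.
  - by move=> y; rewrite subr0.
(* Adding the bound [M] makes the integrand nonnegative, as the measurability part of the Tonelli
   theorem requires; the constant is subtracted again. *)
have bg : bm (fun z => f z + M) := bmD bf (bm_cst _).
rewrite (_ : (fun x => _) = (fun x => fine (fubini_F Q (EFin \o (fun z => f z + M)) x) - M)).
  apply: measurable_funB => //; apply: measurableT_comp => //.
  apply: measurable_fun_fubini_tonelli_F => [|x].
    by apply/measurable_EFinP; case: bg.
  by rewrite lee_fin -lerBlDr sub0r; have := fM x; rewrite ler_norml => /andP[].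
apply/funext => x; rewrite -/(mean Q (fun y => f (x, y) + M)).
by rewrite meanD ?mean_cst ?addrK//; [exact: bm_pair1 | exact: bm_cst].
Qed.

Lemma mean_prod : mean (P \x Q)%E f = mean P (fun x => mean Q (fun y => f (x, y))).
Proof.
apply/EFin_inj; rewrite -!EFin_mean//; last exact: bm_mean.
rewrite -[LHS](integral12_prod_meas1 (bm_integrable (P \x Q)%E bf)).
apply: eq_integral => x _; rewrite -EFin_mean//; exact: bm_pair1.
Qed.

Lemma mean_swap : mean P (fun x => mean Q (fun y => f (x, y))) =
  mean Q (fun y => mean P (fun x => f (x, y))).
Proof.
rewrite -mean_prod; apply/EFin_inj; rewrite -!EFin_mean//.
  rewrite -[LHS](integral21_prod_meas1 (bm_integrable (P \x Q)%E bf)).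
  by apply: eq_integral => x _; rewrite -EFin_mean//; exact: bm_pair2.
split; last first.
  have [_ [M fM]] := bf; exists M => y.
  rewrite -[mean _ _]subr0 -(mean_cst P 0); apply: mean_dist.
  - exact: bm_pair2.
  - exact: bm_cst.
  - by move=> x; rewrite subr0.
apply: measurableT_comp => //.
exact: (@measurable_fubini_G _ _ _ _ _ P Q _ (bm_integrable (P \x Q)%E bf)).
Qed.

End mean_prod.

Lemma mean_distribution {d d'} {T : measurableType d} {T' : measurableType d'}
    (P : probability T R) (g : {mfun T >-> T'}) (f : T' -> R) : bm f ->
  mean (distribution P g) f = mean P (fun x => f (g x)).
Proof.
move=> bf; rewrite /mean integral_distribution//.
- by apply/measurable_EFinP; case: bf.
- by apply: (bm_integrable P (f := fun x => f (g x))); exact: bm_comp bf.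
Qed.

Lemma mean_iidS {d} {T : measurableType d} (P : probability T R) n
    (f : n.+1.-tuple T -> R) : bm f ->
  mean (iid P n.+1) f = mean P (fun x => mean (iid P n) (fun z => f (tcons (x, z)))).
Proof.
move=> bf; rewrite /= mean_distribution// mean_prod//.
by apply: bm_comp bf; exact: measurable_tcons.
Qed.

Lemma bm_tcons {d} {T : measurableType d} n (f : n.+1.-tuple T -> R) :
  bm f -> bm (fun z : T * n.-tuple T => f (tcons z)).
Proof. by move=> bf; apply: bm_comp bf; exact: measurable_tcons. Qed.

Lemma mean_iid0 {d} {T : measurableType d} (P : probability T R)
    (f : 0.-tuple T -> R) : bm f -> mean (iid P 0) f = f [tuple].
Proof.
move=> [mf _]; have mf' : measurable_fun setT (EFin \o f) by exact/measurable_EFinP.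
by rewrite /mean /= (integral_dirac _ _ mf')//= indicT mul1r.
Qed.

Definition tset {T : Type} n (i : nat) (x : T) (z : n.-tuple T) : n.-tuple T :=
  [tuple (if j == i :> nat then x else tnth z j) | j < n].

Lemma measurable_tset {d} {T : measurableType d} n i :
  measurable_fun setT (fun z : T * n.-tuple T => tset i z.1 z.2).
Proof.
apply/measurable_fun_tnthP => j /=.
under [X in measurable_fun _ X]eq_fun do rewrite /= tnth_mktuple.
case: (nat_of_ord j == i); first exact: measurable_fst.
apply: (@measurableT_comp _ _ _ _ _ _ (fun z : n.-tuple T => tnth z j)) => //=.
exact: measurable_tnth.
Qed.

Lemma tset_tcons0 {d} {T : measurableType d} n (x y : T) (z : n.-tuple T) :
  tset 0 x (tcons (y, z)) = tcons (x, z).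
Proof.
apply: eq_from_tnth => j; rewrite tnth_mktuple.
by case: (unliftP ord0 j) => [j' ->|->] //=; rewrite !tnthS.
Qed.

Lemma tset_tconsS {d} {T : measurableType d} n i (x y : T) (z : n.-tuple T) :
  tset i.+1 x (tcons (y, z)) = tcons (y, tset i x z).
Proof.
apply: eq_from_tnth => j; rewrite tnth_mktuple.
case: (unliftP ord0 j) => [j' ->|->] //=.
by rewrite /bump/= add1n eqSS !tnthS tnth_mktuple.
Qed.

(** Overwriting one coordinate by a fresh draw preserves the law of the sample. Through this, a
    sample with the point x planted in place i becomes an honest sample once x is averaged over the
    right law. *)
Lemma mean_iid_resample {d} {T : measurableType d} (P : probability T R) n i
    (f : n.-tuple T -> R) : (i < n)%N -> bm f ->
  mean (iid P n) (fun z => mean P (fun x => f (tset i x z))) = mean (iid P n) f.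
Proof.
elim: n i f => [//|n IH] i f ltin bf.
have bt : bm (fun w : n.+1.-tuple T * T => f (tset i w.2 w.1)).
  apply: (bm_comp _ bf).
  exact: (measurableT_comp (@measurable_tset _ T n.+1 i)
    (measurable_fun_pair measurable_snd measurable_fst)).
rewrite !mean_iidS//; last first.
  exact: (bm_mean P bt).
case: i ltin bt => [_ _|i ltin _].
  transitivity (mean P (fun _ : T => mean P (fun x => mean (iid P n)
      (fun z => f (tcons (x, z)))))); last by rewrite mean_cst.
  apply: eq_mean => y; rewrite (mean_swap P (iid P n) (bm_tcons bf)).
  by apply: eq_mean => z; apply: eq_mean => x; rewrite tset_tcons0.
apply: eq_mean => y.
rewrite -(IH i (fun z => f (tcons (y, z))))//; last first.
  exact: bm_pair1 (bm_tcons bf) y.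
by apply: eq_mean => z; apply: eq_mean => x; rewrite tset_tconsS.
Qed.

Lemma mean_uniform (c : R) : 0 <= c <= 1 ->
  mean (uniform_prob (@ltr01 R)) (fun y => (y <= c)%R%:R) = c.
Proof.
move=> /andP[c0 c1]; apply/EFin_inj.
have mc : measurable [set y : measurableTypeR R | y <= c].
  by rewrite -set_itvNyc; exact: measurable_itv.
rewrite -EFin_mean; last exact: bm_indic.
rewrite integral_uniform//=; last 1 first.
  by apply/measurable_EFinP; have [] := bm_indic mc.
rewrite subr0 invr1 mul1e.
rewrite (eq_integral (fun y : measurableTypeR R => (\1_[set y : measurableTypeR R | (y <= c)%R] y)%:E)); last first.
  by move=> y _; rewrite indicE (mem_setb (fun y : measurableTypeR R => (y <= c)%R)).
rewrite integral_indic//= (_ : _ `&` _ = `[0%R, c]%classic); last first.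
  apply/seteqP; split => y /=; rewrite !in_itv/=.
    by move=> [yc /andP[-> _]].
  by move=> /andP[y0 yc]; split=> //; rewrite y0 (le_trans yc).
rewrite lebesgue_measure_itv/= lte_fin; case: ltP => [_|c0'].
  by rewrite sube0.
by congr EFin; apply/eqP; rewrite eq_le c0 c0'.
Qed.

(** * Rejection sampling with a bounded number of tries *)

Section sampler.
Context {d} {X : measurableType d}.
Variables (P : probability X R) (u : X -> R).
Hypotheses (bu : bm u) (u01 : forall x, 0 <= u x <= 1).

Definition mix_map (z : X * measurableTypeR R * X) : X :=
  if z.1.2 <= u z.1.1 then z.1.1 else z.2.

Lemma measurable_mix_map : measurable_fun setT mix_map.
Proof.
apply: measurable_fun_ifT => //=.
- apply: measurable_fun_ler => //=.
    by apply: (measurableT_comp measurable_snd); exact: measurable_fst.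
  apply: (measurableT_comp bu.1).
  by apply: (measurableT_comp measurable_fst); exact: measurable_fst.
- by apply: (measurableT_comp measurable_fst); exact: measurable_fst.
Qed.

HB.instance Definition _ := isMeasurableFun.Build _ _ _ _ mix_map measurable_mix_map.

(** At most r + 1 draws: a draw is kept with probability [u], and the last one unconditionally, so
    that no lower bound on the mass of [u] is needed for termination. *)
Fixpoint sampler (r : nat) : probability X R :=
  if r is r'.+1 then
    distribution (P \x uniform_prob (@ltr01 R) \x sampler r')%E mix_map
  else P.

Lemma mean_samplerS r f : bm f -> mean (sampler r.+1) f =
  mean P (fun x => u x * f x + (1 - u x) * mean (sampler r) f).
Proof.
move=> bf; rewrite /= mean_distribution//.
have bg : bm (fun z => f (mix_map z)) by apply: bm_comp bf; exact: measurable_mix_map.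
rewrite mean_prod// mean_prod; last exact: (bm_mean (sampler r) bg).
apply: eq_mean => x.
have bi : bm (fun y : measurableTypeR R => (y <= u x)%R%:R : R).
  by apply: bm_indic; rewrite -set_itvNyc; exact: measurable_itv.
transitivity (mean (uniform_prob (@ltr01 R)) (fun y => (y <= u x)%R%:R *
    (f x - mean (sampler r) f) + mean (sampler r) f)).
  apply: eq_mean => y; case: (boolP (y <= u x)%R) => yu.
    rewrite mul1r subrK -[RHS](mean_cst (sampler r)).
    by apply: eq_mean => z; rewrite /= /mix_map /= yu.
  rewrite mul0r add0r; apply: eq_mean => z.
  by rewrite /= /mix_map /= (negbTE yu).
rewrite meanD; [|exact: bmM bi (bm_cst _)|exact: bm_cst].
under [X in mean _ X]eq_fun do rewrite mulrC.
rewrite meanZ// mean_uniform// mean_cst; ring.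
Qed.

End sampler.
End expectation.

(** Induction gives (1 - a)^r (1 + r a) <= 1, and (r + 1) a <= 1 + r a because a <= 1. *)
Lemma le_mul_expr_inv {R : realType} (a : R) r : 0 <= a <= 1 ->
  a * (1 - a) ^+ r <= (r.+1)%:R^-1.
Proof.
move=> /andP[a0 a1]; have b0 : 0 <= 1 - a by rewrite subr_ge0.
rewrite -[leRHS]mul1r ler_pdivlMr ?ltr0n//.
have H : (1 - a) ^+ r * (1 + r%:R * a) <= 1.
  elim: r => [|r IH]; first by rewrite expr0 mul0r addr0 mulr1.
  rewrite exprS; have p0 : 0 <= (1 - a) ^+ r by exact: exprn_ge0.
  apply: le_trans IH; rewrite -[r.+1]addn1 natrD.
  rewrite [leLHS](_ : _ = (1 - a) ^+ r * ((1 - a) * (1 + (r%:R + 1) * a))); last by ring.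
  apply: ler_wpM2l => //; have r0 : 0 <= r%:R :> R by rewrite ler0n.
  nra.
apply: le_trans H; rewrite mulrC mulrA; rewrite -[leRHS]mulrC.
apply: ler_wpM2r; first exact: exprn_ge0.
rewrite -addn1 natrD; nra.
Qed.

Section sampler_approx.
Context {R : realType} {d} {X : measurableType d}.
Variables (P : probability X R) (u : X -> R).
Hypotheses (bu : bm u) (u01 : forall x, 0 <= u x <= 1).
Variable f : X -> R.
Hypotheses (bf : bm f) (f01 : forall x, 0 <= f x <= 1).

Let u0 x : 0 <= u x. Proof. by case/andP: (u01 x). Qed.
Let f0 x : 0 <= f x. Proof. by case/andP: (f01 x). Qed.
Let f1 x : f x <= 1. Proof. by case/andP: (f01 x). Qed.

(** Every additional try multiplies the deviation by exactly 1 - a, where a is the mass of [u], and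
    the deviation starts at absolute value at most a. Since the mass multiplies the sampled mean,
    the bound does not deteriorate when a is tiny. *)
Lemma sampler_approx r :
  `|mean P u * mean (sampler P bu r) f - mean P (fun x => u x * f x)| <= (r.+1)%:R^-1.
Proof.
set a := mean P u; set m := mean P _.
have buf : bm (fun x => u x * f x) := bmM bu bf.
have a0 : 0 <= a by exact: mean_ge0.
have a1 : a <= 1 by apply: mean_le1 => // x; case/andP: (u01 x).
have m0 : 0 <= m by apply: mean_ge0 => x; exact: mulr_ge0.
have ma : m <= a by apply: le_mean => // x; rewrite ler_piMr.
have E : a * mean (sampler P bu r) f - m = (1 - a) ^+ r * (a * mean P f - m).
  elim: r => [|r IH]; first by rewrite expr0 mul1r.
  rewrite mean_samplerS// exprS -mulrA -IH.
  rewrite meanD//; last by apply: bmM; [exact: bmB (bm_cst _) bu | exact: bm_cst].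
  under [X in a * (_ + mean P X) - _]eq_fun do rewrite mulrC.
  rewrite meanZ; last exact: bmB (bm_cst _) bu.
  rewrite meanB ?mean_cst//; last exact: bm_cst.
  rewrite -/a -/m; ring.
rewrite E normrM ger0_norm; last by rewrite exprn_ge0// subr_ge0.
apply: le_trans (le_mul_expr_inv (a := a) r _); last by rewrite a0.
rewrite mulrC; apply: ler_wpM2r; first by rewrite exprn_ge0// subr_ge0.
have mf0 : 0 <= mean P f by exact: mean_ge0.
have mf1 : mean P f <= 1 by exact: mean_le1.
rewrite ler_norml; apply/andP; split; nra.
Qed.

End sampler_approx.

(** * A program logic for upper bounds on the probability of a bad final store *)

Section program_logic.
Context {R : realType} {d : measure_display} {X : measurableType d}.
Variables (A : learner R X) (T : nat) (f : concept X).
Variables (Dtrain Dtest : probability X R).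
Variables (Post G : store X -> Prop).

Let mu := noise_law A Dtrain Dtest.

(* [J n c v]: whatever the noise, the configuration [c] halts within [n] steps
   in a store satisfying [Post], and the final store satisfies [G] with
   probability at most [v]. *)
Inductive J : nat -> seq cmd * store X -> R -> Prop :=
| J_halt n s v : Post s -> 0 <= v -> (G s -> 1 <= v) -> J n ([::], s) v
| J_step n p k s (kap : X * X * bool * seed A -> R) v : bm kap ->
    (forall w, J n (step T f (w : noise A) (p :: k, s)) (kap w)) ->
    mean mu kap <= v -> J n.+1 (p :: k, s) v.

Lemma J_weak n n' c v v' : J n c v -> (n <= n')%N -> v <= v' -> J n' c v'.
Proof.
move=> H; elim: H n' v' => {n c v}.
  move=> n s v Ps v0 Gv n' v' _ vv'.
  by apply: J_halt => // [|/Gv Gv']; [exact: le_trans vv' | exact: le_trans vv'].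
move=> n p k s kap v bk _ IH kv [//|n'] v' nn' vv'.
by apply: (J_step bk) => [w|]; [exact: IH | exact: le_trans vv'].
Qed.

Lemma J_ge0 n c v : J n c v -> 0 <= v.
Proof.
elim=> {n c v}// n p k s kap v bk _ k0 kv.
by apply: le_trans kv; exact: mean_ge0.
Qed.

Lemma halted (s : store X) (ws : seq (noise A)) :
  foldl (fun c w => step T f w c) ([::], s) ws = ([::], s).
Proof. by elim: ws => //= -[[[? ?] ?] ?] ws IH; case: s IH. Qed.

Lemma J_halts n c v : J n c v -> forall ws : seq (noise A), (n <= size ws)%N ->
  let c' := foldl (fun c w => step T f w c) c ws in
  [/\ c'.1 = [::], Post c'.2 & c' = foldl (fun c w => step T f w c) c (take n ws)].
Proof.
elim=> {n c v}.
  by move=> n s v Ps _ _ ws _ /=; rewrite !halted.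
move=> n p k s kap v _ _ IH _ [//|w ws] nws.
exact: (IH w ws nws).
Qed.

(** The product measure is by definition the integral of the measures of sections, so the identity
    holds for arbitrary sets; this allows peeling one step of noise off an event that may not be
    measurable. *)
Lemma iidS_set (N : nat) (S : set (N.+1.-tuple (noise A))) :
  iid mu N.+1 S = (\int[mu]_w (iid mu N) [set ws | S (tcons (w, ws))])%E.
Proof.
apply: eq_integral => w _; congr (iid mu N _).
by apply/seteqP; split => ws /=; rewrite /xsection/= inE.
Qed.

Lemma J_upper n c v : J n c v -> forall N, (n <= N)%N ->
  (iid mu N [set w | G (foldl (fun c w => step T f w c) c (w : seq (noise A))).2]
   <= v%:E)%E.
Proof.
elim=> {n c v}.
  move=> n s v _ v0 Gv N _; case: (pselect (G s)) => Gs.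
    apply: le_trans (_ : 1%:E <= _)%E; last by rewrite lee_fin Gv.
    rewrite [X in iid mu N X](_ : _ = setT) ?probability_setT//.
    by apply/seteqP; split => //= w _; rewrite halted.
  rewrite [X in iid mu N X](_ : _ = set0) ?measure0//.
  by apply/seteqP; split => //= w; rewrite halted.
move=> n p k s kap v bk _ IH kv [//|N] nN; rewrite iidS_set.
apply: le_trans (_ : (mean mu kap)%:E <= _)%E; last by rewrite lee_fin.
rewrite -EFin_mean//; apply: le_integral_nonmeas => [w|w]; first exact: measure_ge0.
exact: IH.
Qed.

(** Without measurability of the event this does not follow from [J_upper] by complementation, so
    the induction is carried out again on the complement. *)
Lemma J_lower n c v : J n c v -> forall N, (n <= N)%N ->
  ((1 - v)%:E <=
   iid mu N [set w | ~ G (foldl (fun c w => step T f w c) c (w : seq (noise A))).2])%E.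
Proof.
elim=> {n c v}.
  move=> n s v _ v0 Gv N _; case: (pselect (G s)) => Gs.
    by rewrite (le_trans _ (measure_ge0 _ _))// lee_fin subr_le0 Gv.
  rewrite [X in iid mu N X](_ : _ = setT).
    by rewrite probability_setT lee_fin gerBl.
  by apply/seteqP; split => //= w _; rewrite halted.
move=> n p k s kap v bk _ IH kv [//|N] nN; rewrite iidS_set.
have b1 : bm (fun w => 1 - kap w) := bmB (bm_cst _) bk.
(* The truncation at 0 is needed because monotonicity of the integral of arbitrary functions is
   available only for nonnegative ones. *)
apply: le_trans (_ : (mean mu (fun w => Num.max (1 - kap w) 0))%:E <= _)%E.
  rewrite lee_fin (@le_trans _ _ (mean mu (fun w => 1 - kap w)))//.
    by rewrite meanB ?mean_cst ?lerB//; exact: bm_cst.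
  by apply: le_mean => //; [exact: bm_max0 | move=> w; rewrite le_max lexx].
rewrite -EFin_mean; last exact: bm_max0.
apply: le_integral_nonmeas => [w|w]; first by rewrite lee_fin le_max lexx orbT.
rewrite EFin_max ge_max; apply/andP; split; first exact: IH.
exact: measure_ge0.
Qed.

Lemma foldl_counters (c : seq cmd * store X) (ws : seq (noise A)) :
  let c' := foldl (fun c w => step T f w c) c ws in
  [/\ (calls c'.2 <= calls c.2 + size ws)%N, (draws c'.2 <= draws c.2 + size ws)%N
    & (time c'.2 <= time c.2 + size ws * T.+1)%N].
Proof.
elim: ws c => [|w ws IH] c /=; first by rewrite !addn0.
have [h1 h2 h3] := IH (step T f w c).
suff [g1 g2 g3] : [/\ (calls (step T f w c).2 <= (calls c.2).+1)%N,
    (draws (step T f w c).2 <= (draws c.2).+1)%N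
  & (time (step T f w c).2 <= time c.2 + T.+1)%N].
  split; [lia|lia|]; rewrite mulSn; lia.
case: w {IH h1 h2 h3} => -[[xa xb] b] r; case: c => [[|p k] [m ps hs tr te nc nd t]] /=.
  by split; lia.
case: p => *; rewrite /=; try (by split; lia).
by case: (call_oracle _ _ _) => [?|] /=; split; lia.
Qed.

Lemma J_resources n c v (B : R) (N : nat) (w : N.-tuple (noise A)) :
  J n c v -> (n <= N)%N -> calls c.2 = 0%N -> draws c.2 = 0%N -> time c.2 = 0%N ->
  (0 < T)%N -> (n * 2)%:R <= B ->
  halts_within T B (foldl (fun c w => step T f w c) c w).
Proof.
move=> HJ nN c0 d0 t0 T0 nB; have sw : (n <= size w)%N by rewrite size_tuple.
have [h1 _ E] := J_halts HJ sw.
have [] := foldl_counters c (take n w); rewrite -E c0 d0 t0 !add0n size_takel//.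
move=> h2 h3 h4; split => //.
- by apply: le_trans nB; rewrite ler_nat; lia.
- by apply: le_trans nB; rewrite ler_nat; lia.
(* A step costs at most [T + 1] units of time, and [T + 1 <= 2 * T] because [T] is positive. *)
- apply: le_trans (_ : T%:R * (n * 2)%:R <= _); last by rewrite ler_wpM2l.
  rewrite -natrM ler_nat; nia.
Qed.

Lemma J_det n p k s c v :
  (forall w : noise A, step T f w (p :: k, s) = c) -> J n c v -> J n.+1 (p :: k, s) v.
Proof.
move=> E HJ; apply: (@J_step _ _ _ _ (fun=> v)); first exact: bm_cst.
  by move=> w; rewrite E.
by rewrite mean_cst.
Qed.

Let mean_mu (kap : X * X * bool * seed A -> R) : bm kap -> mean mu kap =
  mean Dtrain (fun x => mean Dtest (fun y => mean (bernoulli_prob 2^-1)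
    (fun b => mean (seed_law A) (fun r => kap (x, y, b, r))))).
Proof.
move=> bk; rewrite /mu /noise_law mean_prod//.
have b1 := bm_mean (seed_law A) bk; rewrite mean_prod//.
by rewrite mean_prod//; exact: (bm_mean (bernoulli_prob 2^-1) b1).
Qed.

Lemma J_train n a b k m ps hs tr te nc nd t (kap : X -> R) : bm kap ->
  (forall x, J n (k, Store (upd (upd m (eval m a) (size ps)) (eval m b) (f x))
              (rcons ps x) hs tr te nc nd.+1 t.+1) (kap x)) ->
  J n.+1 (DrawTrain a b :: k, Store m ps hs tr te nc nd t) (mean Dtrain kap).
Proof.
move=> bk H; have bk' : bm (fun w : X * X * bool * seed A => kap w.1.1.1).
  by apply: (bm_comp _ bk); do 2! apply: (measurableT_comp measurable_fst).
apply: (@J_step _ _ _ _ _ _ bk'); first by move=> [[[x y] c] r]; exact: H.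
by rewrite mean_mu//= (eq_mean _ (g := kap))// => x; rewrite !mean_cst.
Qed.

Lemma J_test n a k m ps hs tr te nc nd t (kap : X -> R) : bm kap ->
  (forall x, J n (k, Store (upd m (eval m a) (size ps)) (rcons ps x) hs tr te nc
              nd.+1 t.+1) (kap x)) ->
  J n.+1 (DrawTest a :: k, Store m ps hs tr te nc nd t) (mean Dtest kap).
Proof.
move=> bk H; have bk' : bm (fun w : X * X * bool * seed A => kap w.1.1.2).
  apply: (bm_comp _ bk); apply: (measurableT_comp measurable_snd).
  by apply: (measurableT_comp measurable_fst).
apply: (@J_step _ _ _ _ _ _ bk'); first by move=> [[[x y] c] r]; exact: H.
by rewrite mean_mu//= mean_cst (eq_mean _ (g := kap))// => y; rewrite !mean_cst.
Qed.

Lemma J_oracle n a k m ps hs tr te nc nd t (kap : seed A -> R) : bm kap ->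
  (forall r, J n (k, if call_oracle tr te r is Some h
            then Store (upd m (eval m a) (size hs).+1) ps (rcons hs h) [::] [::]
                   nc.+1 nd (t.+1 + T)
            else Store (upd m (eval m a) 0) ps hs [::] [::] nc.+1 nd (t.+1 + T))
     (kap r)) ->
  J n.+1 (CallOracle a :: k, Store m ps hs tr te nc nd t) (mean (seed_law A) kap).
Proof.
move=> bk H; have bk' : bm (fun w : X * X * bool * seed A => kap w.2).
  by apply: (bm_comp _ bk).
apply: (@J_step _ _ _ _ _ _ bk'); first by move=> [[[x y] c] r]; exact: H.
by rewrite mean_mu//= !mean_cst.
Qed.

Lemma J_flip n a k m ps hs tr te nc nd t v1 v0 :
  J n (k, Store (upd m (eval m a) 1) ps hs tr te nc nd t.+1) v1 ->
  J n (k, Store (upd m (eval m a) 0) ps hs tr te nc nd t.+1) v0 ->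
  J n.+1 (Flip a :: k, Store m ps hs tr te nc nd t) ((v1 + v0) / 2).
Proof.
move=> H1 H0; pose kap (b : bool) := if b then v1 else v0.
have bk : bm kap.
  by split => //; exists (Num.max `|v1| `|v0|) => -[]; rewrite le_max lexx// orbT.
have bk' : bm (fun w : X * X * bool * seed A => kap w.1.2).
  apply: (bm_comp _ bk); apply: (measurableT_comp measurable_snd).
  exact: measurable_fst.
apply: (@J_step _ _ _ _ _ _ bk'); first by move=> [[[x y] []] r].
rewrite mean_mu//= !mean_cst.
rewrite (_ : mean _ _ = mean (bernoulli_prob 2^-1) kap); last first.
  by apply: eq_mean => c; rewrite mean_cst.
rewrite /mean integral_bernoulli_prob.
- by rewrite /= /unstable.onem; lra.
- by lra.
- by case; rewrite lee_fin; [exact: J_ge0 H1 | exact: J_ge0 H0].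
Qed.

End program_logic.

(** * The program *)

Fixpoint blk (l : seq cmd) : cmd := if l is c :: l' then Seq c (blk l') else Skip.

Notation "a <~ e" := (Assign (Cst a) e) (at level 70, only parsing).
Notation V a := (Deref (Cst a)).
Notation "x :+: y" := (Add x y) (at level 50, left associativity, only parsing).
Notation "x :-: y" := (Sub x y) (at level 50, left associativity, only parsing).

(* Registers: 1 ntest, 4 ntrain, 6 number k of coins per factor q = 1 - 2^-k,
   7 number of tries of a sampler, 8 and 9 the increments kappa and
   kappa * lambda, 10 number of rounds, 12 end of the tape, 13 rounds to go;
   20-38 scratch; the tape starts at address 64. *)
Definition flips := While (V 23)
  (blk [:: Flip (Cst 24); 22 <~ V 22 :+: V 24; 23 <~ V 23 :-: Cst 1]).

(** A pass clears register 20 only when all [V 6] flips are tails, so after E passes it is still set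
    with probability q^E, q = 1 - 2^-k. Fair coins thus realize the weights without any real
    arithmetic. *)
Definition coin_loop := While (V 21)
  (blk [:: 21 <~ V 21 :-: Cst 1; 22 <~ Cst 0; 23 <~ V 6; flips;
           If (V 22) Skip (20 <~ Cst 0)]).

Definition coin (e : expr) := blk [:: 20 <~ Cst 1; 21 <~ e; coin_loop].

Definition push_train := While (V 4 :-: V 25)
  (blk [:: PushTrain (Deref (V 27 :+: V 25 :+: V 25))
             (Deref (V 27 :+: V 25 :+: V 25 :+: Cst 1));
           25 <~ V 25 :+: Cst 1]).

Definition push_test := While (V 1 :-: V 25)
  (blk [:: If (V 28 :-: V 25)
             (PushTest (Deref (V 27 :+: V 4 :+: V 4 :+: V 1 :+: V 1 :+: V 25 :+: V 25)))
             (If (V 25 :-: V 28)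
                (PushTest (Deref (V 27 :+: V 4 :+: V 4 :+: V 25 :+: V 25)))
                (PushTest (V 31)));
           25 <~ V 25 :+: Cst 1]).

(* Runs the oracle on the record at address [V 27], with the test sample made of
   the points G_j (j < i), the point [V 31] and the points P_j (j > i), where
   i = [V 28]. *)
Definition hybrid :=
  blk [:: 25 <~ Cst 0; push_train; 25 <~ Cst 0; push_test; CallOracle (Cst 26)].

(** A record consists of pairs (handle, label): [ntrain] of them for the labeled sample, then
    [ntest] for each of the two hybrid samples. Five cells follow: the constant increments of the
    two counters (0, 1), the two signs (2, 3) and the handle of the hypothesis (4). *)
Definition flag (i : nat) :=
  Deref (V 27 :+: V 4 :+: V 4 :+: V 1 :+: V 1 :+: V 1 :+: V 1 :+: Cst i).

Definition record_loop := While (V 1 :-: V 28)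
  (blk [:: hybrid; If (V 26) Skip (blk [:: 29 <~ V 29 :+: flag 2; 30 <~ V 30 :+: flag 3]);
           28 <~ V 28 :+: Cst 1]).

Definition next_record := 27 <~ V 27 :+: V 4 :+: V 4 :+: V 1 :+: V 1 :+: V 1 :+: V 1 :+: Cst 5.

Definition update := blk [:: 28 <~ Cst 0; record_loop;
  29 <~ V 29 :+: flag 0; 30 <~ V 30 :+: flag 1; next_record].

Definition evalv_loop := While (V 12 :-: V 27) update.

(** The integer v(x) is held as the difference of the naturals in registers 29 and 30; the two
    truncated differences of these registers are then max(v, 0) and max(-v, 0), the exponents of the
    weights. *)
Definition evalv := blk [:: 29 <~ Cst 0; 30 <~ Cst 0; 27 <~ Cst 64; evalv_loop].

Lemma onth_cat_some (T : Type) (s t : seq T) i x :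
  onth s i = Some x -> onth (s ++ t) i = Some x.
Proof. by elim: s i => [|y s IH] [|i] //= /IH. Qed.

(** * Correctness of the coin and of an oracle call on a hybrid sample *)

Section blocks.
Context {R : realType} {d : measure_display} {X : measurableType d}.
Variables (A : learner R X) (T : nat) (f : concept X).
Variables (Dtrain Dtest : probability X R).
Variables (Post G : store X -> Prop).

Notation J := (J A T f Dtrain Dtest Post G).
(** Besides the untouched registers it records that the tables of points and hypotheses only grow at
    the end, which keeps every stored handle valid. *)
Record frame lo hi (s s' : store X) : Prop := Frame {
  frame_mem : forall a, ~~ (lo <= a < hi)%N -> mem s' a = mem s a;
  frame_pts : exists l, pts s' = pts s ++ l;
  frame_hyps : exists l, hyps s' = hyps s ++ l }.

Definition clean (s : store X) := pend_train s = [::] /\ pend_test s = [::].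

Lemma frame_trans lo hi s1 s2 s3 :
  frame lo hi s1 s2 -> frame lo hi s2 s3 -> frame lo hi s1 s3.
Proof.
move=> [m1 [p1 e1] [h1 g1]] [m2 [p2 e2] [h2 g2]]; split.
- by move=> a Ha; rewrite m2// m1.
- by exists (p1 ++ p2); rewrite e2 e1 catA.
- by exists (h1 ++ h2); rewrite g2 g1 catA.
Qed.

Lemma frame_widen lo hi lo' hi' s s' : (lo' <= lo)%N -> (hi <= hi')%N ->
  frame lo hi s s' -> frame lo' hi' s s'.
Proof. by move=> l1 l2 [h ? ?]; split => // a Ha; apply: h; lia. Qed.

Lemma frame_onth lo hi s s' i x : frame lo hi s s' ->
  onth (pts s) i = Some x -> onth (pts s') i = Some x.
Proof. by move=> [_ [l ->] _]; exact: onth_cat_some. Qed.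

Lemma J_while1 N e p k m0 ps hs tr te nc nd t v : eval m0 e != 0%N ->
  J N (p :: While e p :: k, Store m0 ps hs tr te nc nd t.+1) v ->
  J N.+1 (While e p :: k, Store m0 ps hs tr te nc nd t) v.
Proof. by move=> E; apply: J_det => -[[[? ?] ?] ?] /=; rewrite E. Qed.

Lemma J_while0 N e p k m0 ps hs tr te nc nd t v : eval m0 e = 0%N ->
  J N (k, Store m0 ps hs tr te nc nd t.+1) v ->
  J N.+1 (While e p :: k, Store m0 ps hs tr te nc nd t) v.
Proof. by move=> E; apply: J_det => -[[[? ?] ?] ?] /=; rewrite E. Qed.

Lemma J_if N e p1 p2 k m0 ps hs tr te nc nd t v :
  J N ((if eval m0 e != 0%N then p1 else p2) :: k, Store m0 ps hs tr te nc nd t.+1) v ->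
  J N.+1 (If e p1 p2 :: k, Store m0 ps hs tr te nc nd t) v.
Proof. by apply: J_det => -[[[? ?] ?] ?]. Qed.

Lemma J_seq N p1 p2 k m0 ps hs tr te nc nd t v :
  J N ([:: p1, p2 & k], Store m0 ps hs tr te nc nd t.+1) v ->
  J N.+1 (Seq p1 p2 :: k, Store m0 ps hs tr te nc nd t) v.
Proof. by apply: J_det => -[[[? ?] ?] ?]. Qed.

Lemma J_skip N k m0 ps hs tr te nc nd t v :
  J N (k, Store m0 ps hs tr te nc nd t.+1) v ->
  J N.+1 (Skip :: k, Store m0 ps hs tr te nc nd t) v.
Proof. by apply: J_det => -[[[? ?] ?] ?]. Qed.

Lemma J_assign N a e k m0 ps hs tr te nc nd t v :
  J N (k, Store (upd m0 (eval m0 a) (eval m0 e)) ps hs tr te nc nd t.+1) v ->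
  J N.+1 (Assign a e :: k, Store m0 ps hs tr te nc nd t) v.
Proof. by apply: J_det => -[[[? ?] ?] ?]. Qed.

Lemma J_push_train N e b k m0 ps hs tr te nc nd t x v :
  onth ps (eval m0 e) = Some x ->
  J N (k, Store m0 ps hs (rcons tr (x, eval m0 b != 0%N)) te nc nd t.+1) v ->
  J N.+1 (PushTrain e b :: k, Store m0 ps hs tr te nc nd t) v.
Proof. by move=> E; apply: J_det => -[[[? ?] ?] ?] /=; rewrite E. Qed.

Lemma J_push_test N e k m0 ps hs tr te nc nd t x v :
  onth ps (eval m0 e) = Some x ->
  J N (k, Store m0 ps hs tr (rcons te x) nc nd t.+1) v ->
  J N.+1 (PushTest e :: k, Store m0 ps hs tr te nc nd t) v.
Proof. by move=> E; apply: J_det => -[[[? ?] ?] ?] /=; rewrite E. Qed.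

Local Ltac jdet := (first [apply: J_seq | apply: J_assign | apply: J_skip]); cbn [eval].
Local Ltac updout := rewrite /upd /=;
  repeat (case: ifP => [/eqP ? | _]; [exfalso; lia |]); try done.
Local Ltac frm :=
  try (match goal with |- frame _ _ _ ?s => is_var s; unfold s end); split; [by move=> a Ha; updout | by exists [::]; rewrite cats0 |
  by exists [::]; rewrite cats0].

(** A head seen earlier already settles the result; otherwise only the outcome where all remaining
    flips are tails leads to [v0]. Stating both situations at once closes the induction. *)
Lemma J_flips N k s v1 v0 :
  (forall s', frame 22 25 s s' -> (clean s -> clean s') -> mem s' 22 != 0%N -> J N (k, s') v1) ->
  (forall s', frame 22 25 s s' -> (clean s -> clean s') -> mem s' 22 = 0%N -> J N (k, s') v0) ->
  J (9 * mem s 23 + 1 + N) (flips :: k, s)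
    (if mem s 22 != 0%N then v1 else v1 + 2^-1 ^+ mem s 23 * (v0 - v1)).
Proof.
move: {2}(mem s 23) (erefl (mem s 23)) => l.
elim: l s => [|l IH] [m0 ps hs tr te nc nd t] /= ml H1 H0.
  rewrite ml muln0 add0n; apply: J_while0 => //.
  have fr : frame 22 25 (Store m0 ps hs tr te nc nd t) (Store m0 ps hs tr te nc nd t.+1) by frm.
  case: eqP => [m22|/eqP m22] /=.
    by rewrite expr0 mul1r subrKC; apply: H0.
  by apply: H1.
rewrite ml (_ : (9 * l.+1 + 1 + N = 9 + (9 * l + 1 + N))%N); last by lia.
apply: J_while1; first by rewrite /= ml.
do 1 jdet.
have step b : J (6 + (9 * l + 1 + N)) ([:: blk [:: 22 <~ V 22 :+: V 24; 23 <~ V 23 :-: Cst 1], flips & k],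
    Store (upd m0 24 b) ps hs tr te nc nd t.+3)
    (if (m0 22 + b)%N != 0%N then v1 else v1 + 2^-1 ^+ l * (v0 - v1)).
  jdet; jdet; jdet; jdet; jdet.
  set s1 := Store _ _ _ _ _ _ _ _.
  have fr : frame 22 25 (Store m0 ps hs tr te nc nd t) s1 by frm.
  have E23 : mem s1 23 = l by rewrite /s1 /= /upd /= ml subn1.
  have E22 : mem s1 22 = (m0 22 + b)%N by rewrite /s1 /= /upd /=.
  have := IH s1; rewrite E23 E22 => /(_ erefl) IH'.
  apply: (J_weak (IH' _ _)); [| | lia | exact: lexx].
  - by move=> s' f1 c1; apply: H1; [exact: frame_trans fr f1 | move=> c; apply: c1].
  - by move=> s' f1 c1; apply: H0; [exact: frame_trans fr f1 | move=> c; apply: c1].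
refine (J_weak (J_flip (a := Cst 24) (step 1%N) (step 0%N)) _ _); first by lia.
rewrite addn0 addn1 /=; case: eqP => _ /=; last by lra.
by rewrite exprS; set w := _ ^+ l; lra.
Qed.

Lemma J_coin_loop N kb k s v1 v0 : mem s 6 = kb ->
  (forall s', frame 20 25 s s' -> (clean s -> clean s') -> mem s' 20 != 0%N -> J N (k, s') v1) ->
  (forall s', frame 20 25 s s' -> (clean s -> clean s') -> mem s' 20 = 0%N -> J N (k, s') v0) ->
  J (mem s 21 * (9 * kb + 20) + 1 + N) (coin_loop :: k, s)
    (if mem s 20 != 0%N then v0 + (1 - 2^-1 ^+ kb) ^+ mem s 21 * (v1 - v0) else v0).
Proof.
move: {2}(mem s 21) (erefl (mem s 21)) => l.
elim: l s => [|l IH] [m0 ps hs tr te nc nd t] /= ml m6 H1 H0.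
  rewrite ml mul0n add0n; apply: J_while0 => //.
  have fr : frame 20 25 (Store m0 ps hs tr te nc nd t) (Store m0 ps hs tr te nc nd t.+1) by frm.
  case: eqP => [m20|/eqP m20] /=.
    by apply: H0.
  by rewrite expr0 mul1r subrKC; apply: H1.
rewrite ml (_ : (l.+1 * (9 * kb + 20) + 1 + N =
  8 + ((9 * kb + 1) + (11 + (l * (9 * kb + 20) + 1 + N))))%N); last by lia.
apply: J_while1; first by rewrite /= ml.
jdet; jdet; jdet; jdet; jdet; jdet; jdet.
set s1 := Store _ _ _ _ _ _ _ _.
have fr : frame 20 25 (Store m0 ps hs tr te nc nd t) s1 by frm.
have E23 : mem s1 23 = kb by rewrite /s1 /= /upd /= m6.
have E22 : mem s1 22 = 0%N by rewrite /s1 /= /upd /=.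
set vv := (X in J _ _ X).
pose v1' := if m0 20 != 0%N then v0 + (1 - 2^-1 ^+ kb) ^+ l * (v1 - v0) else v0.
have -> : vv = v1' + 2^-1 ^+ kb * (v0 - v1').
  rewrite /vv /v1'; case: ifP => _; last by rewrite subrr mulr0 addr0.
  rewrite exprS; set w := _ ^+ l; set z := _ ^+ kb; ring.
have fin s' c0 : frame 22 25 s1 s' -> (clean s1 -> clean s') -> (mem s' 22 != 0%N) = c0 ->
   J (11 + (l * (9 * kb + 20) + 1 + N))
     ([:: blk [:: If (V 22) Skip (20 <~ Cst 0)], coin_loop & k], s')
     (if c0 then v1' else v0).
  case: s' => m1 ps1 hs1 tr1 te1 nc1 nd1 t1 fr1 cl1 m22.
  have E6 : m1 6 = kb by have /= -> := frame_mem fr1 (a := 6%N) isT; rewrite /s1 /= /upd.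
  have E21 : m1 21 = l by have /= -> := frame_mem fr1 (a := 21%N) isT; rewrite /s1 /= /upd /= ml subn1.
  have E20 : m1 20 = m0 20 by have /= -> := frame_mem fr1 (a := 20%N) isT; rewrite /s1 /= /upd.
  have fr2 := frame_trans fr (frame_widen (isT : 20 <= 22)%N (isT : 25 <= 25)%N fr1).
  jdet; apply: J_if; rewrite /= m22; case: c0 m22 => _; jdet; jdet;
   set s2 := Store _ _ _ _ _ _ _ _.
    have fr3 : frame 20 25 (Store m0 ps hs tr te nc nd t) s2 by apply: frame_trans fr2 _; frm.
    have := IH s2; rewrite [mem s2 21]E21 => /(_ erefl E6); rewrite [mem s2 20]E20.
    move=> IH'; apply: (J_weak (IH' _ _)); [| |lia|exact: lexx].
    - by move=> s' f1 c1; apply: H1; [exact: frame_trans fr3 f1 | move=> c; apply: c1; apply: cl1].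
    - by move=> s' f1 c1; apply: H0; [exact: frame_trans fr3 f1 | move=> c; apply: c1; apply: cl1].
  have fr3 : frame 20 25 (Store m0 ps hs tr te nc nd t) s2 by apply: frame_trans fr2 _; frm.
  have := IH s2; rewrite [mem s2 21]E21 => /(_ erefl E6); rewrite {1}/s2 /= {1}/upd /=.
  move=> IH'; apply: (J_weak (IH' _ _)); [| |lia|exact: lexx].
  - by move=> s' f1 c1; apply: H1; [exact: frame_trans fr3 f1 | move=> c; apply: c1; apply: cl1].
  - by move=> s' f1 c1; apply: H0; [exact: frame_trans fr3 f1 | move=> c; apply: c1; apply: cl1].
have := @J_flips (11 + (l * (9 * kb + 20) + 1 + N))
  [:: blk [:: If (V 22) Skip (20 <~ Cst 0)], coin_loop & k] s1 v1' v0.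
rewrite E23 E22 /=; apply.
- by move=> s' f1 c1 e; apply: (fin s' true).
- by move=> s' f1 c1 e; apply: (fin s' false) => //; rewrite e.
Qed.

Definition coin_cost kb E := (E * (9 * kb + 20) + 10)%N.

Lemma J_coin N kb e E k s v1 v0 : mem s 6 = kb ->
  eval (upd (mem s) 20 1) e = E ->
  (forall s', frame 20 25 s s' -> (clean s -> clean s') -> mem s' 20 != 0%N -> J N (k, s') v1) ->
  (forall s', frame 20 25 s s' -> (clean s -> clean s') -> mem s' 20 = 0%N -> J N (k, s') v0) ->
  J (coin_cost kb E + N) (coin e :: k, s)
    ((1 - 2^-1 ^+ kb) ^+ E * v1 + (1 - (1 - 2^-1 ^+ kb) ^+ E) * v0).
Proof.
case: s => m0 ps hs tr te nc nd t /= m6 eE H1 H0.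
apply: (@J_weak _ _ _ _ _ _ _ _ _ _ (5 + (E * (9 * kb + 20) + 1 + N.+1))); last 2 first.
- rewrite /coin_cost; lia.
- exact: lexx.
jdet; jdet; jdet; jdet; jdet.
set s1 := Store _ _ _ _ _ _ _ _.
have fr : frame 20 25 (Store m0 ps hs tr te nc nd t) s1 by frm.
have := @J_coin_loop N.+1 kb [:: blk [::] & k] s1 v1 v0.
have -> : mem s1 21 = E by rewrite -eE /s1 /= /upd.
have -> : mem s1 20 = 1%N by rewrite /s1 /= /upd.
have -> : mem s1 6 = kb by rewrite /s1 /= /upd.
move=> /= H; apply: (J_weak (H erefl _ _)).
- case=> m2 ps2 hs2 tr2 te2 nc2 nd2 t2 f1 c1 e1; jdet; apply: H1 => //.
  by apply: frame_trans fr (frame_trans f1 _); frm.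
- case=> m2 ps2 hs2 tr2 te2 nc2 nd2 t2 f1 c1 e1; jdet; apply: H0 => //.
  by apply: frame_trans fr (frame_trans f1 _); frm.
- by [].
- rewrite le_eqVlt; apply/orP; left; apply/eqP; ring.
Qed.

Definition stored (s : store X) p (l : seq X) := forall j x,
  onth l j = Some x -> onth (pts s) (mem s (p + j + j)) = Some x.

Definition labeled (s : store X) p (l : seq X) := forall j x,
  onth l j = Some x -> (mem s (p + j + j + 1) != 0)%N = f x.

Definition test_loc (s : store X) j :=
  if (j < mem s 28)%N then
    mem s (mem s 27 + mem s 4 + mem s 4 + mem s 1 + mem s 1 + j + j)
  else if (mem s 28 < j)%N then mem s (mem s 27 + mem s 4 + mem s 4 + j + j)
  else mem s 31.

Definition tests (s : store X) (l : seq X) := forall j x,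
  onth l j = Some x -> onth (pts s) (test_loc s j) = Some x.

Definition handle (s : store X) v (o : option (concept X)) :=
  if o is Some h then exists i, v = i.+1 /\ onth (hyps s) i = Some h else v = 0%N.

Lemma onth_size_cat (T' : Type) (l1 l2 : seq T') x : onth (l1 ++ x :: l2) (size l1) = Some x.
Proof. by elim: l1. Qed.

Lemma frame_tape lo hi s s' p : frame lo hi s s' -> (hi <= p)%N ->
  forall j, mem s' (p + j) = mem s (p + j).
Proof. by move=> fr hp j; rewrite (frame_mem fr)//; lia. Qed.

Lemma stored_frame lo hi s s' p l : frame lo hi s s' -> (hi <= p)%N ->
  stored s p l -> stored s' p l.
Proof.
move=> fr hp H j x /H; rewrite -addnA (frame_tape fr hp); exact: (frame_onth fr).
Qed.

Lemma labeled_frame lo hi s s' p l : frame lo hi s s' -> (hi <= p)%N ->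
  labeled s p l -> labeled s' p l.
Proof. by move=> fr hp H j x /H; rewrite -!addnA (frame_tape fr hp). Qed.

Lemma tests_frame s s' l : frame 25 27 s s' -> (64 <= mem s 27)%N ->
  tests s l -> tests s' l.
Proof.
move=> fr hp H j x /H; rewrite /test_loc !(frame_mem fr)//; try lia.
exact: (frame_onth fr).
Qed.

Lemma J_push_train_loop N k (Z l1 l2 : seq X) s v : Z = l1 ++ l2 ->
  mem s 4 = size Z -> mem s 25 = size l1 -> (64 <= mem s 27)%N ->
  stored s (mem s 27) Z -> labeled s (mem s 27) Z ->
  pend_train s = [seq (x, f x) | x <- l1] ->
  (forall s', frame 25 27 s s' -> pend_train s' = [seq (x, f x) | x <- Z] ->
    pend_test s' = pend_test s -> J N (k, s') v) ->
  J (6 * size l2 + 1 + N) (push_train :: k, s) v.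
Proof.
elim: l2 l1 s => [|x l2 IH] l1 [m0 ps hs tr te nc nd t] /= EZ m4 m25 h27 st lb ptr H.
  rewrite muln0 add0n; apply: J_while0; first by rewrite /= m4 m25 EZ cats0 subnn.
  by apply: H => //; [frm | rewrite /= ptr EZ cats0].
rewrite (_ : (6 * _ + 1 + N = 6 + (6 * size l2 + 1 + N))%N); last by lia.
apply: J_while1.
  by rewrite /= m4 m25 EZ size_cat /=; lia.
have xn : onth Z (size l1) = Some x by rewrite EZ onth_size_cat.
jdet; apply: (J_push_train (x := x)); first by rewrite /= m25; exact: st.
have lx := lb _ _ xn; rewrite /= in lx; rewrite /= m25 lx.
jdet; jdet; jdet; set s1 := Store _ _ _ _ _ _ _ _.
have fr : frame 25 27 (Store m0 ps hs tr te nc nd t) s1 by frm.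
have E27 : mem s1 27 = m0 27%N by rewrite /s1 /= /upd.
apply: (IH (rcons l1 x)).
- by rewrite EZ cat_rcons.
- by rewrite /s1 /= /upd.
- by rewrite /s1 /= /upd /= m25 size_rcons addn1.
- by rewrite E27.
- by rewrite E27; apply: stored_frame fr _ st; lia.
- by rewrite E27; apply: labeled_frame fr _ lb; lia.
- by rewrite /s1 /= ptr map_rcons.
- by move=> s' f1 ? ?; apply: H => //; exact: frame_trans fr f1.
Qed.

Lemma J_push_test_loop N k (Z l1 l2 : seq X) s v : Z = l1 ++ l2 ->
  mem s 1 = size Z -> mem s 25 = size l1 -> (64 <= mem s 27)%N ->
  tests s Z -> pend_test s = l1 ->
  (forall s', frame 25 27 s s' -> pend_test s' = Z ->
    pend_train s' = pend_train s -> J N (k, s') v) ->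
  J (8 * size l2 + 1 + N) (push_test :: k, s) v.
Proof.
elim: l2 l1 s => [|x l2 IH] l1 [m0 ps hs tr te nc nd t] /= EZ m1 m25 h27 st pte H.
  rewrite muln0 add0n; apply: J_while0; first by rewrite /= m1 m25 EZ cats0 subnn.
  by apply: H => //; [frm | rewrite /= pte EZ cats0].
rewrite (_ : (8 * _ + 1 + N = 8 + (8 * size l2 + 1 + N))%N); last by lia.
apply: J_while1.
  by rewrite /= m1 m25 EZ size_cat /=; lia.
have xn : onth Z (size l1) = Some x by rewrite EZ onth_size_cat.
have fin c : J (3 + (8 * size l2 + 1 + N)) (blk [:: 25 <~ V 25 :+: Cst 1] :: push_test :: k,
    Store m0 ps hs tr (rcons te x) nc nd c) v.
  jdet; jdet; jdet; set s1 := Store _ _ _ _ _ _ _ _.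
  have fr : frame 25 27 (Store m0 ps hs tr te nc nd t) s1 by frm.
  have E27 : mem s1 27 = m0 27%N by rewrite /s1 /= /upd.
  apply: (IH (rcons l1 x)).
  - by rewrite EZ cat_rcons.
  - by rewrite /s1 /= /upd.
  - by rewrite /s1 /= /upd /= m25 size_rcons addn1.
  - by rewrite E27.
  - exact: tests_frame fr _ st.
  - by rewrite /s1 /= pte.
  - by move=> s' f1 ? ?; apply: H => //; exact: frame_trans fr f1.
have := st _ _ xn; rewrite /test_loc /= => loc.
jdet; apply: J_if; rewrite /= m25.
case: ltnP loc => [lt1|ge1].
  move=> loc; rewrite -lt0n subn_gt0 lt1.
  apply: (J_push_test (x := x)); first by rewrite /= m25.
  by apply: (J_weak (fin _)) => //; lia.
rewrite (_ : (m0 28 - size l1)%N = 0%N) /=; last by lia.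
move=> loc; apply: J_if; rewrite /= m25.
case: ltnP loc => [lt2|ge2] loc.
  rewrite -lt0n subn_gt0 lt2.
  apply: (J_push_test (x := x)); first by rewrite /= m25.
  by apply: (J_weak (fin _)) => //; lia.
rewrite (_ : (size l1 - m0 28)%N = 0%N) /=; last by lia.
apply: (J_push_test (x := x)); first by [].
by apply: (J_weak (fin _)) => //; lia.
Qed.

Let n := ntrain A.
Let m := ntest A.

Definition hybrid_cost := (6 * n + 8 * m + 20)%N.

Lemma J_hybrid N k s (Z : n.-tuple X) (te : m.-tuple X) (kap : seed A -> R) :
  bm kap -> clean s -> mem s 4 = n -> mem s 1 = m -> (64 <= mem s 27)%N ->
  stored s (mem s 27) Z -> labeled s (mem s 27) Z -> tests s te ->
  (forall s' r, frame 25 27 s s' -> clean s' ->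
    handle s' (mem s' 26) (output (label_with f Z) te r) -> J N (k, s') (kap r)) ->
  J (hybrid_cost + N) (hybrid :: k, s) (mean (seed_law A) kap).
Proof.
case: s => m0 ps hs tr te0 nc nd t /= bk [/= tr0 te00] m4 m1 h27 st lb ts H.
rewrite /hybrid_cost (_ : (_ + N = 3 + (6 * n + 1 + (3 + (8 * m + 1 + (12 + N)))))%N); last by lia.
jdet; jdet; jdet; set s1 := Store _ _ _ _ _ _ _ _.
have fr : frame 25 27 (Store m0 ps hs tr te0 nc nd t) s1 by frm.
have := @J_push_train_loop (3 + (8 * m + 1 + (12 + N))) [:: blk [:: 25 <~ Cst 0; push_test;
  CallOracle (Cst 26)] & k] Z [::] Z s1 (mean (seed_law A) kap) erefl.
rewrite size_tuple; apply=> //.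
- by rewrite (frame_mem fr (a := 27%N) isT); apply: (stored_frame fr _ st); lia.
- by rewrite (frame_mem fr (a := 27%N) isT); apply: (labeled_frame fr _ lb); lia.
case=> m2 ps2 hs2 tr2 te2 nc2 nd2 t2 f1 /= tr2E te2E.
have {}f1 := frame_trans fr f1.
jdet; jdet; jdet; set s2 := Store _ _ _ _ _ _ _ _.
have fr2 : frame 25 27 (Store m0 ps hs tr te0 nc nd t) s2.
  by apply: frame_trans f1 _; frm.
have := @J_push_test_loop (12 + N) [:: blk [:: CallOracle (Cst 26)] & k] te [::] te s2
  (mean (seed_law A) kap) erefl.
rewrite size_tuple (frame_mem fr2 (a := 1%N) isT) (frame_mem fr2 (a := 27%N) isT); apply=> //.
- exact: tests_frame fr2 _ ts.
- by rewrite /s2 /= te2E.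
case=> m3 ps3 hs3 tr3 te3 nc3 nd3 t3 f3 /= te3E tr3E.
have {}f3 := frame_trans fr2 f3.
jdet; apply: J_oracle => // r.
have -> : call_oracle tr3 te3 r = output (label_with f Z) te r.
  rewrite /call_oracle tr3E te3E tr2E /=.
  by rewrite -[X in insub X]/(val (label_with f Z)) valK valK.
case E : (output _ te r) => [h|]; jdet; (apply: (J_weak (H _ r _ _ _)); [| | |lia|exact: lexx]) => //.
- apply: frame_trans f3 _; split => //= [a Ha||]; [by updout|by exists [::]; rewrite cats0|].
  by exists [:: h]; rewrite cats1.
- by rewrite E /= /upd /=; exists (size hs3); split => //; rewrite -cats1 onth_size_cat.
- by apply: frame_trans f3 _; frm.
- by rewrite E /= /upd.
Qed.

End blocks.

Ltac jdet := (first [apply: J_seq | apply: J_assign | apply: J_skip]); cbn [eval].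
Ltac updout := rewrite /upd /=;
  repeat (case: ifP => [/eqP ? | _]; [exfalso; lia |]); try done.
Ltac frm :=
  try (match goal with |- frame _ _ _ ?s => is_var s; unfold s end);
  split; [by move=> a Ha; updout | by exists [::]; rewrite cats0 |
  by exists [::]; rewrite cats0].

Definition draw (b : bool) : cmd :=
  if b then DrawTrain (Cst 31) (Cst 32) else DrawTest (Cst 31).

Definition weight (b : bool) : expr := if b then V 30 :-: V 29 else V 29 :-: V 30.

Definition sample_loop b := While (V 33)
  (blk [:: draw b; evalv; coin (weight b);
           If (V 20) (33 <~ Cst 0) (33 <~ V 33 :-: Cst 1)]).

Definition sample b := blk [:: 33 <~ V 7; sample_loop b].

Definition sample_many_loop b := While (V 34)
  (blk [:: sample b; Assign (V 35) (V 31); Assign (V 35 :+: Cst 1) (V 32);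
           35 <~ V 35 :+: Cst 2; 34 <~ V 34 :-: Cst 1]).

Definition sample_many b e := blk [:: 34 <~ e; sample_many_loop b].

Definition sample_record := blk [:: 35 <~ V 12; sample_many true (V 4);
  sample_many true (V 1); sample_many false (V 1)].

Lemma onth_tnth (T : Type) k (t : k.-tuple T) j x : onth t j = Some x ->
  exists hj : (j < k)%N, tnth t (Ordinal hj) = x.
Proof.
move=> E; have hj : (j < k)%N.
  rewrite -(size_tuple t); elim: (tval t) j E => [|y l IH] [|j] //= /IH.
  by rewrite ltnS.
exists hj; rewrite (tnth_nth x) /=; elim: (tval t) j E {hj} => [|y l IH] [|j] //=.
  by case.
exact: IH.
Qed.

Lemma tnth_onth (T : Type) k (t : k.-tuple T) (j : 'I_k) : onth t j = Some (tnth t j).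
Proof.
rewrite (tnth_nth (tnth t j)); move: (tnth t j) => x; have := ltn_ord j.
rewrite -[X in (_ < X)%N](size_tuple t); elim: (tval t) (val j) => [|y l IH] [|i] //=.
exact: IH.
Qed.

(** * Hybrid samples, the law of the counters, and the records on the tape *)

Section records.
Context {R : realType} {d : measure_display} {X : measurableType d}.
Variables (A : learner R X) (f : concept X).
Hypothesis mf : measurable_fun setT f.

Let n := ntrain A.
Let m := ntest A.

Lemma measurable_label k :
  measurable_fun setT (fun S : k.-tuple X => label_with f S).
Proof.
apply/measurable_fun_tnthP => i /=.
under [X in measurable_fun _ X]eq_fun do rewrite /= tnth_map.
apply: measurable_fun_pair; first exact: measurable_tnth.
by apply: (measurableT_comp mf); exact: measurable_tnth.
Qed.

Definition rejects (Z : n.-tuple X) (te : m.-tuple X) (r : seed A) : bool :=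
  ~~ (output (label_with f Z) te r : bool).

Lemma bm_rejects : bm (fun z : n.-tuple X * m.-tuple X * seed A =>
  (rejects z.1.1 z.1.2 z.2)%:R : R).
Proof.
pose g (z : n.-tuple X * m.-tuple X * seed A) := (label_with f z.1.1, z.1.2, z.2).
have mg : measurable_fun setT g.
  apply: measurable_fun_pair => //.
  apply: measurable_fun_pair.
    apply: (measurableT_comp (@measurable_label n)).
    by apply: (measurableT_comp measurable_fst); exact: measurable_fst.
  by apply: (measurableT_comp measurable_snd); exact: measurable_fst.
apply: bm_indic.
rewrite (_ : mkset _ = ~` (g @^-1` [set z : n.-tuple (X * bool) * m.-tuple X * seed A |
    isSome (output z.1.1 z.1.2 z.2)])).
  apply: measurableC; rewrite -[X in measurable X]setTI.
  exact: (mg measurableT _ (@measurable_accept _ _ _ A)).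
by apply/seteqP; split => z /=; rewrite /rejects => /negP.
Qed.

Definition rej (Z : n.-tuple X) (te : m.-tuple X) : R :=
  mean (seed_law A) (fun r => (rejects Z te r)%:R).

Lemma bm_rej : bm (fun z : n.-tuple X * m.-tuple X => rej z.1 z.2).
Proof. exact: (bm_mean (seed_law A) bm_rejects). Qed.

Lemma bm_rejects1 Z te : bm (fun r => (rejects Z te r)%:R : R).
Proof. exact: (bm_pair1 bm_rejects (Z, te)). Qed.

Lemma rej01 Z te : 0 <= rej Z te <= 1.
Proof.
apply/andP; split; first by apply: mean_ge0 => r; case: (rejects _ _ _).
by apply: mean_le1 => [|r]; [exact: bm_rejects1 | case: (rejects _ _ _)].
Qed.

Definition splice i (P Q : m.-tuple X) : m.-tuple X :=
  [tuple (if (j < i)%N then tnth Q j else tnth P j) | j < m].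

Definition hyb i (P Q : m.-tuple X) (x : X) := splice i (tset i x P) Q.

(** The source of the telescoping: one sample is both the splice at i with coordinate i of P
    overwritten and the splice at i + 1 with coordinate i of Q overwritten. Averaging x over the law
    of P yields the former splice, over the law of Q the next one. *)
Lemma hybS i P Q x : hyb i P Q x = splice i.+1 P (tset i x Q).
Proof.
apply: eq_from_tnth => j; rewrite !tnth_mktuple ltnS.
by case: (ltngtP j i).
Qed.

Lemma splice0 P Q : splice 0 P Q = P.
Proof. by apply: eq_from_tnth => j; rewrite tnth_mktuple. Qed.

Lemma splice_all P Q : splice m P Q = Q.
Proof. by apply: eq_from_tnth => j; rewrite tnth_mktuple ltn_ord. Qed.

Lemma measurable_splice i :
  measurable_fun setT (fun z : m.-tuple X * m.-tuple X => splice i z.1 z.2).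
Proof.
apply/measurable_fun_tnthP => j /=.
under [X in measurable_fun _ X]eq_fun do rewrite /= tnth_mktuple.
case: (j < i)%N.
  apply: (@measurableT_comp _ _ _ _ _ _ (fun z : m.-tuple X => tnth z j)) => //=.
  exact: measurable_tnth.
apply: (@measurableT_comp _ _ _ _ _ _ (fun z : m.-tuple X => tnth z j)) => //=.
exact: measurable_tnth.
Qed.

(* A round: the two hybrid samples and labeled sample of its test function, the
   constant increments, the signs of the test function, and the hypothesis. *)
Record rnd := Rnd {
  rZ : n.-tuple X; rP : m.-tuple X; rQ : m.-tuple X;
  inc1 : nat; inc0 : nat; sgn1 : nat; sgn0 : nat; rH : option (concept X) }.

(** An expectation over independent oracle runs on the successive hybrids: [ps] lists their
    rejection probabilities, and each rejection moves the counters by the signs. *)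
Fixpoint incrE (ps : seq R) (s1 s0 : nat) (K : nat -> nat -> R) (p q : nat) : R :=
  if ps is a :: ps' then
    a * incrE ps' s1 s0 K (p + s1) (q + s0) + (1 - a) * incrE ps' s1 s0 K p q
  else K p q.

Definition rprob (r : rnd) (x : X) i := rej (rZ r) (hyb i (rP r) (rQ r) x).
Definition rprobs (r : rnd) (x : X) i c := [seq rprob r x j | j <- iota i c].

(* [EV rs x K p q]: the expectation of [K] at the counters of x after the rounds
   [rs], started from (p, q). *)
Fixpoint EV (rs : seq rnd) (x : X) (K : nat -> nat -> R) (p q : nat) : R :=
  if rs is r :: rs' then
    incrE (rprobs r x 0 m) (sgn1 r) (sgn0 r)
      (fun p q => EV rs' x K (p + inc1 r) (q + inc0 r)) p q
  else K p q.

Lemma bm_hyb i P Q (Z : n.-tuple X) : bm (fun x => rej Z (hyb i P Q x)).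
Proof.
apply: (bm_comp (g := fun x => (Z, hyb i P Q x))) bm_rej.
apply: measurable_fun_pair => //.
have mt : measurable_fun setT (fun x : X => tset i x P).
  exact: (measurableT_comp (@measurable_tset _ X m i)
    (measurable_fun_pair (@measurable_id _ X setT) (measurable_cst P))).
exact: (measurableT_comp (@measurable_splice i) (measurable_fun_pair mt (measurable_cst Q))).
Qed.

Lemma bm_incrE (ps : seq (X -> R)) s1 s0 (K : X -> nat -> nat -> R) p q :
  (forall a b, bm (fun x => K x a b)) -> (forall g, List.In g ps -> bm g) ->
  bm (fun x => incrE [seq g x | g <- ps] s1 s0 (K x) p q).
Proof.
move=> bK; elim: ps p q => [|g ps IH] p q bps //=.
have bg : bm g by apply: bps; left.
have bps' h : List.In h ps -> bm h by move=> hps; apply: bps; right.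
apply: bmD; apply: bmM => //; try exact: IH.
exact: bmB (bm_cst _) bg.
Qed.

Lemma bm_EV rs K p q : bm (fun x => EV rs x K p q).
Proof.
elim: rs p q => [|r rs IH] p q /=; first exact: bm_cst.
have E x : rprobs r x 0 m = [seq g x | g <- [seq (fun x => rprob r x j) | j <- iota 0 m]].
  by rewrite /rprobs -map_comp.
under eq_fun do rewrite E.
apply: (@bm_incrE _ _ _ (fun x p q => EV rs x K (p + inc1 r) (q + inc0 r))) => //.
move=> g; elim: (iota 0 m) => [//|j l IHl] /= [<-|/IHl//].
exact: bm_hyb.
Qed.

Lemma incrE_affine ps s1 s0 K (a b : R) p q :
  incrE ps s1 s0 (fun p q => K p q * a + (1 - K p q) * b) p q =
  incrE ps s1 s0 K p q * a + (1 - incrE ps s1 s0 K p q) * b.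
Proof. by elim: ps p q => [//|c ps IH] p q /=; rewrite !IH; ring. Qed.

Lemma eq_incrE ps s1 s0 K K' p q : (forall p q, K p q = K' p q) ->
  incrE ps s1 s0 K p q = incrE ps s1 s0 K' p q.
Proof. by move=> E; elim: ps p q => [//|c ps IH] p q /=; rewrite !IH. Qed.

(** Handles a coin whose bias depends on the random counters: the value of the toss is affine in the
    bias, so only the averaged bias matters. *)
Lemma EV_affine rs x K (a b : R) p q :
  EV rs x (fun p q => K p q * a + (1 - K p q) * b) p q =
  EV rs x K p q * a + (1 - EV rs x K p q) * b.
Proof.
elim: rs p q => [//|r rs IH] p q /=; rewrite -incrE_affine.
by apply: eq_incrE => p' q'; rewrite IH.
Qed.

Lemma rprobs01 r x i c a : a \in rprobs r x i c -> 0 <= a <= 1.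
Proof. by move=> /mapP[j _ ->]; exact: rej01. Qed.

Lemma le_incrE ps s1 s0 K K' p q : (forall a, a \in ps -> 0 <= a <= 1) ->
  (forall p q, K p q <= K' p q) -> incrE ps s1 s0 K p q <= incrE ps s1 s0 K' p q.
Proof.
move=> + KK'; elim: ps p q => [//|c ps IH] p q H /=.
have /andP[c0 c1] : 0 <= c <= 1 by apply: H; rewrite mem_head.
have {}IH p' q' := IH p' q' (fun a aps => H a (mem_behead (s := c :: ps) aps)).
by apply: lerD; apply: ler_wpM2l => //; rewrite subr_ge0.
Qed.

Lemma le_EV rs x K K' p q : (forall p q, K p q <= K' p q) ->
  EV rs x K p q <= EV rs x K' p q.
Proof.
move=> KK'; elim: rs p q => [//|r rs IH] p q /=.
by apply: le_incrE => // a; exact: rprobs01.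
Qed.

Lemma incrE_cst ps s1 s0 (a : R) p q : incrE ps s1 s0 (fun _ _ => a) p q = a.
Proof. by elim: ps p q => [//|c ps IH] p q /=; rewrite !IH; ring. Qed.

Lemma EV_cst rs x (a : R) p q : EV rs x (fun _ _ => a) p q = a.
Proof.
elim: rs p q => [//|r rs IH] p q /=; rewrite -[RHS](incrE_cst (rprobs r x 0 m)
  (sgn1 r) (sgn0 r) a p q); exact: eq_incrE.
Qed.

Definition reclen := (n + n + m + m + m + m + 5)%N.
Definition flag_loc p i := (p + n + n + m + m + m + m + i)%N.

(** [W] bounds what one round can add to either counter: at most one unit per hybrid, plus the
    constant increment. *)
Record recAt W (s : store X) p (r : rnd) : Prop := RecAt {
  rec_Z : stored s p (rZ r);
  rec_lab : labeled f s p (rZ r);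
  rec_P : stored s (p + n + n) (rP r);
  rec_Q : stored s (p + n + n + m + m) (rQ r);
  rec_inc1 : mem s (flag_loc p 0) = inc1 r;
  rec_inc0 : mem s (flag_loc p 1) = inc0 r;
  rec_sgn1 : mem s (flag_loc p 2) = sgn1 r;
  rec_sgn0 : mem s (flag_loc p 3) = sgn0 r;
  rec_H : handle s (mem s (flag_loc p 4)) (rH r);
  rec_bounds : [/\ (sgn1 r <= 1)%N, (sgn0 r <= 1)%N, (inc1 r + m <= W)%N & (inc0 r + m <= W)%N] }.

Definition extends (s s' : store X) :=
  (exists l, pts s' = pts s ++ l) /\ (exists l, hyps s' = hyps s ++ l).

Lemma handle_ext s s' v o : extends s s' -> handle s v o -> handle s' v o.
Proof.
case: o => [h|//] [_ [l E]] [i [-> Hi]]; exists i; split => //.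
by rewrite E; exact: onth_cat_some.
Qed.

Lemma stored_ext s s' p k (l : k.-tuple X) : extends s s' ->
  (forall a, (p <= a < p + k + k)%N -> mem s' a = mem s a) ->
  stored s p l -> stored s' p l.
Proof.
move=> [[l0 E] _] H st j x Hj; have [hj _] := onth_tnth Hj.
rewrite H; last by lia.
by rewrite E; apply: onth_cat_some; exact: st.
Qed.

Lemma labeled_ext s s' p k (l : k.-tuple X) :
  (forall a, (p <= a < p + k + k)%N -> mem s' a = mem s a) ->
  labeled f s p l -> labeled f s' p l.
Proof.
move=> H st j x Hj; have [hj _] := onth_tnth Hj.
by rewrite H; [exact: st | lia].
Qed.

Lemma recAt_ext W s s' p r : extends s s' ->
  (forall a, (p <= a < p + reclen)%N -> mem s' a = mem s a) ->
  recAt W s p r -> recAt W s' p r.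
Proof.
rewrite /reclen => ext H [? ? ? ? ? ? ? ? ? ?]; split => //.
- by apply: (stored_ext ext) => // a Ha; apply: H; lia.
- by apply: (@labeled_ext s) => // a Ha; apply: H; lia.
- by apply: (stored_ext ext) => // a Ha; apply: H; lia.
- by apply: (stored_ext ext) => // a Ha; apply: H; lia.
- by rewrite H// /flag_loc; lia.
- by rewrite H// /flag_loc; lia.
- by rewrite H// /flag_loc; lia.
- by rewrite H// /flag_loc; lia.
- by rewrite H; [apply: handle_ext ext _ | rewrite /flag_loc; lia].
Qed.

Fixpoint tapeAt W (s : store X) p (rs : seq rnd) : Prop :=
  if rs is r :: rs' then recAt W s p r /\ tapeAt W s (p + reclen) rs' else True.

Lemma tapeAt_ext W s s' p rs : extends s s' ->
  (forall a, (p <= a < p + size rs * reclen)%N -> mem s' a = mem s a) ->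
  tapeAt W s p rs -> tapeAt W s' p rs.
Proof.
move=> ext; elim: rs p => [//|r rs IH] p H [r1 r2]; split.
  by apply: (recAt_ext ext) r1 => a Ha; apply: H => /=; nia.
by apply: IH r2 => a Ha; apply: H => /=; nia.
Qed.

Lemma tapeAt_rcons W s p rs r : tapeAt W s p rs ->
  recAt W s (p + size rs * reclen) r -> tapeAt W s p (rcons rs r).
Proof.
elim: rs p => [|r' rs IH] p /=; first by rewrite mul0n addn0.
move=> [h1 h2] h3; split => //; apply: IH => //.
by rewrite -addnA -mulSn.
Qed.

End records.

(** * Replaying the tape at a point and tossing its coin *)

Section sampling.
Context {R : realType} {d : measure_display} {X : measurableType d}.
Variables (A : learner R X) (T : nat) (f : concept X).
Variables (Dtrain Dtest : probability X R).
Variables (Post G : store X -> Prop).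
Hypothesis mf : measurable_fun setT f.

Notation J := (J A T f Dtrain Dtest Post G).
Let n := ntrain A.
Let m := ntest A.
Let rnd := rnd A.

Lemma extends_frame lo hi (s s' : store X) : frame lo hi s s' -> extends s s'.
Proof. by case. Qed.

Lemma extends_trans (s1 s2 s3 : store X) :
  extends s1 s2 -> extends s2 s3 -> extends s1 s3.
Proof.
move=> [[l1 e1] [h1 g1]] [[l2 e2] [h2 g2]]; split.
  by exists (l1 ++ l2); rewrite e2 e1 catA.
by exists (h1 ++ h2); rewrite g2 g1 catA.
Qed.

Lemma tests_hyb W s (r : rnd) x : recAt f W s (mem s 27) r -> mem s 4 = n ->
  mem s 1 = m -> onth (pts s) (mem s 31) = Some x ->
  tests s (hyb (mem s 28) (rP r) (rQ r) x).
Proof.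
move=> rc m4 m1 hx j y Hy; have [hj <-] := onth_tnth Hy.
rewrite !tnth_mktuple /test_loc m4 m1 /=.
case: ltnP => [lt1|ge1].
  by apply: (rec_Q rc); exact: (tnth_onth (rQ r) (Ordinal hj)).
case: ltnP => [lt2|ge2].
  rewrite gtn_eqF//.
  by apply: (rec_P rc); exact: (tnth_onth (rP r) (Ordinal hj)).
by rewrite ifT//; apply/eqP; lia.
Qed.

Lemma mean_seed_if Z te (v1 v0 : R) :
  mean (seed_law A) (fun r => if rejects f Z te r then v1 else v0) =
  rej f Z te * v1 + (1 - rej f Z te) * v0.
Proof.
have b := bm_rejects1 mf Z te.
rewrite (eq_mean _ (g := fun r => (v1 - v0) * (rejects f Z te r)%:R + v0)).
  rewrite meanD; [|exact: bmZ|exact: bm_cst].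
  by rewrite meanZ// mean_cst /rej; ring.
by move=> r; case: (rejects _ _ _ _) => /=; ring.
Qed.

Lemma bm_seed_if Z te (v1 v0 : R) :
  bm (fun r : seed A => if rejects f Z te r then v1 else v0).
Proof.
have b := bm_rejects1 mf Z te.
rewrite (_ : (fun r => _) = (fun r : seed A => (v1 - v0) * (rejects f Z te r)%:R + v0)).
  by apply: bmD; [exact: bmZ | exact: bm_cst].
by apply/funext => r; case: (rejects _ _ _ _) => /=; ring.
Qed.

Definition record_cost := (hybrid_cost A + 15)%N.

Lemma J_record_loop N k W (r : rnd) x c s (K : nat -> nat -> R) :
  (mem s 28 + c = m)%N -> recAt f W s (mem s 27) r -> mem s 4 = n -> mem s 1 = m ->
  (64 <= mem s 27)%N -> clean s -> onth (pts s) (mem s 31) = Some x ->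
  (forall s' p q, frame 25 31 s s' -> mem s' 27 = mem s 27 -> clean s' ->
    mem s' 29 = p -> mem s' 30 = q -> (p <= mem s 29 + c)%N -> (q <= mem s 30 + c)%N ->
    J N (k, s') (K p q)) ->
  J (c * record_cost + 1 + N) (record_loop :: k, s)
    (incrE (rprobs f r x (mem s 28) c) (sgn1 r) (sgn0 r) K (mem s 29) (mem s 30)).
Proof.
elim: c s => [|c IH] [m0 ps hs tr te nc nd t] /= mc rc m4 m1 h27 cl hx H.
  rewrite mul0n add0n; apply: J_while0; first by rewrite /= m1; lia.
  by apply: H => //; [frm | rewrite /=; lia | rewrite /=; lia].
have [b1 b0 _ _] := rec_bounds rc.
rewrite (_ : (_ + N = 2 + (hybrid_cost A + (12 + (c * record_cost + 1 + N).+1))%N)%N); last first.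
  by rewrite mulSn {1}/record_cost; lia.
apply: J_while1; first by rewrite /= m1; lia.
jdet; set s1 := Store _ _ _ _ _ _ _ _.
have fr1 : frame 25 27 (Store m0 ps hs tr te nc nd t) s1 by frm.
have rc1 : recAt f W s1 (mem s1 27) r.
  by apply: (recAt_ext (extends_frame fr1)) rc => a Ha; rewrite (frame_mem fr1)//; lia.
rewrite -mean_seed_if.
apply: (J_hybrid (s := s1) (te := hyb (m0 28%N) (rP r) (rQ r) x) (bm_seed_if _ _ _ _)) => //.
- exact: rec_Z rc1.
- exact: rec_lab rc1.
- exact: (tests_hyb (s := s1) rc1).
case=> m2 ps2 hs2 tr2 te2 nc2 nd2 t2 rr fr2 cl2 hd.
have {}fr2 := frame_trans fr1 fr2.
have rd a : ~~ (25 <= a < 27)%N -> m2 a = m0 a by exact: (frame_mem fr2).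
have fin s3 p q : frame 25 31 (Store m0 ps hs tr te nc nd t) s3 -> clean s3 ->
   mem s3 27 = m0 27%N -> mem s3 28 = (m0 28).+1 -> mem s3 29 = p -> mem s3 30 = q ->
   (p <= m0 29 + 1)%N -> (q <= m0 30 + 1)%N ->
   J (c * record_cost + 1 + N) (record_loop :: k, s3)
     (incrE (rprobs f r x (m0 28).+1 c) (sgn1 r) (sgn0 r) K p q).
  move=> fr3 cl3 e27 e28 <- <- lp lq; rewrite -e28; apply: IH => //.
  - by rewrite e28 addSnnS.
  - rewrite e27; apply: (recAt_ext (extends_frame fr3)) rc => a Ha.
    by apply: (frame_mem fr3); lia.
  - by rewrite (frame_mem fr3 (a := 4%N) isT).
  - by rewrite (frame_mem fr3 (a := 1%N) isT).
  - by rewrite e27.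
  - by rewrite (frame_mem fr3 (a := 31%N) isT); exact: (frame_onth fr3).
  - move=> s' p' q' f' e27' cl' ep eq' lp' lq'; apply: H => //.
    + exact: frame_trans fr3 f'.
    + by rewrite e27' e27.
    + by lia.
    + by lia.
have fr2' := frame_widen (leqnn 25) (isT : 27 <= 31)%N fr2.
jdet; apply: J_if; cbn [eval].
have e4 : m2 4%N = m0 4%N by apply: rd.
have e1 : m2 1%N = m0 1%N by apply: rd.
have e27 : m2 27%N = m0 27%N by apply: rd.
have e28 : m2 28%N = m0 28%N by apply: rd.
have e29 : m2 29%N = m0 29%N by apply: rd.
have e30 : m2 30%N = m0 30%N by apply: rd.
have rF i : (i < 5)%N -> m2 (m0 27%N + n + n + m + m + m + m + i)%N = m0 (flag_loc A (m0 27%N) i).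
  by move=> i5; rewrite rd// /flag_loc; lia.
rewrite /rejects; move: hd; case: (output _ _ rr) => [h|] /=.
  move=> [i [-> _]] /=; jdet; jdet; jdet; jdet.
  set s3 := Store _ _ _ _ _ _ _ _.
  apply: (J_weak (fin s3 _ _ _ _ _ _ _ _ _ _)); rewrite ?/s3 /= ?/upd /= ?e27 ?e28 ?e29 ?e30 ?addn1 //; try lia.
  by apply: frame_trans fr2' _; frm.
move=> -> /=; jdet; jdet; jdet; jdet; jdet; jdet; jdet; jdet.
set s3 := Store _ _ _ _ _ _ _ _.
have fr3 : frame 25 31 (Store m0 ps hs tr te nc nd t) s3 by apply: frame_trans fr2' _; frm.
have E2 := rF 2%N isT; have E3 := rF 3%N isT.
have g1 := rec_sgn1 rc; have g0 := rec_sgn0 rc; rewrite /= in g1 g0.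
have e29' : mem s3 29 = (m0 29 + sgn1 r)%N.
  rewrite /s3 /= /upd /= e4 e1 e27 e29 m4 m1; congr addn; rewrite -g1 -E2.
  by rewrite ?ifF//; apply/eqP; lia.
have e30' : mem s3 30 = (m0 30 + sgn0 r)%N.
  rewrite /s3 /= /upd /= e4 e1 e27 e30 m4 m1; congr addn; rewrite -g0 -E3.
  by rewrite ?ifF//; apply/eqP; lia.
apply: (J_weak (fin s3 _ _ fr3 _ _ _ e29' e30' _ _)); rewrite ?/s3 /= ?/upd /= ?e27 ?e28 ?addn1 //; lia.
Qed.

Definition update_cost := (m * record_cost + 20)%N.

Lemma J_update N k W (r : rnd) x s (K : nat -> nat -> R) :
  recAt f W s (mem s 27) r -> mem s 4 = n -> mem s 1 = m ->
  (64 <= mem s 27)%N -> clean s -> onth (pts s) (mem s 31) = Some x ->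
  (forall s' p q, frame 25 31 s s' -> mem s' 27 = (mem s 27 + reclen A)%N -> clean s' ->
    mem s' 29 = p -> mem s' 30 = q -> (p <= mem s 29 + W)%N -> (q <= mem s 30 + W)%N ->
    J N (k, s') (K p q)) ->
  J (update_cost + N) (update :: k, s)
    (incrE (rprobs f r x 0 m) (sgn1 r) (sgn0 r)
      (fun p q => K (p + inc1 r)%N (q + inc0 r)%N) (mem s 29) (mem s 30)).
Proof.
case: s => m0 ps hs tr te nc nd t /= rc m4 m1 h27 cl hx H.
have [_ _ b1 b0] := rec_bounds rc.
rewrite (_ : (_ + N = 3 + ((m * record_cost + 1) + (16 + N)))%N); last first.
  by rewrite /update_cost; lia.
jdet; jdet; jdet; set s1 := Store _ _ _ _ _ _ _ _.
have fr1 : frame 25 31 (Store m0 ps hs tr te nc nd t) s1 by frm.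
have E0 : mem s1 28 = 0%N by rewrite /s1 /= /upd.
have := @J_record_loop (16 + N) [:: blk [:: 29 <~ V 29 :+: flag 0; 30 <~ V 30 :+: flag 1; next_record] & k]
  W r x m s1 (fun p q => K (p + inc1 r)%N (q + inc0 r)%N).
rewrite E0; apply=> //.
  by apply: (recAt_ext (extends_frame fr1)) rc => a Ha; rewrite (frame_mem fr1)//; lia.
case=> m2 ps2 hs2 tr2 te2 nc2 nd2 t2 p q fr2 e27 cl2 ep eq' lp lq.
have {}fr2 := frame_trans fr1 fr2.
rewrite /= in e27 ep eq' lp lq.
have {}e27 : m2 27%N = m0 27%N by rewrite e27 /s1 /= /upd.
have rd a : ~~ (25 <= a < 31)%N -> m2 a = m0 a by exact: (frame_mem fr2).
have [e4 e1] : m2 4 = m0 4 /\ m2 1%N = m0 1%N by split; apply: rd.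
have rF i : (i < 5)%N -> m2 (m0 27%N + n + n + m + m + m + m + i)%N = m0 (flag_loc A (m0 27%N) i).
  by move=> i5; rewrite rd// /flag_loc; lia.
jdet; jdet; jdet; jdet; jdet; jdet; jdet.
set s3 := Store _ _ _ _ _ _ _ _.
have E2 := rF 0%N isT; have E3 := rF 1%N isT.
have g1 := rec_inc1 rc; have g0 := rec_inc0 rc; rewrite /= in g1 g0.
have e29' : mem s3 29 = (p + inc1 r)%N.
  rewrite /s3 /= /upd /= e4 e1 e27 ep m4 m1; congr addn; rewrite -g1 -E2.
  by rewrite ?ifF//; apply/eqP; lia.
have e30' : mem s3 30 = (q + inc0 r)%N.
  rewrite /s3 /= /upd /= e4 e1 e27 eq' m4 m1; congr addn; rewrite -g0 -E3.
  by rewrite ?ifF//; apply/eqP; lia.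
apply: (J_weak (H s3 _ _ _ _ _ e29' e30' _ _)) => //; try lia.
- by apply: frame_trans fr2 _; frm.
- by rewrite /s3 /= /upd /= e27 e4 e1 m4 m1 /reclen -/n -/m; lia.
- by move: lp; rewrite /s1 /= /upd /=; lia.
- by move: lq; rewrite /s1 /= /upd /=; lia.
Qed.

Lemma J_evalv_loop N k W (rs : seq rnd) x s (K : nat -> nat -> R) :
  tapeAt f W s (mem s 27) rs -> mem s 12 = (mem s 27 + size rs * reclen A)%N ->
  mem s 4 = n -> mem s 1 = m ->
  (64 <= mem s 27)%N -> clean s -> onth (pts s) (mem s 31) = Some x ->
  (forall s' p q, frame 25 31 s s' -> clean s' -> mem s' 29 = p -> mem s' 30 = q ->
    (p <= mem s 29 + size rs * W)%N -> (q <= mem s 30 + size rs * W)%N ->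
    J N (k, s') (K p q)) ->
  J (size rs * (update_cost + 1) + 1 + N) (evalv_loop :: k, s)
    (EV f rs x K (mem s 29) (mem s 30)).
Proof.
elim: rs s => [|r rs IH] [m0 ps hs tr te nc nd t] /= tp e12 m4 m1 h27 cl hx H.
  rewrite mul0n add0n; apply: J_while0; first by rewrite /=; lia.
  by apply: H => //; [frm | rewrite /=; lia | rewrite /=; lia].
case: tp => rc tp.
rewrite (_ : (_ + N = 1 + (update_cost + (size rs * (update_cost + 1) + 1 + N)))%N); last by rewrite mulSn; lia.
apply: J_while1; first by rewrite /= e12 mulSn /reclen; lia.
set s1 := Store _ _ _ _ _ _ _ _.
have fr1 : frame 25 31 (Store m0 ps hs tr te nc nd t) s1 by frm.
have := @J_update (size rs * (update_cost + 1) + 1 + N) (evalv_loop :: k) W r x s1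
  (EV f rs x K); apply=> //.
  by apply: (recAt_ext (extends_frame fr1)) rc => a Ha; rewrite (frame_mem fr1)//; lia.
move=> s2 p q fr2 e27 cl2 <- <- lp lq; have {}fr2 := frame_trans fr1 fr2.
rewrite /= in e27 lp lq.
apply: IH => //.
- rewrite e27; apply: (tapeAt_ext (extends_frame fr2)) tp => a Ha.
  by apply: (frame_mem fr2); lia.
- by rewrite (frame_mem fr2 (a := 12%N) isT) e27 /= e12 mulSn; lia.
- by rewrite (frame_mem fr2 (a := 4%N) isT).
- by rewrite (frame_mem fr2 (a := 1%N) isT).
- by rewrite e27; lia.
- by rewrite (frame_mem fr2 (a := 31%N) isT); exact: (frame_onth fr2).
- move=> s' p' q' f' cl' ep eq' lp' lq'; apply: H => //; rewrite ?mulSn; try lia.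
  exact: frame_trans fr2 f'.
Qed.

(* [Rep s rs]: the tape of [s] holds the records [rs]. *)
Record Rep kb r0 W (s : store X) (rs : seq rnd) : Prop := IsRep {
  rep_n : mem s 4 = n;
  rep_m : mem s 1 = m;
  rep_k : mem s 6 = kb;
  rep_r : mem s 7 = r0.+1;
  rep_top : mem s 12 = (64 + size rs * reclen A)%N;
  rep_clean : clean s;
  rep_tape : tapeAt f W s 64 rs }.

Lemma Rep_ext kb r0 W s s' rs : extends s s' -> clean s' ->
  (forall a, (a < 13)%N && (a != 0)%N || (64 <= a < 64 + size rs * reclen A)%N ->
    mem s' a = mem s a) ->
  Rep kb r0 W s rs -> Rep kb r0 W s' rs.
Proof.
move=> ext cl H [? ? ? ? ? ? tp]; split => //; try by rewrite H.
by apply: (tapeAt_ext ext) tp => a Ha; apply: H; rewrite Ha orbT.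
Qed.

Lemma Rep_frame kb r0 W lo hi s s' rs : frame lo hi s s' -> clean s' ->
  (13 <= lo)%N -> (hi <= 64)%N -> Rep kb r0 W s rs -> Rep kb r0 W s' rs.
Proof.
move=> fr cl l13 h64; apply: Rep_ext => //; first exact: extends_frame fr.
by move=> a Ha; apply: (frame_mem fr); lia.
Qed.

Definition evalv_cost t := (t * (update_cost + 1) + 10)%N.

(** The bounds [size rs * W] on the counters are carried along because the cost of the next coin is
    proportional to a difference of counters and must be bounded for every outcome. *)
Lemma J_evalv N k kb r0 W (rs : seq rnd) x s (K : nat -> nat -> R) :
  Rep kb r0 W s rs -> onth (pts s) (mem s 31) = Some x ->
  (forall s' p q, frame 25 31 s s' -> clean s' -> mem s' 29 = p -> mem s' 30 = q ->
    (p <= size rs * W)%N -> (q <= size rs * W)%N -> J N (k, s') (K p q)) ->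
  J (evalv_cost (size rs) + N) (evalv :: k, s) (EV f rs x K 0 0).
Proof.
case: s => m0 ps hs tr te nc nd t /= rep hx H.
rewrite (_ : (_ + N = 7 + (size rs * (update_cost + 1) + 1 + (2 + N)))%N); last first.
  by rewrite /evalv_cost; lia.
jdet; jdet; jdet; jdet; jdet; jdet; jdet; set s1 := Store _ _ _ _ _ _ _ _.
have fr1 : frame 25 31 (Store m0 ps hs tr te nc nd t) s1 by frm.
have rep1 : Rep kb r0 W s1 rs.
  by apply: (Rep_frame fr1 _ _ _ rep) => //; exact: rep_clean rep.
apply: (J_evalv_loop (s := s1) (W := W)) => //.
- exact: rep_tape rep1.
- exact: rep_top rep1.
- exact: rep_n rep1.
- exact: rep_m rep1.
- exact: rep_clean rep1.
case=> m2 ps2 hs2 tr2 te2 nc2 nd2 t2 p q fr2 cl2 ep eq' lp lq.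
jdet; apply: (J_weak (H _ p q _ _ _ _ _ _)) => //; try lia.
by apply: frame_trans fr1 (frame_trans fr2 _); frm.
Qed.

Definition law (b : bool) := if b then Dtrain else Dtest.

Lemma J_draw N (b : bool) k s (kap : X -> R) : bm kap ->
  (forall s' x, frame 31 33 s s' -> (clean s -> clean s') ->
    onth (pts s') (mem s' 31) = Some x -> (b -> (mem s' 32 != 0%N) = f x) ->
    J N (k, s') (kap x)) ->
  J N.+1 (draw b :: k, s) (mean (law b) kap).
Proof.
case: s => m0 ps hs tr te nc nd t bk H; case: b H => H.
  apply: J_train => // x; apply: H => //=.
  - split => //= [a Ha||]; [by updout|by exists [:: x]; rewrite cats1|by exists [::]; rewrite cats0].
  - by rewrite /upd /= -cats1 onth_size_cat.
  - by rewrite /upd /=; case: (f x).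
apply: J_test => // x; apply: H => //=.
- split => //= [a Ha||]; [by updout|by exists [:: x]; rewrite cats1|by exists [::]; rewrite cats0].
- by rewrite /upd /= -cats1 onth_size_cat.
Qed.

(** The weights u(v) for [true] and g(v) for [false] at v = p - q; truncated subtraction plays the
    role of the maximum with 0. *)
Definition bern kb b (p q : nat) : R :=
  (1 - 2^-1 ^+ kb) ^+ (if b : bool then q - p else p - q)%N.

Lemma bern01 kb b p q : 0 <= bern kb b p q <= 1.
Proof.
have h : (0 : R) <= 1 - (2^-1 : R) ^+ kb <= 1.
  have : 2^-1 ^+ kb <= 1 :> R by rewrite exprn_ile1//; lra.
  have : 0 <= 2^-1 ^+ kb :> R by rewrite exprn_ge0.
  lra.
case/andP: h => h0 h1; rewrite exprn_ge0//= exprn_ile1//.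
Qed.

(* The probability that the coin of [x] comes up heads after the rounds [rs]:
   u for [b = true], g for [b = false]. *)
Definition wt kb b (rs : seq rnd) (x : X) : R := EV f rs x (bern kb b) 0 0.

Lemma bm_wt kb b rs : bm (wt kb b rs).
Proof. exact: bm_EV. Qed.

Lemma wt01 kb b rs x : 0 <= wt kb b rs x <= 1.
Proof.
apply/andP; split.
  rewrite -(EV_cst f rs x 0 0 0); apply: (le_EV mf) => p q; by case/andP: (bern01 kb b p q).
rewrite -[leRHS](EV_cst f rs x 1 0 0); apply: (le_EV mf) => p q; by case/andP: (bern01 kb b p q).
Qed.

Definition toss_cost kb W t := (evalv_cost t + (coin_cost kb (t * W) + 2))%N.

(* Evaluates the point 31 and tosses its coin. *)
Lemma J_toss N k kb r0 W b (rs : seq rnd) x s l v1 v0 :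
  Rep kb r0 W s rs -> onth (pts s) (mem s 31) = Some x ->
  (forall s', frame 20 31 s s' -> clean s' -> mem s' 20 != 0%N -> J N (blk l :: k, s') v1) ->
  (forall s', frame 20 31 s s' -> clean s' -> mem s' 20 = 0%N -> J N (blk l :: k, s') v0) ->
  J (toss_cost kb W (size rs) + N) (blk [:: evalv, coin (weight b) & l] :: k, s)
    (wt kb b rs x * v1 + (1 - wt kb b rs x) * v0).
Proof.
case: s => m0 ps hs tr te nc nd t rep hx H1 H0.
rewrite -EV_affine (_ : (_ + N = 1 + (evalv_cost (size rs) + (1 + (coin_cost kb (size rs * W) + N))))%N);
  last by rewrite /toss_cost; lia.
jdet; set s1 := Store _ _ _ _ _ _ _ _.
have fr1 : frame 20 31 (Store m0 ps hs tr te nc nd t) s1 by frm.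
apply: (J_evalv (s := s1) (kb := kb) (r0 := r0) (W := W)) => //.
  by apply: (Rep_frame fr1 _ _ _ rep) => //; exact: rep_clean rep.
case=> m2 ps2 hs2 tr2 te2 nc2 nd2 t2 p q fr2 cl2 ep eq' lp lq.
have {}fr2 := frame_trans fr1 (frame_widen (isT : 20 <= 25)%N (leqnn 31) fr2).
jdet; set s3 := Store _ _ _ _ _ _ _ _.
have fr3 : frame 20 31 (Store m0 ps hs tr te nc nd t) s3 by apply: frame_trans fr2 _; frm.
rewrite /= in ep eq'.
have e6 : m2 6%N = kb by have /= -> := frame_mem fr3 (a := 6%N) isT; exact: rep_k rep.
refine (J_weak (J_coin (s := s3) (E := if b then (q - p)%N else (p - q)%N) e6 _
  (v1 := v1) (v0 := v0) (N := N) _ _) _ _).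
- by case: b; rewrite /= /upd /= ep eq'.
- move=> s' f4 c4; apply: H1; last exact: c4.
  exact: frame_trans fr3 (frame_widen (leqnn 20) (isT : 25 <= 31)%N f4).
- move=> s' f4 c4; apply: H0; last exact: c4.
  exact: frame_trans fr3 (frame_widen (leqnn 20) (isT : 25 <= 31)%N f4).
- rewrite /coin_cost leq_add2r leq_add2r leq_mul2r; case: b; apply/orP; right; lia.
- exact: lexx.
Qed.

End sampling.

Definition write_flag i e := Assign (V 35 :+: Cst i) e.

(** The hypothesis and both signs come from the first record, which the second [sample_record]
    overwrites, since register 12 has not moved. The test function left on the tape is therefore
    independent of the sign by which it is multiplied. *)
Definition round := blk [:: sample_record; 27 <~ V 12; 28 <~ V 1; hybrid; 36 <~ V 26;
  31 <~ Deref (V 12 :+: V 4 :+: V 4); 28 <~ Cst 0; hybrid; 37 <~ V 26; sample_record;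
  draw true; evalv; coin (weight true);
  If (V 20) (write_flag 1 (V 9)) (write_flag 1 (Cst 0));
  draw false; evalv; coin (weight false);
  If (V 20) (write_flag 0 (V 8)) (write_flag 0 (Cst 0));
  If (V 36) (write_flag 2 (Cst 0)) (write_flag 2 (Cst 1));
  If (V 37) (write_flag 3 (Cst 0)) (write_flag 3 (Cst 1));
  write_flag 4 (V 36); 12 <~ V 35 :+: Cst 5; 13 <~ V 13 :-: Cst 1].

Definition rounds := While (V 13) round.

Lemma upd_neq (m0 : nat -> nat) a b v : b != a -> upd m0 a v b = m0 b.
Proof. by rewrite /upd => /negbTE ->. Qed.

Lemma upd_eq (m0 : nat -> nat) a v : upd m0 a v a = v.
Proof. by rewrite /upd eqxx. Qed.

(** * Drawing a record, and the expectation of one round *)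

Section sample_lemmas.
Context {R : realType} {d : measure_display} {X : measurableType d}.
Variables (A : learner R X) (T : nat) (f : concept X).
Variables (Dtrain Dtest : probability X R).
Variables (Post G : store X -> Prop).
Hypothesis mf : measurable_fun setT f.
Variables (kb r0 W : nat).

Notation J := (J A T f Dtrain Dtest Post G).
Notation Rep := (Rep f kb r0 W).
Notation wt := (wt f kb).
Let n := ntrain A.
Let m := ntest A.
Notation rnd := (rnd A).
Notation law := (law Dtrain Dtest).

Definition Qlaw b (rs : seq rnd) : probability X R :=
  sampler (law b) (bm_wt mf kb b rs) r0.

Definition try_cost t := (toss_cost A kb W t + 12)%N.

Lemma J_try N N1 k (b : bool) (rs : seq rnd) s c (kap vx : X -> R) : bm kap -> bm vx ->
  Rep s rs -> mem s 33 = c.+1 -> (N < N1)%N ->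
  (forall s' x, frame 20 34 s s' -> clean s' -> onth (pts s') (mem s' 31) = Some x ->
    (b -> (mem s' 32 != 0%N) = f x) -> J N (k, s') (kap x)) ->
  (forall s' x, frame 20 34 s s' -> clean s' -> onth (pts s') (mem s' 31) = Some x ->
    (b -> (mem s' 32 != 0%N) = f x) -> mem s' 33 = c ->
    J N1 (sample_loop b :: k, s') (vx x)) ->
  J (try_cost (size rs) + N1) (sample_loop b :: k, s)
    (mean (law b) (fun x => wt b rs x * kap x + (1 - wt b rs x) * vx x)).
Proof.
case: s => m0 ps hs tr te nc nd t bk bv rep m33 NN1 H1 H0.
rewrite (_ : (_ + N1 = 3 + (toss_cost A kb W (size rs) + (9 + N1)))%N); last first.
  by rewrite /try_cost; lia.
apply: J_while1; first by rewrite /= [m0 33%N]m33.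
jdet; set s1 := Store _ _ _ _ _ _ _ _.
have fr1 : frame 20 34 (Store m0 ps hs tr te nc nd t) s1 by frm.
have bw := bm_wt mf kb b rs.
apply: J_draw.
  by apply: bmD; apply: bmM => //; exact: bmB (bm_cst _) bw.
move=> s2 x fr2 cl2 hx hl.
have e33 : mem s2 33 = c.+1 by rewrite (frame_mem fr2 (a := 33%N) isT).
have {}fr2 := frame_trans fr1 (frame_widen (isT : 20 <= 31)%N (isT : 33 <= 34)%N fr2).
have {}cl2 := cl2 (rep_clean rep).
have rep2 : Rep s2 rs by exact: (Rep_frame fr2 _ _ _ rep).
refine (J_toss mf b (s := s2)
  (l := [:: If (V 20) (33 <~ Cst 0) (33 <~ V 33 :-: Cst 1)]) rep2 hx _ _); case=> m3 ps3 hs3 tr3 te3 nc3 nd3 t3 fr3 cl3 e20.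
all: have e33' : m3 33%N = c.+1 by have /= -> := frame_mem fr3 (a := 33%N) isT.
all: have e31 : m3 31%N = mem s2 31 by have /= -> := frame_mem fr3 (a := 31%N) isT.
all: have e32 : m3 32%N = mem s2 32 by have /= -> := frame_mem fr3 (a := 32%N) isT.
all: have hx3 := frame_onth fr3 hx.
all: have {}fr3 := frame_trans fr2 (frame_widen (leqnn 20) (isT : 31 <= 34)%N fr3).
all: jdet; apply: J_if; cbn [eval]; rewrite /= in e20.
- rewrite e20; jdet; jdet; apply: (J_weak (n := N.+1)); [|lia|exact: lexx].
  apply: J_while0; first by rewrite /= /upd.
  apply: H1 => //=; rewrite /upd /= ?e31 ?e32 //.
  by apply: frame_trans fr3 _; frm.
- rewrite e20 /=; jdet; jdet; apply: (J_weak (n := N1)); [|lia|exact: lexx].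
  apply: H0 => //=; rewrite /upd /= ?e31 ?e32 ?e33' ?subn1 //.
  by apply: frame_trans fr3 _; frm.
Qed.

Lemma J_sample_loop N k (b : bool) (rs : seq rnd) s r (kap : X -> R) : bm kap ->
  Rep s rs -> mem s 33 = r.+1 ->
  (forall s' x, frame 20 34 s s' -> clean s' -> onth (pts s') (mem s' 31) = Some x ->
    (b -> (mem s' 32 != 0%N) = f x) -> J N (k, s') (kap x)) ->
  J (r.+1 * try_cost (size rs) + (1 + N)) (sample_loop b :: k, s)
    (mean (sampler (law b) (bm_wt mf kb b rs) r) kap).
Proof.
move=> bk; elim: r s => [|r IH] s rep m33 H.
  (* On the last try the point is kept whatever the coin shows, so both branches have the same
     value; this matches the base case of [sampler]. *)
  rewrite mul1n (_ : mean _ _ =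
    mean (law b) (fun x => wt b rs x * kap x + (1 - wt b rs x) * kap x)); last first.
    by apply: eq_mean => x; ring.
  apply: (J_try (c := 0) bk bk rep m33 _ H); first by lia.
  case=> m3 ps3 hs3 tr3 te3 nc3 nd3 t3 x fr3 cl3 hx hl e33.
  apply: J_while0; first by rewrite /= [m3 33%N]e33.
  by apply: H => //; apply: frame_trans fr3 _; frm.
rewrite mean_samplerS//; last by move=> x; exact: wt01.
rewrite mulSn -addnA; apply: (J_try bk (bm_cst _) rep m33 _ H); first by lia.
move=> s' x fr' cl' hx hl e33; apply: IH => //.
  exact: (Rep_frame fr' _ _ _ rep).
by move=> s2 y fr2; apply: H; exact: frame_trans fr' fr2.
Qed.

Definition sample_cost t := (r0.+1 * try_cost t + 10)%N.

Lemma J_sample N k (b : bool) (rs : seq rnd) s (kap : X -> R) : bm kap ->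
  Rep s rs ->
  (forall s' x, frame 20 34 s s' -> clean s' -> onth (pts s') (mem s' 31) = Some x ->
    (b -> (mem s' 32 != 0%N) = f x) -> J N (k, s') (kap x)) ->
  J (sample_cost (size rs) + N) (sample b :: k, s) (mean (Qlaw b rs) kap).
Proof.
case: s => m0 ps hs tr te nc nd t bk rep H.
apply: (J_weak (n := 3 + (r0.+1 * try_cost (size rs) + (1 + N.+1)))); last 2 first.
- by rewrite /sample_cost; lia.
- exact: lexx.
jdet; jdet; jdet; set s1 := Store _ _ _ _ _ _ _ _.
have fr1 : frame 20 34 (Store m0 ps hs tr te nc nd t) s1 by frm.
have rep1 : Rep s1 rs by apply: (Rep_frame fr1 _ _ _ rep) => //; exact: rep_clean rep.
apply: J_sample_loop => //; first by rewrite /s1 /= /upd /=; exact: rep_r rep.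
case=> m3 ps3 hs3 tr3 te3 nc3 nd3 t3 x fr3 cl3 hx hl; jdet; apply: H => //.
by apply: frame_trans fr1 (frame_trans fr3 _); frm.
Qed.

(* Stores that agree up to scratch registers and the tape from [wp] on. *)
Record wframe wp (s s' : store X) : Prop := WFrame {
  wframe_mem : forall a, ((a < 20) || (36 <= a))%N -> (a < wp)%N -> mem s' a = mem s a;
  wframe_ext : extends s s';
  wframe_clean : clean s' }.

Lemma wframe_trans wp wp' s1 s2 s3 : (wp <= wp')%N ->
  wframe wp s1 s2 -> wframe wp' s2 s3 -> wframe wp s1 s3.
Proof.
move=> ww [h1 e1 c1] [h2 e2 c2]; split => //; last exact: extends_trans e1 e2.
by move=> a Ha la; rewrite h2 ?h1//; lia.
Qed.

Lemma wframe_frame wp lo hi s s' : (20 <= lo)%N -> (hi <= 36)%N ->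
  frame lo hi s s' -> clean s' -> wframe wp s s'.
Proof.
move=> ll hh fr cl; split => //; last exact: extends_frame fr.
by move=> a Ha la; apply: (frame_mem fr); lia.
Qed.

Lemma Rep_wframe wp s s' (rs : seq rnd) : wframe wp s s' ->
  (64 + size rs * reclen A <= wp)%N -> Rep s rs -> Rep s' rs.
Proof.
move=> [h e c] ww; apply: Rep_ext => // a Ha; apply: h; lia.
Qed.

Lemma J_sample_many_loop N k (b : bool) (rs : seq rnd) c s (kap : c.-tuple X -> R) : bm kap ->
  Rep s rs -> mem s 34 = c -> (64 + size rs * reclen A <= mem s 35)%N ->
  (forall s' (Z : c.-tuple X), wframe (mem s 35) s s' -> stored s' (mem s 35) Z ->
    (b -> labeled f s' (mem s 35) Z) -> mem s' 35 = (mem s 35 + c + c)%N ->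
    J N (k, s') (kap Z)) ->
  J (c * (sample_cost (size rs) + 12) + 1 + N) (sample_many_loop b :: k, s)
    (mean (iid (Qlaw b rs) c) kap).
Proof.
elim: c s kap => [|c IH] [m0 ps hs tr te nc nd t] kap bk rep m34 h35 H.
  rewrite mul0n add0n mean_iid0//; apply: J_while0; first by rewrite /= [m0 34%N]m34.
  apply: H => //.
  - by apply: (@wframe_frame _ 20 36) => //; [frm | exact: rep_clean rep].
  - by case.
  - by move=> _ [].
  - by rewrite !addn0.
rewrite mean_iidS// mulSn (_ : (_ + N = 2 + (sample_cost (size rs) +
  (9 + (c * (sample_cost (size rs) + 12) + 1 + N).+1)))%N); last by lia.
apply: J_while1; first by rewrite /= [m0 34%N]m34.
jdet; set s1 := Store _ _ _ _ _ _ _ _.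
have fr1 : frame 20 34 (Store m0 ps hs tr te nc nd t) s1 by frm.
have rep1 : Rep s1 rs by apply: (Rep_frame fr1 _ _ _ rep) => //; exact: rep_clean rep.
apply: J_sample => //; first exact: (bm_mean (iid (Qlaw b rs) c) (bm_tcons bk)).
case=> m2 ps2 hs2 tr2 te2 nc2 nd2 t2 x fr2 cl2 hx hl.
have {}fr2 := frame_trans fr1 fr2; rewrite /= in hx hl h35 m34.
have e34 : m2 34%N = c.+1 by have /= -> := frame_mem fr2 (a := 34%N) isT.
have e35 : m2 35%N = m0 35%N by have /= -> := frame_mem fr2 (a := 35%N) isT.
set wp := m0 35%N in h35 H e35 *; have w64 : (64 <= wp)%N by lia.
do 9 jdet; rewrite !e35 ?(@upd_neq _ _ 35) ?e35; try (by apply/eqP; lia).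
set s3 := Store _ _ _ _ _ _ _ _.
have g35 : mem s3 35 = (wp + 2)%N.
  by rewrite /s3 /= upd_neq// upd_eq; congr addn; rewrite ?upd_neq ?e35//; apply/eqP; lia.
have gw a : (64 <= a)%N -> mem s3 a =
    if (a == wp + 1)%N then m2 32%N else if a == wp then m2 31%N else m2 a.
  move=> a64; rewrite /s3 /= upd_neq; last by apply/eqP; lia.
  rewrite upd_neq; last by apply/eqP; lia.
  rewrite {1}/upd; case: eqP => // _; first by rewrite upd_neq//; apply/eqP; lia.
have gs a : (a < 64)%N -> a != 34%N -> a != 35%N -> mem s3 a = m2 a.
  move=> a64 a34 a35; rewrite /s3 /= !upd_neq//; apply/eqP; lia.
have g34 : mem s3 34 = c.
  by rewrite /s3 /= upd_eq !upd_neq ?e34 ?subn1//; apply/eqP; lia.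
have wf3 : wframe wp (Store m0 ps hs tr te nc nd t) s3.
  split => //; last 1 first.
  - exact: extends_frame fr2.
  move=> a Ha la; case: (ltnP a 64) => [a64|a64].
    by rewrite gs; [have /= -> := frame_mem fr2 (a := a) _; lia | lia | lia | lia].
  rewrite gw// !ifF; try (by apply/eqP; lia).
  by have /= -> := frame_mem fr2 (a := a) _; lia.
have rep3 : Rep s3 rs by apply: (Rep_wframe wf3).
apply: (J_weak (IH s3 (fun z => kap (tcons (x, z))) _ rep3 g34 _ _)); last 2 first.
- by lia.
- exact: lexx.
- exact: bm_pair1 (bm_tcons bk) x.
- by rewrite g35; lia.
rewrite g35 => s' Z wf' st' lb' e35'; apply: H.
- by apply: (wframe_trans _ wf3 wf'); lia.
- case=> [|j] y /= Hy.
    case: Hy => <-; rewrite !addn0 (wframe_mem wf') ?gw; try lia.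
    rewrite ifF ?eqxx; last by apply/eqP; lia.
    by have [[l ->] _] := wframe_ext wf'; apply: onth_cat_some.
  by have := st' j y Hy; congr (onth _ (mem _ _) = _); lia.
- move=> bt [|j] y /= Hy.
    case: Hy => <-; rewrite !addn0 (wframe_mem wf') ?gw ?eqxx; try lia.
  by have := lb' bt j y Hy; congr ((mem _ _ != _) = _); lia.
- by rewrite e35' /= -/wp; lia.
Qed.

Definition many_cost c t := (c * (sample_cost t + 12) + 10)%N.

Lemma J_sample_many N k (b : bool) e (rs : seq rnd) c s (kap : c.-tuple X -> R) : bm kap ->
  Rep s rs -> eval (mem s) e = c -> (64 + size rs * reclen A <= mem s 35)%N ->
  (forall s' (Z : c.-tuple X), wframe (mem s 35) s s' -> stored s' (mem s 35) Z ->
    (b -> labeled f s' (mem s 35) Z) -> mem s' 35 = (mem s 35 + c + c)%N ->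
    J N (k, s') (kap Z)) ->
  J (many_cost c (size rs) + N) (sample_many b e :: k, s) (mean (iid (Qlaw b rs) c) kap).
Proof.
case: s => m0 ps hs tr te nc nd t bk rep ec h35 H.
apply: (J_weak (n := 3 + (c * (sample_cost (size rs) + 12) + 1 + N.+1))); last 2 first.
- by rewrite /many_cost; lia.
- exact: lexx.
jdet; jdet; jdet; set s1 := Store _ _ _ _ _ _ _ _.
have fr1 : frame 20 36 (Store m0 ps hs tr te nc nd t) s1 by frm.
have rep1 : Rep s1 rs by apply: (Rep_frame fr1 _ _ _ rep) => //; exact: rep_clean rep.
have wf1 : wframe (m0 35%N) (Store m0 ps hs tr te nc nd t) s1.
  by apply: (@wframe_frame _ 20 36 _ _ isT isT fr1); exact: rep_clean rep.
apply: J_sample_many_loop => //.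
case=> m3 ps3 hs3 tr3 te3 nc3 nd3 t3 Z wf3 st lb e35; jdet; apply: H => //.
apply: (wframe_trans (leqnn _) wf1); apply: (wframe_trans (leqnn _) wf3).
apply: (@wframe_frame _ 20 36) => //; first by frm.
exact: wframe_clean wf3.
Qed.

Definition record_sample_cost t := (many_cost n t + (many_cost m t + (many_cost m t + 10)))%N.

Lemma J_sample_record N k (rs : seq rnd) s
    (kap : n.-tuple X * m.-tuple X * m.-tuple X -> R) : bm kap -> Rep s rs ->
  (forall s' (Z : n.-tuple X) (P Q : m.-tuple X), wframe (mem s 12) s s' -> Rep s' rs ->
    stored s' (mem s 12) Z -> labeled f s' (mem s 12) Z ->
    stored s' (mem s 12 + n + n) P -> stored s' (mem s 12 + n + n + m + m) Q ->
    mem s' 35 = (mem s 12 + n + n + m + m + m + m)%N -> J N (k, s') (kap (Z, P, Q))) ->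
  J (record_sample_cost (size rs) + N) (sample_record :: k, s)
    (mean (iid (Qlaw true rs) n) (fun Z => mean (iid (Qlaw true rs) m)
      (fun P => mean (iid (Qlaw false rs) m) (fun Q => kap (Z, P, Q))))).
Proof.
case: s => m0 ps hs tr te nc nd t bk rep H.
rewrite /record_sample_cost (_ : (_ + N = 3 + (many_cost n (size rs) + (1 + (many_cost m (size rs)
  + (1 + (many_cost m (size rs) + (5 + N)))))))%N); last by lia.
jdet; jdet; jdet; set s1 := Store _ _ _ _ _ _ _ _.
have fr1 : frame 20 36 (Store m0 ps hs tr te nc nd t) s1 by frm.
have rep1 : Rep s1 rs by apply: (Rep_frame fr1 _ _ _ rep) => //; exact: rep_clean rep.
have top : m0 12%N = (64 + size rs * reclen A)%N := rep_top rep.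
have e35 : mem s1 35 = m0 12%N by rewrite /s1 /= upd_eq.
have wf1 : wframe (m0 12%N) (Store m0 ps hs tr te nc nd t) s1.
  by apply: (@wframe_frame _ 20 36 _ _ isT isT fr1); exact: rep_clean rep.
have b2 := bm_mean (iid (Qlaw false rs) m) bk.
apply: J_sample_many => //.
- exact: (bm_mean (iid (Qlaw true rs) m) b2).
- exact: rep_n rep1.
- by rewrite e35 top.
rewrite e35; case=> m2 ps2 hs2 tr2 te2 nc2 nd2 t2 Z wf2 stZ lbZ e35'; rewrite /= in e35'.
have {}wf2 := wframe_trans (leqnn _) wf1 wf2.
jdet; set s3 := Store _ _ _ _ _ _ _ _.
have wf3 : wframe (m0 12%N) (Store m0 ps hs tr te nc nd t) s3 by case: wf2.
have rep3 : Rep s3 rs by apply: (Rep_wframe wf3) rep; rewrite top.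
apply: J_sample_many => //.
- exact: (bm_pair1 b2 Z).
- exact: rep_m rep3.
- by rewrite /= e35' top; lia.
case=> m4 ps4 hs4 tr4 te4 nc4 nd4 t4 P wf4 stP _ e354; rewrite /= e35' in e354 stP.
jdet; set s5 := Store _ _ _ _ _ _ _ _.
have wf5' : wframe (m0 12 + n + n)%N s3 s5 by move: wf4; rewrite /= e35'; case.
have wf5 : wframe (m0 12%N) (Store m0 ps hs tr te nc nd t) s5.
  by apply: (wframe_trans _ wf3 wf5'); lia.
have rep5 : Rep s5 rs by apply: (Rep_wframe wf5) rep; rewrite top.
apply: J_sample_many => //.
- exact: (bm_pair1 bk (Z, P)).
- exact: rep_m rep5.
- by rewrite /= e354 top; lia.
case=> m6 ps6 hs6 tr6 te6 nc6 nd6 t6 Q wf6 stQ _ e356; rewrite /= e354 in e356 stQ.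
jdet; set s7 := Store _ _ _ _ _ _ _ _.
have wf7' : wframe (m0 12 + n + n + m + m)%N s5 s7 by move: wf6; rewrite /= e354; case.
have wf73 : wframe (m0 12 + n + n)%N s3 s7 by apply: (wframe_trans _ wf5' wf7'); lia.
have wf7 : wframe (m0 12%N) (Store m0 ps hs tr te nc nd t) s7.
  by apply: (wframe_trans _ wf3 wf73); lia.
apply: (J_weak (H s7 Z P Q _ _ _ _ _ _ _)) => //; last by lia.
- by apply: (Rep_wframe wf7) rep; rewrite top.
- apply: (stored_ext A (wframe_ext wf73)) => // a /= Ha; apply: (wframe_mem wf73); lia.
- apply: (@labeled_ext _ _ _ A f s3) => [a /= Ha|]; last exact: lbZ.
  by apply: (wframe_mem wf73); lia.
- apply: (stored_ext A (wframe_ext wf7')) => // a /= Ha; apply: (wframe_mem wf7'); lia.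
Qed.


Lemma J_if_flag N a i e1 e0 k m0 F ps hs tr te nc nd t v : m0 35%N = F ->
  J N (k, Store (upd m0 (F + i) (if m0 a != 0%N then eval m0 e1 else eval m0 e0))
    ps hs tr te nc nd t.+2) v ->
  J N.+2 (If (V a) (write_flag i e1) (write_flag i e0) :: k,
    Store m0 ps hs tr te nc nd t) v.
Proof.
move=> E H; apply: J_if; cbn [eval]; case: ifP H => _ H;
  by apply: J_assign; rewrite /= E.
Qed.

Definition round_end := [:: If (V 36) (write_flag 2 (Cst 0)) (write_flag 2 (Cst 1));
  If (V 37) (write_flag 3 (Cst 0)) (write_flag 3 (Cst 1));
  write_flag 4 (V 36); 12 <~ V 35 :+: Cst 5; 13 <~ V 13 :-: Cst 1].

(* The state of a round once the samples of its record are drawn. *)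
Record partialRec (s : store X) (rs : seq rnd) (Z : n.-tuple X) (P Q : m.-tuple X)
  hv v0 H ka kl : Prop := PartialRec {
  part_rep : Rep s rs;
  part_Z : stored s (mem s 12) Z;
  part_lab : labeled f s (mem s 12) Z;
  part_P : stored s (mem s 12 + n + n) P;
  part_Q : stored s (mem s 12 + n + n + m + m) Q;
  part_35 : mem s 35 = (mem s 12 + n + n + m + m + m + m)%N;
  part_36 : mem s 36 = hv;
  part_37 : mem s 37 = v0;
  part_H : handle s hv H;
  part_8 : mem s 8 = ka;
  part_9 : mem s 9 = kl }.

Lemma partialRec_ext s s' rs Z P Q hv v0 H ka kl : extends s s' -> clean s' ->
  (forall a, (0 < a < 13)%N || (35 <= a < 38)%N || (64 <= a < mem s 35)%N ->
    mem s' a = mem s a) ->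
  partialRec s rs Z P Q hv v0 H ka kl -> partialRec s' rs Z P Q hv v0 H ka kl.
Proof.
move=> ext cl E [rp hZ hl hP hQ h35 h36 h37 hH h8 h9].
have top := rep_top rp.
have e12 : mem s' 12 = mem s 12 by apply: E.
rewrite h35 in E; split; rewrite ?e12 //; try by rewrite E.
- apply: (Rep_ext ext cl _ rp) => a Ha; apply: E; lia.
- apply: (stored_ext A ext) hZ => a Ha; apply: E; lia.
- apply: (@labeled_ext _ _ _ A f s) hl => a Ha; apply: E; lia.
- apply: (stored_ext A ext) hP => a Ha; apply: E; lia.
- apply: (stored_ext A ext) hQ => a Ha; apply: E; lia.
- exact: handle_ext ext hH.
Qed.

Lemma J_round_end N k s rs Z P Q hv v0 H ka kl i1 i0 v :
  partialRec s rs Z P Q hv v0 H ka kl ->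
  mem s (mem s 35) = i1 -> mem s (mem s 35 + 1) = i0 ->
  (i1 + m <= W)%N -> (i0 + m <= W)%N ->
  (forall s', Rep s' (rcons rs (Rnd Z P Q i1 i0 (hv == 0%N) (v0 == 0%N) H)) ->
    (forall a, (0 < a < 12)%N -> mem s' a = mem s a) -> mem s' 13 = (mem s 13).-1 ->
    J N (k, s') v) ->
  J (20 + N) (blk round_end :: k, s) v.
Proof.
case: s => m0 ps hs tr te nc nd t pr e1 e0 w1 w0 Hk.
move: (pr) => [rp hZ hl hP hQ h35 h36 h37 hH h8 h9].
rewrite /= in e1 e0 h35 h36 h37 h8 h9; have top : m0 12%N = _ := rep_top rp.
set F := m0 35%N in h35 e1 e0; have F64 : (64 <= F)%N by lia.
jdet; apply: J_if_flag; first by []; rewrite -/F; cbn [eval].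
jdet; apply: J_if_flag; first by rewrite upd_neq//; apply/eqP; lia.
rewrite -/F; cbn [eval].
jdet; jdet; jdet; jdet; jdet; jdet; jdet.
set s' := Store _ _ _ _ _ _ _ _; apply: (J_weak (n := N)); [|lia|exact: lexx].
have E a : a != 12%N -> a != 13%N -> a != (F + 2)%N -> a != (F + 3)%N -> a != (F + 4)%N ->
    mem s' a = m0 a.
  move=> a12 a13 a2 a3 a4; rewrite /s' /= upd_neq// upd_neq// upd_neq; last first.
    by rewrite !upd_neq -/F//; apply/eqP; lia.
  by rewrite !upd_neq.
have r35 (x y : nat) : upd (upd m0 (F + 2) x) (F + 3) y 35%N = F.
  by rewrite !upd_neq -/F//; apply/eqP; lia.
have E2 : mem s' (F + 2)%N = (hv == 0%N).
  rewrite /s' /= r35 upd_neq; last by apply/eqP; lia.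
  rewrite upd_neq; last by apply/eqP; lia.
  rewrite upd_neq; last by apply/eqP; lia.
  rewrite upd_neq; last by apply/eqP; lia.
  by rewrite upd_eq h36; case: eqP.
have E3 : mem s' (F + 3)%N = (v0 == 0%N).
  rewrite /s' /= r35 upd_neq; last by apply/eqP; lia.
  rewrite upd_neq; last by apply/eqP; lia.
  rewrite upd_neq; last by apply/eqP; lia.
  by rewrite upd_eq upd_neq ?h37; [case: eqP | apply/eqP; lia].
have E4 : mem s' (F + 4)%N = hv.
  rewrite /s' /= r35 upd_neq; last by apply/eqP; lia.
  rewrite upd_neq; last by apply/eqP; lia.
  by rewrite upd_eq !upd_neq ?h36//; apply/eqP; lia.
have E12 : mem s' 12 = (F + 5)%N.
  rewrite /s' /= upd_neq// upd_eq upd_neq ?r35//; apply/eqP; lia.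
have E13 : mem s' 13 = (m0 13%N).-1.
  by rewrite /s' /= upd_eq !upd_neq ?subn1 ?r35//; apply/eqP; lia.
have ext : extends (Store m0 ps hs tr te nc nd t) s'.
  by split; exists [::]; rewrite cats0.
apply: Hk => //; last first.
  by move=> a Ha; apply: E; apply/eqP; lia.
have EF : F = (64 + size rs * reclen A + n + n + m + m + m + m)%N by rewrite h35 top.
split.
- by rewrite E; [exact: rep_n rp|..]; apply/eqP; lia.
- by rewrite E; [exact: rep_m rp|..]; apply/eqP; lia.
- by rewrite E; [exact: rep_k rp|..]; apply/eqP; lia.
- by rewrite E; [exact: rep_r rp|..]; apply/eqP; lia.
- by rewrite E12 size_rcons EF mulSn /reclen -/n -/m; lia.
- exact: rep_clean rp.
apply: tapeAt_rcons.
  by apply: (tapeAt_ext ext _ (rep_tape rp)) => a Ha; apply: E; apply/eqP; lia.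
rewrite -top; split; cbn [rZ rP rQ inc1 inc0 sgn1 sgn0 rH].
- by apply: (stored_ext A ext) hZ => a /= Ha; apply: E; apply/eqP; lia.
- by apply: (@labeled_ext _ _ _ A f _ s') hl => a /= Ha; apply: E; apply/eqP; lia.
- by apply: (stored_ext A ext) hP => a /= Ha; apply: E; apply/eqP; lia.
- by apply: (stored_ext A ext) hQ => a /= Ha; apply: E; apply/eqP; lia.
- by rewrite /flag_loc -/n -/m -h35 addn0 -e1 E//; apply/eqP; lia.
- by rewrite /flag_loc -/n -/m -h35 -e0 E//; apply/eqP; lia.
- by rewrite /flag_loc -/n -/m -h35 E2.
- by rewrite /flag_loc -/n -/m -h35 E3.
- by rewrite /flag_loc -/n -/m -h35 E4; exact: handle_ext ext hH.
- by split => //; [case: (hv == 0%N) | case: (v0 == 0%N)].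
Qed.

Lemma handle_eq0 (s : store X) v o : handle s v o -> (v == 0%N) = ~~ isSome o.
Proof. by case: o => [h [i [-> _]]|->]. Qed.

Lemma bm_rejects_out (B : option (concept X) -> R) Z te :
  bm (fun z : n.-tuple X * m.-tuple X * seed A => B (output (label_with f z.1.1) z.1.2 z.2)) ->
  bm (fun r : seed A => B (output (label_with f Z) te r)).
Proof. by move=> bB; exact: (bm_pair1 bB (Z, te)). Qed.

Definition round_cost t := (record_sample_cost t + record_sample_cost t + hybrid_cost A
  + hybrid_cost A + toss_cost A kb W t + toss_cost A kb W t + 200)%N.

Section round.
Variables (ka kl : nat) (c0 c1 c2 : R) (L : n.-tuple X * m.-tuple X * m.-tuple X -> R).
Variable B : option (concept X) -> R.
Hypotheses (bL : bm L) (wa : (ka + m <= W)%N) (wl : (kl + m <= W)%N).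
Hypothesis bB : bm (fun z : n.-tuple X * m.-tuple X * seed A =>
  B (output (label_with f z.1.1) z.1.2 z.2)).

Definition mean3 (rs : seq rnd) (g : n.-tuple X * m.-tuple X * m.-tuple X -> R) :=
  mean (iid (Qlaw true rs) n) (fun Z => mean (iid (Qlaw true rs) m)
      (fun P => mean (iid (Qlaw false rs) m) (fun Q => g (Z, P, Q)))).

Lemma mean3_affine rs (r1 r2 : R) g : bm g ->
  mean3 rs (fun z => r1 + r2 * g z) = r1 + r2 * mean3 rs g.
Proof.
move=> bg; have b2 := bm_mean (iid (Qlaw false rs) m) bg.
have b3 := bm_mean (iid (Qlaw true rs) m) b2.
rewrite /mean3 -meanZ// -[in RHS](mean_cst (iid (Qlaw true rs) n) r1) -meanD; last 2 first.
- exact: bm_cst.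
- exact: bmZ.
apply: eq_mean => Z; have b2' := bm_pair1 b2 Z.
rewrite -meanZ// -[in RHS](mean_cst (iid (Qlaw true rs) m) r1) -meanD; last 2 first.
- exact: bm_cst.
- exact: bmZ.
apply: eq_mean => P; have b1' := bm_pair1 bg (Z, P).
rewrite -meanZ// -[in RHS](mean_cst (iid (Qlaw false rs) m) r1) -meanD//.
- exact: bm_cst.
- exact: bmZ.
Qed.

(** The only shape of function whose expectation over a round is computed: for it, independence of
    the two records, of the two tosses and of the oracle runs gives a closed form. *)
Definition round_value (r : rnd) := c0 + c1 * ((inc1 r)%:R - (inc0 r)%:R) +
  c2 * ((sgn1 r)%:R - (sgn0 r)%:R) * L (rZ r, rP r, rQ r) + B (rH r).

Definition outB Z te := mean (seed_law A) (fun r => B (output (label_with f Z) te r)).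

(** Here [z] is the first record, still free, while the second is already averaged in [mean3 rs L]:
    by independence the mean of sign times test function is a product. The [c1] term has the mean
    increments of the two tosses. *)
Definition round_mean (rs : seq rnd) (z : n.-tuple X * m.-tuple X * m.-tuple X) :=
  c0 + c1 * (ka%:R * mean Dtest (wt false rs) - kl%:R * mean Dtrain (wt true rs)) +
  c2 * (rej f z.1.1 z.2 - rej f z.1.1 z.1.2) * mean3 rs L + outB z.1.1 z.2.

Lemma measurable_proj13 : measurable_fun setT
  (fun z : n.-tuple X * m.-tuple X * m.-tuple X => (z.1.1, z.2)).
Proof.
by apply: measurable_fun_pair => //; apply: (measurableT_comp measurable_fst); exact: measurable_fst.
Qed.

Lemma bm_rej13 : bm (fun z : n.-tuple X * m.-tuple X * m.-tuple X => rej f z.1.1 z.2).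
Proof. exact: (bm_comp measurable_proj13 (bm_rej A mf)). Qed.

Lemma bm_rej12 : bm (fun z : n.-tuple X * m.-tuple X * m.-tuple X => rej f z.1.1 z.1.2).
Proof. exact: (bm_comp measurable_fst (bm_rej A mf)). Qed.

Lemma bm_outB : bm (fun z : n.-tuple X * m.-tuple X * m.-tuple X => outB z.1.1 z.2).
Proof. exact: (bm_comp measurable_proj13 (bm_mean (seed_law A) bB)). Qed.

Lemma bm_round_mean rs : bm (round_mean rs).
Proof.
apply: bmD bm_outB; apply: bmD; first exact: bm_cst.
apply: bmM (bm_cst _); apply: bmZ; exact: bmB bm_rej13 bm_rej12.
Qed.

Lemma J_round_draws N k s rs Z P Q hv v0 H v : partialRec s rs Z P Q hv v0 H ka kl ->
  (forall s' r, Rep s' (rcons rs r) ->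
    (forall a, (0 < a < 12)%N -> mem s' a = mem s a) -> mem s' 13 = (mem s 13).-1 ->
    J N (k, s') (round_value r)) ->
  v = c0 + c1 * (ka%:R * mean Dtest (wt false rs) - kl%:R * mean Dtrain (wt true rs)) +
    c2 * ((hv == 0%N)%:R - (v0 == 0%N)%:R) * L (Z, P, Q) + B H ->
  J (toss_cost A kb W (size rs) + toss_cost A kb W (size rs) + 60 + N)
    (blk [:: draw true, evalv, coin (weight true),
       If (V 20) (write_flag 1 (V 9)) (write_flag 1 (Cst 0)),
       draw false, evalv, coin (weight false),
       If (V 20) (write_flag 0 (V 8)) (write_flag 0 (Cst 0)) & round_end] :: k, s) v.
Proof.
case: s => m0 ps hs tr te nc nd t pr Hk ->.
have top : m0 12%N = (64 + size rs * reclen A)%N := rep_top (part_rep pr).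
have h35 : m0 35%N = _ := part_35 pr; set F := m0 35%N in h35.
have F64 : (64 <= F)%N by rewrite h35 /= top; lia.
pose k0 := c0 + c2 * ((hv == 0%N)%:R - (v0 == 0%N)%:R) * L (Z, P, Q) + B H.
pose b0 := mean Dtest (wt false rs).
have bw b := bm_wt mf kb b rs.
have stage2 s2 i0 : partialRec s2 rs Z P Q hv v0 H ka kl -> mem s2 35 = F ->
    mem s2 (F + 1) = i0 -> (i0 + m <= W)%N ->
    (forall a, (0 < a < 12)%N -> mem s2 a = m0 a) -> mem s2 13 = m0 13%N ->
    J (toss_cost A kb W (size rs) + 30 + N) (blk [:: draw false, evalv, coin (weight false),
       If (V 20) (write_flag 0 (V 8)) (write_flag 0 (Cst 0)) & round_end] :: k, s2)
      (k0 + c1 * (ka%:R * b0 - i0%:R)).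
{ case: s2 => m2 ps2 hs2 tr2 te2 nc2 nd2 t2 pr2 e35 ei0 wi0 e12 e13; rewrite /= in e35 ei0 e12 e13.
  apply: (J_weak (n := 2 + (toss_cost A kb W (size rs) + (3 + (20 + N))))); last 2 first.
  - by lia.
  - exact: lexx.
  jdet; set s3 := Store _ _ _ _ _ _ _ _.
  pose vv i1 := k0 + c1 * (i1%:R - i0%:R).
  have -> : k0 + c1 * (ka%:R * b0 - i0%:R) =
      mean (law false) (fun x => wt false rs x * vv ka + (1 - wt false rs x) * vv 0%N).
    rewrite (eq_mean _ (g := fun x => c1 * ka%:R * wt false rs x + vv 0%N)); last first.
      by move=> x; rewrite /vv; ring.
    rewrite meanD; [|exact: bmZ|exact: bm_cst].
    by rewrite meanZ// mean_cst /vv -/b0; ring.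
  apply: J_draw.
    by apply: bmD; apply: bmM => //; try exact: bm_cst; exact: bmB (bm_cst _) (bw _).
  move=> s4 x fr4 cl4 hx _.
  have {}cl4 := cl4 (rep_clean (part_rep pr2)).
  have fr4' : frame 20 33 (Store m2 ps2 hs2 tr2 te2 nc2 nd2 t2) s4.
    by apply: (frame_trans (s2 := s3)); [frm | exact: (frame_widen _ _ fr4)].
  have rep4 : Rep s4 rs by exact: (Rep_frame fr4' _ _ _ (part_rep pr2)).
  refine (J_toss mf false (s := s4) (l := If (V 20) (write_flag 0 (V 8)) (write_flag 0 (Cst 0)) :: round_end) rep4 hx _ _);
    case=> m5 ps5 hs5 tr5 te5 nc5 nd5 t5 fr5 cl5 e20; rewrite /= in e20.
  all: have {}fr5 := frame_trans fr4' (frame_widen (leqnn 20) (isT : 31 <= 33)%N fr5).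
  all: have g35 : m5 35%N = F by have /= -> := frame_mem fr5 (a := 35%N) isT.
  all: have g8 : m5 8%N = ka by have /= -> := frame_mem fr5 (a := 8%N) isT; exact: (part_8 pr2).
  all: jdet; apply: (J_if_flag g35); rewrite e20 /=; set s6 := Store _ _ _ _ _ _ _ _.
  all: have ext6 : extends (Store m2 ps2 hs2 tr2 te2 nc2 nd2 t2) s6 := extends_frame fr5.
  all: have cl6 : clean s6 := cl5.
  all: have pr6 : partialRec s6 rs Z P Q hv v0 H ka kl by
    apply: (partialRec_ext ext6 cl6 _ pr2) => a /= Ha; rewrite e35 in Ha;
    rewrite upd_neq; [have /= -> := frame_mem fr5 (a := a) _; lia | apply/eqP; lia].
  all: have g6 a : (a < 64)%N -> mem s6 a = m5 a by move=> Ha; rewrite /s6 /= upd_neq//; apply/eqP; lia.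
  all: have h6 : mem s6 35 = F by rewrite g6.
  all: apply: (J_round_end pr6); rewrite ?h6.
  all: try (by rewrite /s6 /= addn0 upd_eq ?g8).
  all: try (by rewrite /s6 /= upd_neq ?ei0; [have /= -> := frame_mem fr5 (a := (F + 1)%N) _; [exact: ei0 | lia] | apply/eqP; lia]).
  all: try (by lia).
  all: move=> s7 rp7 r7 t7; apply: (J_weak (Hk _ _ rp7 _ _)) => //.
  all: try (by move=> a Ha; rewrite r7// g6; [have /= -> := frame_mem fr5 (a := a) _; [exact: e12 | lia] | lia]).
  all: try (by rewrite t7 g6//=; have /= -> := frame_mem fr5 (a := 13%N) isT; rewrite e13).
  all: by rewrite /round_value /vv /k0 /= le_eqVlt; apply/orP; left; apply/eqP; ring. }
apply: (J_weak (n := 2 + (toss_cost A kb W (size rs) + (3 + (toss_cost A kb W (size rs) + 30 + N))))); last 2 first.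
- by lia.
- exact: lexx.
jdet; set s3 := Store _ _ _ _ _ _ _ _.
pose vv (i0 : nat) := k0 + c1 * (ka%:R * b0 - i0%:R).
rewrite (_ : c0 + _ + _ + _ =
    mean (law true) (fun x => wt true rs x * vv kl + (1 - wt true rs x) * vv 0%N)); last first.
  rewrite [RHS](eq_mean _ (g := fun x => - c1 * kl%:R * wt true rs x + vv 0%N)); last first.
    by move=> x; rewrite /vv; ring.
  rewrite meanD; [|exact: bmZ|exact: bm_cst].
  by rewrite meanZ// mean_cst /vv /k0 -/b0; ring.
apply: J_draw.
  by apply: bmD; apply: bmM => //; try exact: bm_cst; exact: bmB (bm_cst _) (bw _).
move=> s4 x fr4 cl4 hx _.
have {}cl4 := cl4 (rep_clean (part_rep pr)).
have fr4' : frame 20 33 (Store m0 ps hs tr te nc nd t) s4.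
  by apply: (frame_trans (s2 := s3)); [frm | exact: (frame_widen _ _ fr4)].
have rep4 : Rep s4 rs by exact: (Rep_frame fr4' _ _ _ (part_rep pr)).
refine (J_toss mf true (s := s4) (l := [:: If (V 20) (write_flag 1 (V 9)) (write_flag 1 (Cst 0)),
    draw false, evalv, coin (weight false),
    If (V 20) (write_flag 0 (V 8)) (write_flag 0 (Cst 0)) & round_end]) rep4 hx _ _);
  case=> m5 ps5 hs5 tr5 te5 nc5 nd5 t5 fr5 cl5 e20; rewrite /= in e20.
all: have {}fr5 := frame_trans fr4' (frame_widen (leqnn 20) (isT : 31 <= 33)%N fr5).
all: have g35 : m5 35%N = F by have /= -> := frame_mem fr5 (a := 35%N) isT.
all: have g9 : m5 9%N = kl by have /= -> := frame_mem fr5 (a := 9%N) isT; exact: (part_9 pr).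
all: jdet; apply: (J_if_flag g35); rewrite e20 /=; set s6 := Store _ _ _ _ _ _ _ _.
all: have g6 a : (a < 64)%N -> mem s6 a = m5 a by move=> Ha; rewrite /s6 /= upd_neq//; apply/eqP; lia.
all: have h6 : mem s6 35 = F by rewrite g6.
all: have ext6 : extends (Store m0 ps hs tr te nc nd t) s6 := extends_frame fr5.
all: have cl6 : clean s6 := cl5.
all: have pr6 : partialRec s6 rs Z P Q hv v0 H ka kl by
  apply: (partialRec_ext ext6 cl6 _ pr) => a /= Ha;
  rewrite upd_neq; [have /= -> := frame_mem fr5 (a := a) _; lia | apply/eqP; lia].
all: apply: (stage2 s6 _ pr6 h6).
all: try (by rewrite /s6 /= upd_eq ?g9).
all: try (by lia).
all: try (by move=> a Ha; rewrite g6; [have /= -> := frame_mem fr5 (a := a) _; lia | lia]).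
all: by rewrite g6//=; have /= -> := frame_mem fr5 (a := 13%N) isT.
Qed.

Lemma tests_all s (Q : m.-tuple X) : mem s 28 = m -> mem s 4 = n -> mem s 1 = m ->
  stored s (mem s 27 + n + n + m + m) Q -> tests s Q.
Proof.
move=> e28 e4 e1 st j x Hj; have [hj _] := onth_tnth Hj.
by rewrite /test_loc e28 hj e4 e1; exact: st.
Qed.

(** The pure training sample is obtained as hybrid 0 by loading its own first point into register
    31. For an empty sample the loaded value is meaningless, but then no test point is pushed. *)
Lemma tests_none s (P : m.-tuple X) : mem s 28 = 0%N -> mem s 4 = n ->
  mem s 31 = mem s (mem s 27 + n + n) ->
  stored s (mem s 27 + n + n) P -> tests s P.
Proof.
move=> e28 e4 e31 st [|j] x Hj; rewrite /test_loc e28 ltn0 /= ?e4; last exact: st.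
by have := st 0%N x Hj; rewrite !addn0 e31.
Qed.

Lemma J_round N k s rs : Rep s rs -> mem s 8 = ka -> mem s 9 = kl ->
  (forall s' r, Rep s' (rcons rs r) ->
    (forall a, (0 < a < 12)%N -> mem s' a = mem s a) -> mem s' 13 = (mem s 13).-1 ->
    J N (k, s') (round_value r)) ->
  J (round_cost (size rs) + N) (round :: k, s) (mean3 rs (round_mean rs)).
Proof.
case: s => m0 ps hs tr te nc nd t rep e8 e9 Hk; rewrite /= in e8 e9.
have top : m0 12%N = (64 + size rs * reclen A)%N := rep_top rep.
pose tl := (2 + (toss_cost A kb W (size rs) + toss_cost A kb W (size rs) + 60 + N))%N.
apply: (J_weak (n := 1 + (record_sample_cost (size rs) + (5 + (hybrid_cost A + (7 +
  (hybrid_cost A + (3 + (record_sample_cost (size rs) + tl)))))))%N)); last 2 first.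
- by rewrite /tl /round_cost; lia.
- exact: lexx.
jdet; set s1 := Store _ _ _ _ _ _ _ _.
have fr1 : frame 20 36 (Store m0 ps hs tr te nc nd t) s1 by frm.
have rep1 : Rep s1 rs by apply: (Rep_frame fr1 _ _ _ rep) => //; exact: rep_clean rep.
apply: (J_sample_record (bm_round_mean rs) rep1).
case=> m2 ps2 hs2 tr2 te2 nc2 nd2 t2 Z P Q wf2 rep2 stZ lbZ stP stQ _; rewrite /= in stZ lbZ stP stQ.
have rd2 a : ((a < 20) || (36 <= a))%N -> (a < m0 12%N)%N -> m2 a = m0 a.
  exact: (wframe_mem wf2).
have e12 : m2 12%N = m0 12%N by apply: rd2 => //; rewrite top.
jdet; jdet; jdet; jdet; jdet; set s3 := Store _ _ _ _ _ _ _ _.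
have fr3 : frame 20 36 (Store m2 ps2 hs2 tr2 te2 nc2 nd2 t2) s3 by frm.
have cl3 : clean s3 := rep_clean rep2.
have rep3 : Rep s3 rs by apply: (Rep_frame fr3 _ _ _ rep2).
have e27 : mem s3 27 = m0 12%N by rewrite /s3 /= upd_neq// upd_eq.
have e28 : mem s3 28 = m by rewrite /s3 /= upd_eq upd_neq//; exact: rep_m rep2.
have tp64 : (36 <= m0 12%N)%N by lia.
have st3 p k' (l : k'.-tuple X) : (36 <= p)%N -> stored (Store m2 ps2 hs2 tr2 te2 nc2 nd2 t2) p l ->
   stored s3 p l by move=> hp; exact: (stored_frame fr3).
have lb3 : labeled f s3 (m0 12%N) Z by exact: (labeled_frame fr3) lbZ.
pose kk := c0 + c1 * (ka%:R * mean Dtest (wt false rs) - kl%:R * mean Dtrain (wt true rs)).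
pose out te r := output (label_with f Z) te r : option (concept X).
pose kap1 (r : seed A) := kk + c2 * ((rejects f Z Q r)%:R - rej f Z P) * mean3 rs L + B (out Q r).
have bo te' := bm_rejects_out Z te' bB.
have br te' := bm_rejects1 mf Z te'.
have b1 : bm kap1.
  apply: bmD (bo Q); apply: bmD (bm_cst _) _; apply: bmM (bm_cst _); apply: bmZ.
  exact: bmB (br Q) (bm_cst _).
(* The value is unfolded in the order in which randomness is consumed: the run on Q, the run on P,
   then the second record. Each stage leaves an affine function of what is still to be drawn. *)
have -> : round_mean rs (Z, P, Q) = mean (seed_law A) kap1.
  rewrite (eq_mean _ (g := fun r => (kk - c2 * rej f Z P * mean3 rs L +
    c2 * mean3 rs L * (rejects f Z Q r)%:R) + B (out Q r))); last first.
    by move=> r; rewrite /kap1; ring.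
  have bz := bmZ (c2 * mean3 rs L) (br Q).
  rewrite meanD; [|exact: bmD (bm_cst _) bz|exact: bo].
  rewrite meanD//; last exact: bm_cst.
  by rewrite meanZ// mean_cst /round_mean -/kk /outB /rej /=; ring.
apply: (J_hybrid (s := s3) (Z := Z) (te := Q) b1 cl3 (rep_n rep3) (rep_m rep3)); rewrite ?e27.
- by lia.
- exact: st3.
- exact: lb3.
- apply: (tests_all e28 (rep_n rep3) (rep_m rep3)).
  by rewrite e27; apply: st3 => //; lia.
case=> m4 ps4 hs4 tr4 te4 nc4 nd4 t4 r fr4 cl4 hd; rewrite /= in hd.
have f27 : m4 27%N = m0 12%N by rewrite -e27; exact: (frame_mem fr4 (a := 27%N) isT).
have {}fr4 := frame_trans fr3 (frame_widen (isT : 20 <= 25)%N (isT : 27 <= 36)%N fr4).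
have rd4 a : ~~ (20 <= a < 36)%N -> m4 a = m2 a by exact: (frame_mem fr4).
have g4 : m4 4%N = n by rewrite rd4//; exact: rep_n rep2.
have g12 : m4 12%N = m0 12%N by rewrite rd4.
jdet; jdet; jdet; jdet; jdet; jdet; jdet; set s5 := Store _ _ _ _ _ _ _ _.
have fr5 : frame 20 37 (Store m2 ps2 hs2 tr2 te2 nc2 nd2 t2) s5.
  by apply: (frame_trans (frame_widen (leqnn 20) (isT : 36 <= 37)%N fr4)); frm.
have cl5 : clean s5 := cl4.
have rep5 : Rep s5 rs by apply: (Rep_frame fr5 _ _ _ rep2).
have h27 : mem s5 27 = m0 12%N by rewrite /s5 /= !upd_neq.
have h28 : mem s5 28 = 0%N by rewrite /s5 /= upd_eq.
have h36 : mem s5 36 = m4 26%N by rewrite /s5 /= upd_neq// upd_neq// upd_eq.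
have t37 : (37 <= m0 12%N)%N by lia.
have h31 : mem s5 31 = mem s5 (mem s5 27 + n + n)%N.
  rewrite h27 /s5 /= upd_neq// upd_eq !(@upd_neq _ 36)// g12 g4; last by apply/eqP; lia.
  by rewrite !upd_neq//; apply/eqP; lia.
pose kap2 (r2 : seed A) := kk + c2 * ((rejects f Z Q r)%:R - (rejects f Z P r2)%:R) *
  mean3 rs L + B (out Q r).
have b2 : bm kap2.
  apply: bmD (bm_cst _); apply: bmD (bm_cst _) _; apply: bmM (bm_cst _); apply: bmZ.
  exact: bmB (bm_cst _) (br P).
have -> : kap1 r = mean (seed_law A) kap2.
  rewrite (eq_mean _ (g := fun r2 => (kk + c2 * (rejects f Z Q r)%:R * mean3 rs L + B (out Q r)) +
    - c2 * mean3 rs L * (rejects f Z P r2)%:R)); last first.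
    by move=> r2; rewrite /kap2; ring.
  have bz := bmZ (- c2 * mean3 rs L) (br P).
  rewrite meanD//; last exact: bm_cst.
  by rewrite meanZ// mean_cst /kap1 /rej; ring.
apply: (J_hybrid (s := s5) (Z := Z) (te := P) b2 cl5 (rep_n rep5) (rep_m rep5)); rewrite ?h27.
- by lia.
- exact: (stored_frame fr5).
- exact: (labeled_frame fr5).
- apply: (tests_none h28 (rep_n rep5) h31); rewrite h27; apply: (stored_frame fr5) => //; lia.
case=> m6 ps6 hs6 tr6 te6 nc6 nd6 t6 r2 fr6 cl6 hd6; rewrite /= in hd6.
have k36 : m6 36%N = m4 26%N by rewrite -h36; exact: (frame_mem fr6 (a := 36%N) isT).
have hd4 : handle (Store m6 ps6 hs6 tr6 te6 nc6 nd6 t6) (m4 26%N) (out Q r).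
  exact: (handle_ext (extends_frame fr6) hd).
have {}fr6 := frame_trans fr5 (frame_widen (isT : 20 <= 25)%N (isT : 27 <= 37)%N fr6).
jdet; jdet; jdet; set s7 := Store _ _ _ _ _ _ _ _.
have fr7 : frame 20 38 (Store m2 ps2 hs2 tr2 te2 nc2 nd2 t2) s7.
  by apply: (frame_trans (frame_widen (leqnn 20) (isT : 37 <= 38)%N fr6)); frm.
have rep7 : Rep s7 rs by apply: (Rep_frame fr7 _ _ _ rep2).
have E7 a : (0 < a < 20)%N -> mem s7 a = m0 a.
  by move=> Ha; rewrite (frame_mem fr7) /= ?rd2//; lia.
pose sg : R := (rejects f Z Q r)%:R - (rejects f Z P r2)%:R.
have -> : kap2 r2 = mean3 rs (fun z => (kk + B (out Q r)) + c2 * sg * L z).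
  by rewrite mean3_affine// /kap2 /sg; ring.
have b3 : bm (fun z => (kk + B (out Q r)) + c2 * sg * L z) by exact: bmD (bm_cst _) (bmZ _ bL).
apply: (J_sample_record b3 rep7) => s8 Z8 P8 Q8 wf8 rep8 stZ8 lbZ8 stP8 stQ8 e35.
have e12' : mem s7 12 = m0 12%N by rewrite E7.
rewrite e12' in stZ8 lbZ8 stP8 stQ8 e35 wf8.
have E8 a : (0 < a < 20)%N -> mem s8 a = m0 a.
  by move=> Ha; rewrite (wframe_mem wf8) ?E7//; lia.
have pr8 : partialRec s8 rs Z8 P8 Q8 (m4 26%N) (m6 26%N) (out Q r) ka kl.
  split; rewrite ?(E8 12%N)//.
  - by rewrite (wframe_mem wf8); [rewrite /s7 /= upd_neq | by [] | lia].
  - by rewrite (wframe_mem wf8); [rewrite /s7 /= upd_eq | by [] | lia].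
  - exact: (handle_ext (wframe_ext wf8) hd4).
  - by rewrite E8.
  - by rewrite E8.
apply: (J_weak (n := (toss_cost A kb W (size rs) + toss_cost A kb W (size rs) + 60 + N)%N)); last 2 first.
- by rewrite /tl; lia.
- exact: lexx.
apply: (J_round_draws pr8).
  move=> s' r' rp' E' t'; apply: Hk => //.
    by move=> a Ha; rewrite E'// E8//; lia.
  by rewrite t' E8.
by rewrite (handle_eq0 hd4) (handle_eq0 hd6) /kk /sg /rejects; ring.
Qed.

End round.
Lemma leq_evalv_cost t t' : (t <= t')%N -> (evalv_cost A t <= evalv_cost A t')%N.
Proof. by move=> tt; rewrite /evalv_cost leq_add2r leq_mul2r tt orbT. Qed.

Lemma leq_toss_cost t t' : (t <= t')%N -> (toss_cost A kb W t <= toss_cost A kb W t')%N.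
Proof.
move=> tt; rewrite /toss_cost leq_add ?leq_evalv_cost// leq_add2r /coin_cost leq_add2r.
by rewrite leq_mul2r leq_mul2r tt !orbT.
Qed.

Lemma leq_round_cost t t' : (t <= t')%N -> (round_cost t <= round_cost t')%N.
Proof.
move=> tt; have h1 := leq_toss_cost tt.
have h2 : (sample_cost t <= sample_cost t')%N.
  by rewrite /sample_cost leq_add2r leq_mul2l /try_cost leq_add2r h1 orbT.
have h3 c : (many_cost c t <= many_cost c t')%N.
  by rewrite /many_cost leq_add2r leq_mul2l leq_add2r h2 orbT.
have h4 : (record_sample_cost t <= record_sample_cost t')%N.
  by have := h3 n; have := h3 m; rewrite /record_sample_cost; lia.
rewrite /round_cost; lia.
Qed.

Definition rok (r : rnd) :=
  [/\ (sgn1 r <= 1)%N, (sgn0 r <= 1)%N, (inc1 r + m <= W)%N & (inc0 r + m <= W)%N].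

Lemma tapeAt_last (s : store X) p rs r : tapeAt f W s p (rcons rs r) -> rok r.
Proof. by elim: rs p => [|r' rs IH] p /= [h]; [move=> _; exact: rec_bounds h | exact: IH]. Qed.

(* [v] bounds the expectation of [F r] over the record [r] of a round from [rs]. *)
Definition round_bound ka kl rs (F : rnd -> R) (v : R) :=
  exists c0 c1 c2 L B, [/\ bm L, bm (fun z : n.-tuple X * m.-tuple X * seed A =>
      B (output (label_with f z.1.1) z.1.2 z.2)),
    forall r, rok r -> F r <= round_value c0 c1 c2 L B r &
    mean3 rs (round_mean ka kl c0 c1 c2 L B rs) <= v].

(** [Phi t] is the bound with [t] rounds to go. The hypothesis on [round_bound] is the
    supermartingale inequality, so the initial value dominates the expected terminal one. *)
Lemma J_rounds N k ka kl Tt (Phi : nat -> seq rnd -> R) t rs s :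
  (ka + m <= W)%N -> (kl + m <= W)%N ->
  (forall t rs, round_bound ka kl rs (fun r => Phi t (rcons rs r)) (Phi t.+1 rs)) ->
  Rep s rs -> mem s 8 = ka -> mem s 9 = kl -> mem s 13 = t -> (size rs + t = Tt)%N ->
  (forall s' rs', Rep s' rs' -> size rs' = Tt ->
    (forall a, (0 < a < 12)%N -> mem s' a = mem s a) -> J N (k, s') (Phi 0%N rs')) ->
  J (t * (round_cost Tt + 1) + 1 + N) (rounds :: k, s) (Phi t rs).
Proof.
move=> wa wl HP; elim: t rs s => [|t IH] rs [m0 ps hs tr te nc nd tm] rep e8 e9 e13 eT H.
  rewrite mul0n add0n; apply: J_while0; first exact: e13.
  apply: H => //; last by lia.
  by apply: (@Rep_frame _ _ _ _ _ _ _ _ 20 21 _ _ _ _ _ _ _ rep) => //; [frm | exact: rep_clean rep].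
apply: (J_weak (n := 1 + (round_cost (size rs) + (t * (round_cost Tt + 1) + 1 + N)))); last 2 first.
- have := @leq_round_cost (size rs) Tt; rewrite mulSn; lia.
- exact: lexx.
apply: J_while1; first by rewrite /= [m0 13%N]e13.
set s1 := Store _ _ _ _ _ _ _ _.
have rep1 : Rep s1 rs.
  by apply: (@Rep_frame _ _ _ _ _ _ _ _ 20 21 _ _ _ _ _ _ _ rep) => //; [frm | exact: rep_clean rep].
have [c0 [c1 [c2 [L [B [bL bB HF Hv]]]]]] := HP t rs.
apply: (J_weak (n := round_cost (size rs) + (t * (round_cost Tt + 1) + 1 + N)) _ _ Hv) => //.
apply: (J_round (s := s1) bL wa wl bB rep1 e8 e9) => s' r rp' E' t'.
apply: (J_weak (n := t * (round_cost Tt + 1) + 1 + N) _ _ (HF r (tapeAt_last (rep_tape rp')))) => //.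
apply: IH => //.
- by rewrite E'.
- by rewrite E'.
- by rewrite t' /= [m0 13%N]e13.
- by rewrite size_rcons; lia.
- by move=> s2 rs2 rp2 sz2 E2; apply: H => // a Ha; rewrite E2// E'.
Qed.

End sample_lemmas.

(** * The potential function of a counter *)

Section potential.
Context {R : realType}.
Variable kb : nat.
Let Q : R := 2 ^+ kb.
Let q : R := 1 - 2^-1 ^+ kb.

(* U(p - q), where U(v + 1) - U(v) is the weight u(v + 1). *)
Definition pot (p r : nat) : R :=
  if (p <= r)%N then Q * q ^+ (r - p) else Q + (p - r)%:R.

(** The scale [Q] makes the differences of the geometric branch exactly powers of q, so that both
    branches of the potential have the weight u as discrete derivative. *)
Let Qq : Q * (1 - q) = 1.
Proof. by rewrite /Q /q opprB subrKC -exprMn divff ?expr1n// pnatr_eq0. Qed.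

Let Q1 : 1 <= Q. Proof. by rewrite exprn_ege1// ler1n. Qed.
Let q0 : 0 <= q.
Proof. by rewrite subr_ge0 exprn_ile1//; lra. Qed.
Let q1 : q <= 1.
Proof. by rewrite /q lerBlDr lerDl exprn_ge0. Qed.

Notation u p r := (bern kb true p r : R).

Lemma bernS_l p r : u p r <= u p.+1 r <= u p r + Q^-1.
Proof.
have Qn0 : Q != 0 by rewrite gt_eqF// (lt_le_trans ltr01).
have iQ : Q^-1 = 1 - q by apply: (mulfI Qn0); rewrite Qq divff.
rewrite /bern -/q; case: (ltnP p r) => pr.
  rewrite (_ : (r - p)%N = (r - p.+1).+1); last by lia.
  rewrite exprS; set w := q ^+ _; have w0 : 0 <= w by exact: exprn_ge0.
  have w1 : w <= 1 by exact: exprn_ile1.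
  rewrite ler_piMl//= iQ; have : 0 <= (1 - q) * (1 - w) by rewrite mulr_ge0 ?subr_ge0.
  lra.
rewrite (_ : (r - p)%N = 0%N); last by lia.
rewrite (_ : (r - p.+1)%N = 0%N); last by lia.
by rewrite lexx lerDl invr_ge0 (le_trans ler01).
Qed.

Lemma potS_l p r : pot p.+1 r = pot p r + u p.+1 r.
Proof.
rewrite /pot /bern -/q; case: (ltngtP p r) => pr.
- rewrite (_ : (r - p)%N = (r - p.+1).+1); last by lia.
  rewrite exprS; set w := q ^+ _; have E : w = Q * (1 - q) * w by rewrite Qq mul1r.
  by rewrite [X in _ = _ + X]E; ring.
- rewrite (_ : (r - p.+1)%N = 0%N); last by lia.
  by rewrite (_ : (p.+1 - r)%N = (p - r).+1) ?expr0 -?natr1 ?addrA//; lia.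
- rewrite pr subnn (_ : (r.+1 - r)%N = 1%N); last by lia.
  by rewrite (_ : (r - r.+1)%N = 0%N) ?expr0 ?mulr1//; lia.
Qed.

Lemma pot_shift p r : pot p.+1 r.+1 = pot p r.
Proof. by rewrite /pot ltnS !subSS. Qed.

Lemma bern_shift b p r : bern kb b p.+1 r.+1 = bern kb b p r :> R.
Proof. by rewrite /bern; case: b; rewrite !subSS. Qed.

Let iQ0 : 0 <= Q^-1. Proof. by rewrite invr_ge0 (le_trans ler01). Qed.

Lemma bern_addl p r i : u p r <= u (p + i) r <= u p r + i%:R * Q^-1.
Proof.
elim: i => [|i IH]; first by rewrite addn0 mul0r addr0 lexx.
rewrite addnS -natr1; have := bernS_l (p + i) r; lra.
Qed.

Lemma pot_addl p r i : pot (p + i) r <= pot p r + i%:R * u p r + i%:R ^+ 2 * Q^-1.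
Proof.
elim: i => [|i IH]; first by rewrite addn0 expr0n /= !mul0r !addr0.
rewrite addnS potS_l; have := bern_addl p r i.+1; rewrite addnS -natr1.
have i0 : 0 <= i%:R :> R by rewrite ler0n.
move: IH; set a := i%:R; set w := Q^-1; have : 0 <= w := iQ0.
rewrite expr2 expr2; nra.
Qed.

Lemma potS_r p r : pot p r.+1 = pot p r - u p r.
Proof. by have := potS_l p r.+1; rewrite pot_shift bern_shift; lra. Qed.

Lemma bernS_r p r : u p r - Q^-1 <= u p r.+1.
Proof. by have := bernS_l p r.+1; rewrite bern_shift; lra. Qed.

Lemma bern_addr p r j : u p r - j%:R * Q^-1 <= u p (r + j).
Proof.
elim: j => [|j IH]; first by rewrite addn0 mul0r subr0.
rewrite addnS -natr1; have := bernS_r p (r + j); lra.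
Qed.

Lemma pot_addr p r j : pot p (r + j) <= pot p r - j%:R * u p r + j%:R ^+ 2 * Q^-1.
Proof.
elim: j => [|j IH]; first by rewrite addn0 expr0n /= !mul0r subr0 !addr0.
rewrite addnS potS_r; have := bern_addr p r j; rewrite -natr1.
have i0 : 0 <= j%:R :> R by rewrite ler0n.
move: IH; set a := j%:R; set w := Q^-1; have : 0 <= w := iQ0.
rewrite expr2 expr2; nra.
Qed.

(** A discrete second-order expansion: the derivative is u, and u changes by at most 1 - q = 1 / Q
    per unit, which gives the quadratic remainders. The mixed term may be dropped because u is
    nondecreasing in [p]. *)
Lemma pot_add p r i j : pot (p + i) (r + j) <=
  pot p r + (i%:R - j%:R) * u p r + (i%:R ^+ 2 + j%:R ^+ 2) * Q^-1.
Proof.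
have h1 := pot_addr (p + i) r j; have h2 := pot_addl p r i.
have /andP[h3 _] := bern_addl p r i.
have : 0 <= j%:R * (u (p + i) r - u p r) by rewrite mulr_ge0 ?ler0n// subr_ge0.
lra.
Qed.

Lemma pot_ge0 p r : 0 <= pot p r.
Proof.
rewrite /pot; have Q0 : 0 <= Q := le_trans ler01 Q1.
by case: ifP => _; [rewrite mulr_ge0 ?exprn_ge0 | rewrite addr_ge0].
Qed.

Lemma bern_swap p r : bern kb false p r = bern kb true r p :> R.
Proof. by []. Qed.

(* Where the coin of g may fail, the coin of u cannot. *)
Lemma bern_sum p r : 1 - bern kb false p r <= bern kb true p r :> R.
Proof.
rewrite /bern -/q; case: (leqP p r) => pr.
  by rewrite (_ : (p - r)%N = 0%N) ?expr0 ?subrr ?exprn_ge0//; lia.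
rewrite (_ : (r - p)%N = 0%N) ?expr0; last by lia.
by rewrite lerBlDr lerDl exprn_ge0.
Qed.

Lemma pot00 : pot 0 0 = Q.
Proof. by rewrite /pot leqnn subnn expr0 mulr1. Qed.

End potential.

(** From exp(-x) >= 1 - x one gets exp(x) <= 1 / (1 - x), and the fraction is bounded by the
    polynomial on this interval. *)
Lemma expR_le1DxDx2 (R : realType) (x : R) : `|x| <= 2^-1 -> expR x <= 1 + x + 2 * x ^+ 2.
Proof.
move=> hx; have [h1 h2] : - 2^-1 <= x /\ x <= 2^-1 by move: hx; rewrite ler_norml => /andP[].
have : 1 - x <= expR (- x) by have := expR_ge1Dx (- x).
rewrite expRN => H; have e0 := expR_gt0 x.
have p : 0 < 1 - x by lra.
have : expR x <= (1 - x)^-1.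
  by rewrite -[expR x]invrK lef_pV2 ?posrE// invr_gt0.
move=> /le_trans; apply; rewrite -[leLHS]mul1r ler_pdivrMr// expr2; nra.
Qed.

Local Opaque mean sampler iid.

(** * The change of the energy in one round *)

Section analysis.
Context {R : realType} {d : measure_display} {X : measurableType d}.
Variables (A : learner R X) (f : concept X).
Variables (Dtrain Dtest : probability X R).
Hypothesis mf : measurable_fun setT f.
Variables (kb r0 W lam : nat).

Notation wt := (wt f kb).
Notation rnd := (rnd A).
Notation law := (law Dtrain Dtest).
Notation Qlaw := (Qlaw (A := A) Dtrain Dtest mf kb r0).
Notation mean3 := (mean3 Dtrain Dtest mf kb r0).
Notation rok := (rok (A := A) W).
Let n := ntrain A.
Let m := ntest A.

Lemma EV_rcons (rs : seq rnd) r x K p q : EV f (rcons rs r) x K p q =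
  EV f rs x (fun p q => incrE (rprobs f r x 0 m) (sgn1 r) (sgn0 r)
    (fun p q => K (p + inc1 r)%N (q + inc0 r)%N) p q) p q.
Proof.
elim: rs p q => [//|r' rs IH] p q /=; apply: eq_incrE => p' q'; exact: IH.
Qed.

Lemma incrE_lin ps s1 s0 (K1 K2 : nat -> nat -> R) (t e : R) p q :
  incrE ps s1 s0 (fun p q => K1 p q + t * K2 p q + e) p q =
  incrE ps s1 s0 K1 p q + t * incrE ps s1 s0 K2 p q + e.
Proof. by elim: ps p q => [//|c ps IH] p q /=; rewrite !IH; ring. Qed.

Lemma EV_lin (rs : seq rnd) x (K1 K2 : nat -> nat -> R) (t e : R) p q :
  EV f rs x (fun p q => K1 p q + t * K2 p q + e) p q =
  EV f rs x K1 p q + t * EV f rs x K2 p q + e.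
Proof.
elim: rs p q => [//|r rs IH] p q /=; rewrite -incrE_lin.
by apply: eq_incrE => p' q'; rewrite IH.
Qed.

(** A bound affine in the number c of rejections passes to the expectation, where c is replaced by
    the sum of the rejection probabilities. *)
Lemma incrE_ub ps s1 s0 (K : nat -> nat -> R) (al k : R) p q :
  (forall a, a \in ps -> 0 <= a <= 1) ->
  (forall c, (c <= size ps)%N -> K (p + c * s1)%N (q + c * s0)%N <= al + c%:R * k) ->
  incrE ps s1 s0 K p q <= al + (\sum_(a <- ps) a) * k.
Proof.
elim: ps al p q => [|a ps IH] al p q h01 H /=.
  by have := H 0%N isT; rewrite big_nil !mul0n !addn0 !mul0r.
have /andP[a0 a1] : 0 <= a <= 1 by apply: h01; rewrite mem_head.
have h01' b : b \in ps -> 0 <= b <= 1 by move=> bps; apply: h01; rewrite in_cons bps orbT.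
have i1 : incrE ps s1 s0 K (p + s1) (q + s0) <= (al + k) + (\sum_(a <- ps) a) * k.
  apply: IH => // c cs; have := H c.+1 cs; rewrite !mulSn !addnA -natr1 => /le_trans; apply; lra.
have i0 : incrE ps s1 s0 K p q <= al + (\sum_(a <- ps) a) * k.
  by apply: IH => // c cs; apply: H; exact: leqW.
rewrite big_cons; have := ler_wpM2l a0 i1; have b0 : 0 <= 1 - a by lra.
have := ler_wpM2l b0 i0; lra.
Qed.

Definition psum (r : rnd) x := \sum_(a <- rprobs f r x 0 m) a.

Definition drift (r : rnd) x : R :=
  (inc1 r)%:R - (inc0 r)%:R + ((sgn1 r)%:R - (sgn0 r)%:R) * psum r x.

Let iQ : R := (2 ^+ kb)^-1.
Let iQ0 : 0 <= iQ. Proof. by rewrite invr_ge0 exprn_ge0. Qed.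

Let err : R := 2 * W%:R ^+ 2 * iQ.

Let sqW (a b : nat) : (a <= W)%N -> (b <= W)%N ->
  (a%:R ^+ 2 + b%:R ^+ 2) * iQ <= err.
Proof.
move=> aW bW; apply: ler_wpM2r => //.
have : (a%:R : R) <= W%:R by rewrite ler_nat.
have : (b%:R : R) <= W%:R by rewrite ler_nat.
have : 0 <= a%:R :> R by []. have : 0 <= b%:R :> R by [].
rewrite !expr2; nra.
Qed.

(** Fresh oracle randomness makes the rejections of the new round independent of the counter reached
    before it, so the mean drift and the mean weight simply multiply. *)
Lemma EV_pot_rcons rs r x : rok r ->
  EV f (rcons rs r) x (pot kb) 0 0 <=
  EV f rs x (pot kb) 0 0 + drift r x * wt true rs x + err.
Proof.
move=> [s1 s0 w1 w0]; rewrite EV_rcons -EV_lin; apply: (le_EV mf) => p q.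
rewrite -[leRHS](_ : (pot kb p q + ((inc1 r)%:R - (inc0 r)%:R) * bern kb true p q + err) +
  psum r x * (((sgn1 r)%:R - (sgn0 r)%:R) * bern kb true p q) = _); last by rewrite /drift; ring.
apply: incrE_ub => [a|c]; first exact: rprobs01.
rewrite size_map size_iota => cm; rewrite -addnA -addnA.
apply: (le_trans (pot_add _ _ _ _ _)).
have := @sqW (c * sgn1 r + inc1 r) (c * sgn0 r + inc0 r); rewrite -/iQ => /(_ _ _)/le_trans h.
have hh : (((c * sgn1 r + inc1 r)%:R ^+ 2 + (c * sgn0 r + inc0 r)%:R ^+ 2) * iQ <= err).
  by apply: sqW; nia.
rewrite !natrD !natrM in hh *; lra.
Qed.

Lemma EV_potS_rcons rs r x : rok r ->
  EV f (rcons rs r) x (fun p q => pot kb q p) 0 0 <=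
  EV f rs x (fun p q => pot kb q p) 0 0 - drift r x * wt false rs x + err.
Proof.
move=> [s1 s0 w1 w0]; rewrite EV_rcons -mulNr -EV_lin; apply: (le_EV mf) => p q.
rewrite -[leRHS](_ : (pot kb q p - ((inc1 r)%:R - (inc0 r)%:R) * bern kb false p q + err) +
  psum r x * (- ((sgn1 r)%:R - (sgn0 r)%:R) * bern kb false p q) = _); last by rewrite /drift; ring.
apply: incrE_ub => [a|c]; first exact: rprobs01.
rewrite size_map size_iota => cm; rewrite -addnA -addnA bern_swap.
apply: (le_trans (pot_add _ _ _ _ _)).
have hh : (((c * sgn0 r + inc0 r)%:R ^+ 2 + (c * sgn1 r + inc1 r)%:R ^+ 2) * iQ <= err).
  by apply: sqW; nia.
rewrite !natrD !natrM in hh *; rewrite -/iQ; lra.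
Qed.

Definition energy (rs : seq rnd) : R :=
  lam%:R * mean Dtrain (fun x => EV f rs x (pot kb) 0 0) +
  mean Dtest (fun x => EV f rs x (fun p q => pot kb q p) 0 0).

(* The test function of a record, integrated against lam * u * Dtrain - g * Dtest. *)
Definition gap (rs : seq rnd) (z : n.-tuple X * m.-tuple X * m.-tuple X) : R :=
  \sum_(i <- iota 0 m)
   (lam%:R * mean Dtrain (fun x => wt true rs x * rej f z.1.1 (hyb i z.1.2 z.2 x)) -
    mean Dtest (fun x => wt false rs x * rej f z.1.1 (hyb i z.1.2 z.2 x))).

Lemma psumE r x : psum r x = \sum_(i <- iota 0 m) rprob f r x i.
Proof. by rewrite /psum /rprobs big_map. Qed.

Lemma bm_psum r : bm (psum r).
Proof.
rewrite (_ : psum r = (fun x => \sum_(i <- iota 0 m) rprob f r x i)); last first.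
  by apply/funext => x; exact: psumE.
by apply: bm_sum => i; exact: bm_hyb.
Qed.

Lemma bm_drift r : bm (drift r).
Proof. by apply: bmD (bm_cst _) (bmZ _ (bm_psum r)). Qed.

Lemma mean_drift (P : probability X R) b (rs : seq rnd) r :
  mean P (fun x => drift r x * wt b rs x) =
  ((inc1 r)%:R - (inc0 r)%:R) * mean P (wt b rs) + ((sgn1 r)%:R - (sgn0 r)%:R) *
  \sum_(i <- iota 0 m) mean P (fun x => wt b rs x * rprob f r x i).
Proof.
have bw := bm_wt mf kb b rs.
have bi i : bm (fun x => wt b rs x * rprob f r x i) by apply: bmM => //; exact: bm_hyb.
rewrite -mean_sum// -meanZ// -meanZ//; last exact: bm_sum.
rewrite -meanD; [|exact: bmZ|by apply: bmZ; exact: bm_sum].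
apply: eq_mean => x; rewrite /drift psumE mulrDl; congr (_ + _).
by rewrite -mulrA; congr (_ * _); rewrite mulrC mulr_sumr.
Qed.

Lemma energy_rcons rs r : rok r -> energy (rcons rs r) <= energy rs +
  (((inc1 r)%:R - (inc0 r)%:R) *
    (lam%:R * mean Dtrain (wt true rs) - mean Dtest (wt false rs)) +
   ((sgn1 r)%:R - (sgn0 r)%:R) * gap rs (rZ r, rP r, rQ r) + (lam%:R + 1) * err).
Proof.
move=> rr; rewrite /energy.
have b1 b := bm_wt mf kb b rs; have b2 := bm_drift r.
have bE K rs' : bm (fun x => EV f rs' x K 0 0) by exact: bm_EV.
have h1 : mean Dtrain (fun x => EV f (rcons rs r) x (pot kb) 0 0) <=
    mean Dtrain (fun x => EV f rs x (pot kb) 0 0) +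
    mean Dtrain (fun x => drift r x * wt true rs x) + err.
  have bdw : bm (fun x => drift r x * wt true rs x) by exact: bmM.
  rewrite -[err in leRHS](mean_cst Dtrain) -meanD// -meanD//.
  - by apply: le_mean => //; [apply: bmD (bm_cst _); exact: bmD | move=> x; exact: EV_pot_rcons].
  - exact: bmD.
  - exact: bm_cst.
have h2 : mean Dtest (fun x => EV f (rcons rs r) x (fun p q => pot kb q p) 0 0) <=
    mean Dtest (fun x => EV f rs x (fun p q => pot kb q p) 0 0) -
    mean Dtest (fun x => drift r x * wt false rs x) + err.
  have bdw : bm (fun x => drift r x * wt false rs x) by exact: bmM.
  rewrite -[err in leRHS](mean_cst Dtest) -meanB// -meanD//.
  - by apply: le_mean => //; [apply: bmD (bm_cst _); exact: bmB | move=> x; exact: EV_potS_rcons].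
  - exact: bmB.
  - exact: bm_cst.
have l0 : 0 <= lam%:R :> R by [].
have := ler_wpM2l l0 h1; rewrite !mean_drift in h2 *.
have -> : gap rs (rZ r, rP r, rQ r) =
    lam%:R * (\sum_(i <- iota 0 m) mean Dtrain (fun x => wt true rs x * rprob f r x i)) -
    \sum_(i <- iota 0 m) mean Dtest (fun x => wt false rs x * rprob f r x i).
  by rewrite /gap sumrB mulr_sumr.
by move: h2; set S1 := \sum_(i <- _) _; set S2 := \sum_(i <- _) _; lra.
Qed.

Notation trip := (n.-tuple X * m.-tuple X * m.-tuple X)%type.

Lemma bm_rej_splice i : bm (fun z : trip => rej f z.1.1 (splice i z.1.2 z.2)).
Proof.
apply: (bm_comp (g := fun z : trip => (z.1.1, splice i z.1.2 z.2))) (bm_rej A mf).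
apply: measurable_fun_pair.
  by apply: (measurableT_comp measurable_fst); exact: measurable_fst.
exact: (measurableT_comp (@measurable_splice _ _ _ A i)
  (measurable_fun_pair (measurableT_comp measurable_snd measurable_fst) measurable_snd)).
Qed.

Lemma bm_rej_hyb i : bm (fun z : trip * X => rej f z.1.1.1 (hyb i z.1.1.2 z.1.2 z.2)).
Proof.
pose g (z : trip * X) : trip := (z.1.1.1, tset i z.2 z.1.1.2, z.1.2).
have m11 : measurable_fun setT (fun z : trip * X => z.1.1).
  by apply: (measurableT_comp measurable_fst); exact: measurable_fst.
apply: (bm_comp (g := g)) (bm_rej_splice i).
apply: measurable_fun_pair; last first.
  by apply: (measurableT_comp measurable_snd); exact: measurable_fst.
apply: measurable_fun_pair; first exact: (measurableT_comp measurable_fst m11).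
exact: (measurableT_comp (@measurable_tset _ X m i)
  (measurable_fun_pair measurable_snd (measurableT_comp measurable_snd m11))).
Qed.

Lemma bm_mean_hyb (P : probability X R) (g : X -> R) i : bm g ->
  bm (fun z : trip => mean P (fun x => g x * rej f z.1.1 (hyb i z.1.2 z.2 x))).
Proof.
move=> bg; apply: (bm_mean P (f := fun w : trip * X => g w.2 * rej f w.1.1.1 (hyb i w.1.1.2 w.1.2 w.2))).
apply: bmM; last exact: bm_rej_hyb.
exact: (bm_comp measurable_snd bg).
Qed.

Lemma bm_gap (rs : seq rnd) : bm (gap rs).
Proof.
apply: bm_sum => i; apply: bmB; last exact: bm_mean_hyb (bm_wt mf kb _ rs).
by apply: bmZ; exact: bm_mean_hyb (bm_wt mf kb _ rs).
Qed.

Definition hrej (rs : seq rnd) i := mean3 rs (fun z => rej f z.1.1 (splice i z.1.2 z.2)).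

Definition massu (rs : seq rnd) : R := lam%:R * mean Dtrain (wt true rs).
Definition massg (rs : seq rnd) : R := mean Dtest (wt false rs).

(** The function [gap] with each reweighted integral replaced by a mass times a mean under the law
    the program really samples; [sampler_approx] bounds the difference. The factor [1 *] makes
    [bm_mean_hyb] applicable. *)
Definition gap' (rs : seq rnd) (z : trip) : R := \sum_(i <- iota 0 m)
   (massu rs * mean (Qlaw true rs) (fun x => 1 * rej f z.1.1 (hyb i z.1.2 z.2 x)) -
    massg rs * mean (Qlaw false rs) (fun x => 1 * rej f z.1.1 (hyb i z.1.2 z.2 x))).

Lemma bm_gap' (rs : seq rnd) : bm (gap' rs).
Proof.
apply: bm_sum => i; apply: bmB; apply: bmZ; exact: bm_mean_hyb (bm_cst _).
Qed.

Lemma gap_approx (rs : seq rnd) z : `|gap rs z - gap' rs z| <= m%:R * ((lam%:R + 1) / (r0.+1)%:R).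
Proof.
rewrite /gap /gap' -sumrB; apply: (le_trans (ler_norm_sum _ _ _)).
rewrite (_ : m%:R * _ = \sum_(i <- iota 0 m) ((lam%:R + 1) / (r0.+1)%:R)); last first.
  by rewrite big_const_seq count_predT size_iota iter_addr_0 mulr_natl.
apply: ler_sum => i _.
have bh := bm_hyb mf i z.1.2 z.2 z.1.1.
have h01 x := rej01 mf z.1.1 (hyb i z.1.2 z.2 x).
have h1 := sampler_approx Dtrain (bm_wt mf kb true rs) (wt01 mf kb true rs) bh h01 r0.
have h2 := sampler_approx Dtest (bm_wt mf kb false rs) (wt01 mf kb false rs) bh h01 r0.
have e1 b : mean (Qlaw b rs) (fun x => 1 * rej f z.1.1 (hyb i z.1.2 z.2 x)) =
  mean (Qlaw b rs) (fun x => rej f z.1.1 (hyb i z.1.2 z.2 x)).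
  by apply: eq_mean => x; rewrite mul1r.
rewrite !e1 /massu /massg; move: h1 h2; rewrite -/(Qlaw true rs) -/(Qlaw false rs).
set M1 := mean (Qlaw true rs) _; set M2 := mean (Qlaw false rs) _.
set N1 := mean Dtrain _; set N2 := mean Dtest _; set a := mean Dtrain _; set b := mean Dtest _.
have l0 : 0 <= lam%:R :> R by [].
set e := (r0.+1)%:R^-1; rewrite !ler_norml => /andP[h1 h1'] /andP[h2 h2'].
have := ler_wpM2l l0 h1; have := ler_wpM2l l0 h1'.
by move=> g1 g2; apply/andP; split; lra.
Qed.

Lemma mean3_resample_u (rs : seq rnd) i : (i < m)%N ->
  mean3 rs (fun z => mean (Qlaw true rs) (fun x => 1 * rej f z.1.1 (hyb i z.1.2 z.2 x))) =
  hrej rs i.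
Proof.
move=> im; apply: eq_mean => Z.
have bs : bm (fun z : m.-tuple X * m.-tuple X => rej f Z (splice i z.1 z.2)).
  apply: (bm_comp (g := fun z : m.-tuple X * m.-tuple X => (Z, splice i z.1 z.2))) (bm_rej A mf).
  by apply: measurable_fun_pair => //; exact: measurable_splice.
rewrite -(mean_iid_resample (Qlaw true rs) im (bm_mean (iid (Qlaw false rs) m) bs)).
apply: eq_mean => P /=.
have bh : bm (fun z : m.-tuple X * X => rej f Z (hyb i P z.1 z.2)).
  apply: (bm_comp (g := fun z : m.-tuple X * X => ((Z, P, z.1), z.2))) (bm_rej_hyb i).
  by apply: measurable_fun_pair => //; apply: measurable_fun_pair.
rewrite -(mean_swap (iid (Qlaw false rs) m) (Qlaw true rs) bh).
by apply: eq_mean => Q; apply: eq_mean => x; rewrite mul1r.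
Qed.

Lemma mean3_resample_g (rs : seq rnd) i : (i < m)%N ->
  mean3 rs (fun z => mean (Qlaw false rs) (fun x => 1 * rej f z.1.1 (hyb i z.1.2 z.2 x))) =
  hrej rs i.+1.
Proof.
move=> im; apply: eq_mean => Z; apply: eq_mean => P.
have bs : bm (fun Q : m.-tuple X => rej f Z (splice i.+1 P Q)).
  exact: (bm_pair1 (bm_rej_splice i.+1) (Z, P)).
rewrite -(mean_iid_resample (Qlaw false rs) im bs).
by apply: eq_mean => Q; apply: eq_mean => x; rewrite mul1r hybS.
Qed.

Lemma eq_mean3 (rs : seq rnd) (g h : trip -> R) : g =1 h -> mean3 rs g = mean3 rs h.
Proof. by move=> /funext ->. Qed.

Lemma mean3D (rs : seq rnd) (g h : trip -> R) : bm g -> bm h ->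
  mean3 rs (fun z => g z + h z) = mean3 rs g + mean3 rs h.
Proof.
move=> bg bh; have g2 := bm_mean (iid (Qlaw false rs) m) bg.
have h2 := bm_mean (iid (Qlaw false rs) m) bh.
have g3 := bm_mean (iid (Qlaw true rs) m) g2; have h3 := bm_mean (iid (Qlaw true rs) m) h2.
rewrite /mean3 -meanD//; apply: eq_mean => Z.
rewrite -meanD; [|exact: (bm_pair1 g2 Z)|exact: (bm_pair1 h2 Z)].
by apply: eq_mean => P; rewrite -meanD//; [exact: (bm_pair1 bg (Z, P))|exact: (bm_pair1 bh (Z, P))].
Qed.

Lemma mean3Z (rs : seq rnd) (c : R) (g : trip -> R) : bm g ->
  mean3 rs (fun z => c * g z) = c * mean3 rs g.
Proof.
move=> bg; have g2 := bm_mean (iid (Qlaw false rs) m) bg.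
have g3 := bm_mean (iid (Qlaw true rs) m) g2.
rewrite /mean3 -meanZ//; apply: eq_mean => Z.
rewrite -meanZ; last exact: (bm_pair1 g2 Z).
by apply: eq_mean => P; rewrite -meanZ//; exact: (bm_pair1 bg (Z, P)).
Qed.

Lemma mean3_cst (rs : seq rnd) (c : R) : mean3 rs (fun=> c) = c.
Proof. by rewrite /mean3 !mean_cst. Qed.

Lemma mean3_sum (rs : seq rnd) (I : eqType) (s : seq I) (F : I -> trip -> R) :
  (forall i, bm (F i)) -> mean3 rs (fun z => \sum_(i <- s) F i z) = \sum_(i <- s) mean3 rs (F i).
Proof.
move=> bF; elim: s => [|i s IH].
  by rewrite big_nil -[RHS](mean3_cst rs); apply: eq_mean3 => z; rewrite big_nil.
rewrite big_cons -IH (eq_mean3 _ (h := fun z => F i z + \sum_(j <- s) F j z)).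
  by rewrite mean3D//; exact: bm_sum.
by move=> z; rewrite big_cons.
Qed.

Lemma le_mean3 (rs : seq rnd) (g h : trip -> R) : bm g -> bm h -> (forall z, g z <= h z) ->
  mean3 rs g <= mean3 rs h.
Proof.
move=> bg bh gh; have g2 := bm_mean (iid (Qlaw false rs) m) bg.
have h2 := bm_mean (iid (Qlaw false rs) m) bh.
have g3 := bm_mean (iid (Qlaw true rs) m) g2; have h3 := bm_mean (iid (Qlaw true rs) m) h2.
apply: le_mean => // Z; apply: le_mean => [||P]; [exact: (bm_pair1 g2 Z)|exact: (bm_pair1 h2 Z)|].
by apply: le_mean => [||Q //]; [exact: (bm_pair1 bg (Z, P))|exact: (bm_pair1 bh (Z, P))].
Qed.

(** Writing a s_i - b s_(i+1) as (a - b) s_i + b (s_i - s_(i+1)) separates the imbalance of the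
    masses from a telescoping sum, of which only the pure training and pure test samples survive. *)
Lemma telescope_hyb (a b : R) (s : nat -> R) k :
  \sum_(i <- iota 0 k) (a * s i - b * s i.+1) =
  (a - b) * (\sum_(i <- iota 0 k) s i) + b * (s 0%N - s k).
Proof.
elim: k => [|k IH]; first by rewrite !big_nil subrr !mulr0 addr0.
rewrite -addn1 iotaD !big_cat /= !big_seq1 add0n IH addn1; ring.
Qed.

Lemma mean3_gap' (rs : seq rnd) : mean3 rs (gap' rs) =
  (massu rs - massg rs) * (\sum_(i <- iota 0 m) hrej rs i) +
  massg rs * (hrej rs 0%N - hrej rs m).
Proof.
have b1 i b := bm_mean_hyb (Qlaw b rs) i (bm_cst 1).
rewrite /gap' mean3_sum; last by move=> i; apply: bmB; apply: bmZ; exact: b1.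
rewrite -telescope_hyb; apply: eq_big_seq => i; rewrite mem_iota => /andP[_ im].
rewrite (_ : mean3 rs _ = mean3 rs (fun z => massu rs * mean (Qlaw true rs)
    (fun x => 1 * rej f z.1.1 (hyb i z.1.2 z.2 x)) + - massg rs * mean (Qlaw false rs)
    (fun x => 1 * rej f z.1.1 (hyb i z.1.2 z.2 x)))); last first.
  by apply: eq_mean3 => z; rewrite mulNr.
rewrite mean3D; [|by apply: bmZ; exact: b1|by apply: bmZ; exact: b1].
rewrite mean3Z; last exact: b1.
rewrite mean3Z; last exact: b1.
by rewrite mean3_resample_u// mean3_resample_g// mulNr.
Qed.

Lemma hrej01 (rs : seq rnd) i : 0 <= hrej rs i <= 1.
Proof.
have b := bm_rej_splice i; have h (z : trip) := rej01 mf z.1.1 (splice i z.1.2 z.2).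
apply/andP; split.
  rewrite -(mean3_cst rs 0); apply: le_mean3 => //; first exact: bm_cst.
  by move=> z; case/andP: (h z).
rewrite -[leRHS](mean3_cst rs 1); apply: le_mean3 => //; first exact: bm_cst.
by move=> z; case/andP: (h z).
Qed.

Lemma mean3_near (rs : seq rnd) (g h : trip -> R) (e : R) : bm g -> bm h ->
  (forall z, `|g z - h z| <= e) ->
  mean3 rs g <= mean3 rs h + e /\ mean3 rs h - e <= mean3 rs g.
Proof.
move=> bg bh gh; split.
  have <- : mean3 rs (fun z => h z + e) = mean3 rs h + e.
    by rewrite mean3D ?mean3_cst//; exact: bm_cst.
  apply: le_mean3 => //; first exact: bmD (bm_cst _).
  by move=> z; have := gh z; rewrite ler_norml => /andP[_]; rewrite lerBlDl.
have <- : mean3 rs (fun z => h z + - e) = mean3 rs h - e.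
  by rewrite mean3D ?mean3_cst//; exact: bm_cst.
apply: le_mean3 => //; first exact: bmD (bm_cst _).
by move=> z; have := gh z; rewrite ler_norml => /andP[+ _]; rewrite lerBrDl.
Qed.

(** Multiplying by x - y turns the telescoped term g (y - x) into minus a square, while |x - y| <= 1
    keeps the error and the imbalance from growing. *)
Lemma gap_arith (M u g S x y e mm : R) : 0 <= S <= mm -> 0 <= x <= 1 -> 0 <= y <= 1 ->
  M <= (u - g) * S + g * (y - x) + e -> (u - g) * S + g * (y - x) - e <= M ->
  (x - y) * M <= mm * `|u - g| + e - g * (x - y) ^+ 2.
Proof.
move=> /andP[S0 S1] /andP[x0 x1] /andP[y0 y1] h1 h2.
have sg1 : `|x - y| <= 1 by rewrite ler_norml; lra.
have e0 : 0 <= e by lra.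
have hd : `|(x - y) * (M - ((u - g) * S + g * (y - x)))| <= e.
  by rewrite normrM -[leRHS]mul1r ler_pM// ler_norml; lra.
have hd2 : (x - y) * ((u - g) * S) <= mm * `|u - g|.
  apply: (le_trans (ler_norm _)); rewrite normrM normrM -[leRHS]mul1r ler_pM//.
  by rewrite mulrC ler_wpM2r// ger0_norm.
move: hd; rewrite ler_norml => /andP[_]; rewrite expr2; lra.
Qed.

Lemma sum_hrej (rs : seq rnd) : 0 <= \sum_(i <- iota 0 m) hrej rs i <= m%:R.
Proof.
move: (hrej rs) (hrej01 rs) => h h01; apply/andP; split.
  by apply: sumr_ge0 => i _; case/andP: (h01 i).
apply: (@le_trans _ _ (\sum_(i <- iota 0 m) (1 : R))).
  by apply: ler_sum => i _; case/andP: (h01 i).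
by rewrite big_const_seq count_predT size_iota iter_addr_0.
Qed.

Lemma gap_upper (rs : seq rnd) : (hrej rs m - hrej rs 0%N) * mean3 rs (gap rs) <=
  m%:R * `|massu rs - massg rs| + m%:R * ((lam%:R + 1) / (r0.+1)%:R) -
  massg rs * (hrej rs m - hrej rs 0%N) ^+ 2.
Proof.
have [h1 h2] := mean3_near rs (bm_gap rs) (bm_gap' rs) (gap_approx rs).
rewrite mean3_gap' in h1 h2.
exact: (gap_arith (sum_hrej rs) (hrej01 rs m) (hrej01 rs 0%N) h1 h2).
Qed.

Lemma energy0 : energy [::] = (lam%:R + 1) * 2 ^+ kb.
Proof. by rewrite /energy /= !mean_cst pot00 mulrDl mul1r. Qed.

Lemma energy_ge0 (rs : seq rnd) : 0 <= energy rs.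
Proof.
have h K x : (forall p q, 0 <= K p q) -> 0 <= EV f rs x K 0 0.
  by move=> K0; rewrite -(EV_cst f rs x 0 0 0); exact: (le_EV mf).
apply: addr_ge0; first apply: mulr_ge0 => //.
  by apply: mean_ge0 => x; apply: h => p q; exact: pot_ge0.
by apply: mean_ge0 => x; apply: h => p q; exact: pot_ge0.
Qed.

(** The link between the selector g and the training law: it suffices to keep the training mass of u
    small, which is what the balance achieves. *)
Lemma reject_le_mass (rs : seq rnd) : mean Dtrain (fun x => 1 - wt false rs x) <= mean Dtrain (wt true rs).
Proof.
have bw b := bm_wt mf kb b rs.
apply: le_mean => //; first exact: bmB (bm_cst _) (bw _).
move=> x; rewrite /wt (_ : 1 - _ = EV f rs x (fun p q => 1 + -1 * bern kb false p q + 0) 0 0).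
  by apply: (le_EV mf) => p q; rewrite addr0 mulN1r; exact: bern_sum.
by rewrite EV_lin EV_cst; ring.
Qed.

End analysis.

(** * Completeness and soundness of the oracle as bounds on expectations *)

Section tds.
Context {R : realType} {d : measure_display} {X : measurableType d}.
Variables (A : learner R X) (f : concept X).
Hypothesis mf : measurable_fun setT f.
Let n := ntrain A.
Let m := ntest A.
Notation sample := (n.-tuple X * m.-tuple X * seed A)%type.

Definition concept_of (o : option (concept X)) : concept X :=
  fun x => if o is Some h then h x else false.

Definition outz (z : sample) := output (label_with f z.1.1) z.1.2 z.2.

Lemma measurable_wrong :
  measurable [set w : sample * X | f w.2 != concept_of (outz w.1) w.2].
Proof.
pose g (w : sample * X) := (label_with f w.1.1.1, w.1.1.2, w.1.2, w.2).
have m1 : measurable_fun setT (fun w : sample * X => w.1.1).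
  by apply: (measurableT_comp measurable_fst); exact: measurable_fst.
have mg : measurable_fun setT g.
  apply: measurable_fun_pair; last exact: measurable_snd.
  apply: measurable_fun_pair; last exact: (measurableT_comp measurable_snd measurable_fst).
  apply: measurable_fun_pair; last exact: (measurableT_comp measurable_snd m1).
  apply: (measurableT_comp (f := fun S : n.-tuple X => label_with f S)).
    exact: (measurable_label mf).
  by apply: (measurableT_comp measurable_fst); exact: m1.
have mH : measurable [set w : sample * X | concept_of (outz w.1) w.2].
  have := mg measurableT _ (@measurable_hypothesis _ _ _ A); rewrite setTI; congr (measurable _).
  by apply/seteqP; split => w; rewrite /preimage /= /concept_of /outz /g /=; case: (output _ _ _).
have mF : measurable [set w : sample * X | f w.2].
  have := (measurableT_comp mf (@measurable_snd _ _ sample X)) measurableT [set true] I.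
  by rewrite setTI; congr measurable.
rewrite (_ : mkset _ = ([set w : sample * X | f w.2] `&` ~` [set w | concept_of (outz w.1) w.2]) `|`
   (~` [set w | f w.2] `&` [set w | concept_of (outz w.1) w.2])).
  apply: measurableU; apply: measurableI => //; exact: measurableC.
apply/seteqP; split => w /=; case: (f w.2); case: (concept_of _ _) => //=.
- by move=> _; left; split.
- by move=> _; right; split.
- by case=> [[]|[]].
- by case=> [[]|[]].
Qed.

Lemma measurable_wrong1 z : measurable [set x | f x != concept_of (outz z) x].
Proof.
have := measurable_xsection z measurable_wrong; congr measurable.
by apply/seteqP; split => x /=; rewrite /xsection /= inE.
Qed.

Lemma bm_wrong : bm (fun w : sample * X => (f w.2 != concept_of (outz w.1) w.2)%:R : R).
Proof. exact: bm_indic measurable_wrong. Qed.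

Variable eps : R.

Definition unsound (D2 : probability X R) (o : option (concept X)) : bool :=
  if o is Some h then ~~ (D2 [set x | f x != h x] <= eps%:E)%E else false.

Definition rejz (z : sample) := rejects f z.1.1 z.1.2 z.2.

Lemma bool_set_lt (g : sample -> R) (c : R) : measurable_fun setT g ->
  measurable [set z | c < g z].
Proof.
move=> mg; have := measurable_fun_ltr (measurable_cst c) mg measurableT (Y := [set true]) I.
by rewrite setTI; congr measurable.
Qed.

Lemma measurable_rejz : measurable [set z | rejz z].
Proof.
have [mr _] := bm_rejects A mf.
have := bool_set_lt 2^-1 mr; congr measurable.
apply/seteqP; split => z /=; rewrite /rejz; case: (rejects _ _ _ _) => //=; by lra.
Qed.

Lemma measurable_unsound D2 : measurable [set z | unsound D2 (outz z)].
Proof.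
have [me _] := bm_mean D2 bm_wrong.
rewrite (_ : mkset _ = ~` [set z | rejz z] `&` [set z | eps < mean D2 (fun x =>
   (f x != concept_of (outz z) x)%:R)]).
  by apply: measurableI; [exact: measurableC measurable_rejz | exact: (bool_set_lt eps me)].
apply/seteqP; split => z /=; have := mean_indic D2 (measurable_wrong1 z).
  rewrite /rejz /rejects /unsound -/(outz z); case: (outz z) => [h|//] <-.
  by rewrite lee_fin -ltNge => ->.
rewrite /rejz /rejects /unsound -/(outz z); case: (outz z) => [h|] E [] //=.
by move=> _; rewrite -E lee_fin -ltNge.
Qed.

Lemma mean_negb (P : probability sample R) (b : sample -> bool) :
  measurable [set z | b z] ->
  (mean P (fun z => (b z)%:R))%:E = (1 - P [set z | ~~ b z])%E.
Proof.
move=> mb; rewrite mean_indic// (_ : [set z | ~~ b z] = ~` [set z | b z]); last first.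
  by apply/seteqP; split => z /= /negP.
rewrite probability_setC//; move: (fin_num_measure P _ mb).
by case: (P _) => // r _; rewrite -!EFinB; congr EFin; ring.
Qed.

Variable C : set (concept X).
Hypotheses (tds : TDS_learner C A eps (1 / 100)) (Cf : C f).

(** Any measurable event that forces the guarantee of the oracle to fail has probability at most
    1/100; completeness and soundness are the two instances used. *)
Lemma tds_event (D1 D2 : probability X R) (b : sample -> bool) : measurable [set z | b z] ->
  (forall z, b z -> unsound D2 (outz z) \/
    ((forall U, measurable U -> D1 U = D2 U) /\ rejz z)) ->
  mean (iid D1 n) (fun Z => mean (iid D2 m) (fun te => mean (seed_law A)
    (fun r => (b (Z, te, r))%:R))) <= 1 / 100.
Proof.
move=> mb bE; have bb := bm_indic (R := R) mb.
have b2 := bm_mean (seed_law A) bb.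
pose P : probability sample R := (iid D1 n \x iid D2 m \x seed_law A)%E.
have -> : mean (iid D1 n) (fun Z => mean (iid D2 m) (fun te => mean (seed_law A)
    (fun r => (b (Z, te, r))%:R))) = mean P (fun z => (b z)%:R).
  by rewrite mean_prod// mean_prod.
rewrite -lee_fin mean_negb//.
have := tds D1 D2 Cf; set E := mkset _ => HE.
have mE : measurable E.
  have mU : measurable [set z | ~~ unsound D2 (outz z)].
    have := measurableC (measurable_unsound D2); congr measurable.
    by apply/seteqP; split => z /= /negP.
  (* Whether the laws agree does not depend on the sample, so the guarantee event is measurable in
     both cases: soundness together with acceptance if they agree, soundness alone otherwise. *)
  case: (pselect (forall U, measurable U -> D1 U = D2 U)) => [eqD|neD].
    rewrite (_ : E = [set z | ~~ unsound D2 (outz z)] `&` ~` [set z | rejz z]).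
      by apply: measurableI => //; exact: measurableC measurable_rejz.
    apply/seteqP; split => z /=; rewrite /E /= /unsound /rejz /rejects -/(outz z);
      case: (outz z) => [h|] /=.
    - by move=> [+ _] => /(_ h erefl) ->.
    - by move=> [_ /(_ eqD)].
    - by move=> [/negPn hh _]; split => // h' [<-].
    - by case.
  rewrite (_ : E = [set z | ~~ unsound D2 (outz z)])//.
  apply/seteqP; split => z /=; rewrite /E /= /unsound -/(outz z); case: (outz z) => [h|] //=.
  - by move=> [+ _] => /(_ h erefl) ->.
  - by move=> /negPn hh; split => // h' [<-].
have EB : E `<=` [set z | ~~ b z].
  move=> z; rewrite /E /= => -[h1 h2]; apply/negP => /bE [].
    by rewrite /unsound; move: h1; rewrite -/(outz z); case: (outz z) => [h /(_ h erefl) ->|].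
  by move=> [eqD]; rewrite /rejz /rejects; move: (h2 eqD); rewrite -/(outz z); case: (outz z).
have mnb : measurable [set z | ~~ b z].
  have := measurableC mb; congr measurable.
  by apply/seteqP; split => z /= /negP.
have PE : (P E <= P [set z | ~~ b z])%E by apply: le_measure; rewrite ?inE.
have {}PE := le_trans HE PE.
have [r Er] : exists r, P [set z | ~~ b z] = r%:E.
  by exists (fine (P [set z | ~~ b z])); rewrite fineK//; exact: fin_num_measure.
by rewrite Er in PE *; move: PE; rewrite -EFinB !lee_fin; lra.
Qed.

Lemma tds_complete (D : probability X R) :
  mean (iid D n) (fun Z => mean (iid D m) (fun te => rej f Z te)) <= 1 / 100.
Proof.
apply: (tds_event (D1 := D) (D2 := D) measurable_rejz) => z rz; by right; split.
Qed.

Lemma tds_sound (D1 D2 : probability X R) :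
  mean (iid D1 n) (fun Z => mean (iid D2 m) (fun te => mean (seed_law A)
    (fun r => (unsound D2 (outz (Z, te, r)))%:R))) <= 1 / 100.
Proof.
by apply: (tds_event (D1 := D1) (measurable_unsound D2)) => z uz; left.
Qed.

Lemma bm_unsound D2 : bm (fun z : sample => (unsound D2 (outz z))%:R : R).
Proof. exact: bm_indic (measurable_unsound D2). Qed.

End tds.

(** Linearizes one factor of the exponential process; 51/50 bounds exp(x) for |x| <= 1/100. *)
Lemma bool_expR_le (R : realType) (b : bool) (mu x tau : R) : 0 <= mu -> `|x| <= 1 / 100 ->
  2 * x ^+ 2 <= tau ->
  (1 + mu) ^+ b * expR x <= 1 + x + tau + mu * (51 / 50) * b%:R.
Proof.
move=> mu0 x1 xt; have E : expR x <= 1 + x + 2 * x ^+ 2.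
  by apply: expR_le1DxDx2; apply: (le_trans x1); lra.
case: b => /=; rewrite ?expr0 ?expr1 ?mulr1 ?mulr0 ?mul1r ?addr0; last by lra.
have [h1 h2] : - (1 / 100) <= x /\ x <= 1 / 100 by move: x1; rewrite ler_norml => /andP[].
have x2 : x ^+ 2 <= 1 / 10000 by rewrite expr2; nra.
have : mu * expR x <= mu * (51 / 50) by apply: ler_wpM2l => //; lra.
lra.
Qed.

Lemma bool_natr_le (R : realType) (a b c : bool) : (a -> b || c) -> a%:R <= b%:R + c%:R :> R.
Proof. by case: a; case: b; case: c => //= h; rewrite ?addr0 ?add0r ?lerDl ?addr_ge0//; have := h isT. Qed.

(** If D > 1, the balancing term -ka D^2 pays for a bad round. If s >= 9/100 and g > eps, then g s^2
    >= (81/10000) eps, slightly more than gam = eps / 125. Otherwise a bad round has probability at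
    most 11/100, and 1/8 leaves room for the factor 51/50 and the small errors. *)
Lemma drift_le (R : realType) (z gam eps D m ka g s t E eta EB : R) :
  0 < z -> 0 < eps < 1 -> gam = eps / 125 ->
  0 <= m -> m + 1 <= ka -> m ^+ 2 <= ka * gam / 250 ->
  t <= z * (gam / 1000) -> E + eta <= gam / 1000 -> 0 <= g -> EB <= 1 ->
  (1 < D \/ (eps < g /\ 9 / 100 <= s) \/ EB <= 11 / 100) -> 0 <= D ->
  t + z * (E - ka * D ^+ 2 + m * D + eta - g * s ^+ 2) + z * gam * (51 / 50) * EB <= z * gam / 8.
Proof.
move=> z0 /andP[e0 e1] hg m0 mka m2 ht hE g0 EB1 cs D0.
have gam0 : 0 < gam by rewrite hg; lra.
(* Completing the square: the left side is at most m^2 / (4 ka). *)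
have hq : m * D - ka * D ^+ 2 <= gam / 1000.
  have k0 : 0 < ka by lra.
  have h : 0 <= (2 * ka * D - m) ^+ 2 by exact: sqr_ge0.
  have h' : 4 * ka * (m * D - ka * D ^+ 2) <= 4 * ka * (gam / 1000).
    by move: h m2; rewrite !expr2; lra.
  by move: h'; rewrite ler_pM2l// mulr_gt0.
have gs0 : 0 <= g * s ^+ 2 by rewrite mulr_ge0// sqr_ge0.
suff H : E - ka * D ^+ 2 + m * D + eta - g * s ^+ 2 + gam * (51 / 50) * EB
    <= gam / 8 - gam / 1000.
  by have := ler_wpM2l (ltW z0) H; lra.
have gEB : gam * (51 / 50) * EB <= gam * (51 / 50) by rewrite ler_piMr// mulr_ge0//; lra.
case: cs => [D1|[[geps s9]|EB2]].
- have : (ka - m) * D <= (ka * D - m) * D by rewrite ler_wpM2r//; nra.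
  have : 1 <= (ka - m) * D by nra.
  rewrite expr2; lra.
- have s2 : (9 / 100) * (9 / 100) <= s ^+ 2 by rewrite expr2 ler_pM//; lra.
  have s3 : eps * ((9 / 100) * (9 / 100)) <= g * s ^+ 2 by apply: ler_pM; [lra|lra|lra|exact: s2].
  lra.
- have : gam * (51 / 50) * EB <= gam * (51 / 50) * (11 / 100) by rewrite ler_wpM2l// mulr_ge0//; lra.
  lra.
Qed.

Lemma incr_arith (R : realType) (i1 i0 s1 s0 W m : nat) (D g l E : R) :
  (s1 <= 1)%N -> (s0 <= 1)%N -> (i1 + m <= W)%N -> (i0 + m <= W)%N -> 0 <= l -> 0 <= E ->
  `|D| <= l -> `|g| <= m%:R * l ->
  `|(i1%:R - i0%:R) * D + (s1%:R - s0%:R) * g + E| <= 2 * W%:R * l + E.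
Proof.
move=> h1 h2 h3 h4 l0 E0 hD hg.
have nb (a b c : nat) : (a <= c)%N -> (b <= c)%N -> `|a%:R - b%:R| <= c%:R :> R.
  move=> ac bc; have ac' : a%:R <= c%:R :> R by rewrite ler_nat.
  have bc' : b%:R <= c%:R :> R by rewrite ler_nat.
  have a0 : 0 <= a%:R :> R by []. have b0 : 0 <= b%:R :> R by [].
  by rewrite ler_norml; lra.
have mW : m%:R <= W%:R :> R by rewrite ler_nat; lia.
have g1 : `|(i1%:R - i0%:R) * D| <= W%:R * l by rewrite normrM ler_pM// nb//; lia.
have g2 : `|(s1%:R - s0%:R) * g| <= 1 * (W%:R * l).
  rewrite normrM ler_pM//; first exact: (nb _ _ 1%N).
  by apply: (le_trans hg); exact: ler_wpM2r.
apply: (le_trans (ler_normD _ _)); rewrite (ger0_norm E0) lerD2r.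
by apply: (le_trans (ler_normD _ _)); lra.
Qed.

Lemma potential_step (R : realType) (Cn rho mu z en en' inc zc : R) (t nb : nat) (b : bool) :
  0 <= Cn -> 0 <= rho -> 0 <= mu -> 0 <= z -> en' <= en + inc -> `|z * inc| <= zc ->
  zc <= 1 / 100 ->
  Cn * rho ^+ t * (1 + mu) ^+ (nb + b) * expR (z * en') <=
  Cn * rho ^+ t * (1 + mu) ^+ nb * expR (z * en) *
    (1 + z * inc + 2 * zc ^+ 2 + mu * (51 / 50) * b%:R).
Proof.
move=> Cn0 rho0 mu0 z0 hen hzc zc1.
set q := Cn * rho ^+ t * (1 + mu) ^+ nb.
have q0 : 0 <= q by rewrite /q !mulr_ge0// exprn_ge0// addr_ge0.
rewrite exprD mulrA -/q -[leRHS]mulrA -[leLHS]mulrA; apply: ler_wpM2l => //.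
have hb := @bool_expR_le _ b mu (z * inc) (2 * zc ^+ 2) mu0 (le_trans hzc zc1).
apply: le_trans (ler_wpM2l (expR_ge0 (z * en)) (hb _)); last first.
  by rewrite ler_pM2l// -(real_normK (num_real (z * inc))) ler_sqr ?nnegrE//; exact: le_trans hzc.
rewrite mulrCA; apply: ler_wpM2l; first by rewrite exprn_ge0// addr_ge0.
by rewrite -expRD ler_expR -mulrDr ler_wpM2l.
Qed.

Lemma round_value_arith (R : realType) (K tau z E D g b mu i s : R) :
  K * (1 + tau + z * E) + K * z * D * i + K * z * s * g + K * mu * (51 / 50) * b =
  K * (1 + z * (i * D + s * g + E) + tau + mu * (51 / 50) * b).
Proof. ring. Qed.

Lemma round_mean_arith (R : realType) (K tau z E u g b mu k x y M : R) :
  K * (1 + tau + z * E) + K * z * (u - g) * (k * g - k * u) +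
    (K * z * M * x + (- (K * z * M) * y + K * mu * (51 / 50) * b)) =
  K * (1 + (tau + z * E - z * k * (u - g) ^+ 2 + z * ((x - y) * M) + mu * (51 / 50) * b)).
Proof. ring. Qed.

Lemma round_mean_le (R : realType) (K tau z E D g b mu k s M m eta gam : R) :
  0 <= K -> 0 <= z -> mu = z * gam ->
  s * M <= m * `|D| + eta - g * s ^+ 2 ->
  tau + z * (E - k * `|D| ^+ 2 + m * `|D| + eta - g * s ^+ 2) + z * gam * (51 / 50) * b <= z * gam / 8 ->
  K * (1 + (tau + z * E - z * k * D ^+ 2 + z * (s * M) + mu * (51 / 50) * b)) <= K * (1 + mu / 8).
Proof.
move=> K0 z0 -> hg hd; apply: ler_wpM2l => //; rewrite lerD2l; apply: le_trans hd.
have := ler_wpM2l z0 hg; rewrite (real_normK (num_real D)); move: (`|D|) => D'; lra.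
Qed.

(** * Bad rounds and the exponential supermartingale *)

Section supermartingale.
Context {R : realType} {d : measure_display} {X : measurableType d}.
Variables (C : set (concept X)) (A : learner R X) (f : concept X) (eps : R).
Variables (Dtrain Dtest : probability X R).
Hypothesis mf : measurable_fun setT f.
Hypotheses (tds : TDS_learner C A eps (1 / 100)) (Cf : C f).
Variables (kb r0 W lam ka : nat).
Let n := ntrain A.
Let m := ntest A.

Notation wt := (wt f kb).
Notation rnd := (rnd A).
Notation Qlaw := (Qlaw (A := A) Dtrain Dtest mf kb r0).
Notation mean3 := (mean3 Dtrain Dtest mf kb r0).
Notation hrej := (hrej Dtrain Dtest mf kb r0).
Notation massu := (massu f Dtrain kb lam).
Notation massg := (massg f Dtest kb).
Notation gap := (gap f Dtrain Dtest kb lam).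
Notation energy := (energy f Dtrain Dtest kb lam).
Notation sample := (n.-tuple X * m.-tuple X * seed A)%type.
Notation trip := (n.-tuple X * m.-tuple X * m.-tuple X)%type.

Definition test_err (rs : seq rnd) (o : option (concept X)) : R :=
  mean Dtest (fun x => wt false rs x * (f x != concept_of o x)%:R).
Definition train_rej (rs : seq rnd) : R := mean Dtrain (fun x => 1 - wt false rs x).

(** A rejecting round is judged by the constant hypothesis that [concept_of] assigns to it, so it
    may be good, as it is when the masses are balanced and the test mass of g is at most eps.
    Measurability is part of the definition so that the error is a genuine integral. *)
Definition good_out (rs : seq rnd) (o : option (concept X)) : Prop :=
  [/\ measurable [set x | f x != concept_of o x], test_err rs o <= 2 * eps &
      train_rej rs <= 2 * eps].

Definition bad_out rs o : bool := ~~ `[< good_out rs o >].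

Fixpoint nbad (pre rs : seq rnd) : nat :=
  if rs is r :: rs' then (bad_out pre (rH r) + nbad (rcons pre r) rs')%N else 0%N.

Lemma nbad_rcons pre rs r : nbad pre (rcons rs r) = (nbad pre rs + bad_out (pre ++ rs) (rH r))%N.
Proof.
elim: rs pre => [|r' rs IH] pre /=; first by rewrite cats0 addn0.
by rewrite IH cat_rcons addnA.
Qed.

Lemma bm_bad_out rs : bm (fun z : sample => (bad_out rs (outz f z))%:R : R).
Proof.
have bw : bm (fun w : sample * X => wt false rs w.2 * (f w.2 != concept_of (outz f w.1) w.2)%:R).
  apply: bmM; last exact: bm_wrong.
  exact: (bm_comp measurable_snd (bm_wt mf kb false rs)).
have [mt _] := bm_mean Dtest bw.
apply: bm_indic; case: (leP (train_rej rs) (2 * eps)) => hr.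
  have := bool_set_lt (2 * eps) mt; congr measurable.
  apply/seteqP; split => z /=; rewrite /bad_out -/(test_err rs (outz f z)).
    by move=> h; apply/negP => /asboolP[_]; rewrite leNgt h.
  move=> /asboolP h; rewrite ltNge; apply/negP => h2; apply: h; split => //.
  exact: measurable_wrong1.
rewrite (_ : mkset _ = setT)//; apply/seteqP; split => z //= _.
by apply/negP => /asboolP[_ _]; rewrite leNgt hr.
Qed.

Definition bad_prob (rs : seq rnd) : R := mean3 rs (fun z : trip =>
  mean (seed_law A) (fun r => (bad_out rs (outz f (z.1.1, z.2, r)))%:R)).

Lemma mean3_13 (rs : seq rnd) (F : n.-tuple X -> m.-tuple X -> R) :
  mean3 rs (fun z => F z.1.1 z.2) =
  mean (iid (Qlaw true rs) n) (fun Z => mean (iid (Qlaw false rs) m) (F Z)).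
Proof. by apply: eq_mean => Z; exact: (mean_cst _ (mean (iid (Qlaw false rs) m) (F Z))). Qed.

Lemma mean3_12 (rs : seq rnd) (F : n.-tuple X -> m.-tuple X -> R) :
  mean3 rs (fun z => F z.1.1 z.1.2) =
  mean (iid (Qlaw true rs) n) (fun Z => mean (iid (Qlaw true rs) m) (F Z)).
Proof.
by apply: eq_mean => Z; apply: eq_mean => P; exact: (mean_cst _ (F Z P)).
Qed.

Lemma hrej_all (rs : seq rnd) : hrej rs m = mean3 rs (fun z => rej f z.1.1 z.2).
Proof. by apply: eq_mean3 => z; rewrite splice_all. Qed.

Lemma hrej_none (rs : seq rnd) : hrej rs 0%N = mean3 rs (fun z => rej f z.1.1 z.1.2).
Proof. by apply: eq_mean3 => z; rewrite splice0. Qed.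

Lemma hrej0_le (rs : seq rnd) : hrej rs 0%N <= 1 / 100.
Proof. rewrite hrej_none mean3_12; exact: (tds_complete mf tds Cf (Qlaw true rs)). Qed.

Let bm_seed (F : sample -> R) : bm F ->
  bm (fun z : trip => mean (seed_law A) (fun r => F (z.1.1, z.2, r))).
Proof.
move=> bF.
apply: (bm_comp (g := fun z : trip => (z.1.1, z.2))) (bm_mean (seed_law A) bF).
exact: measurable_proj13.
Qed.

Let bm_seed1 (F : sample -> R) z : bm F -> bm (fun r => F (z, r)).
Proof. by move=> bF; exact: (bm_pair1 bF z). Qed.

Lemma bad_prob_le1 (rs : seq rnd) : bad_prob rs <= 1.
Proof.
rewrite /bad_prob -[leRHS](mean3_cst Dtrain Dtest mf kb r0 rs 1).
apply: le_mean3; [exact: (bm_seed (bm_bad_out rs)) | exact: bm_cst | move=> z].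
apply: mean_le1; first exact: (bm_seed1 _ (bm_bad_out rs)).
by move=> r; case: bad_out.
Qed.

Hypothesis eps01 : 0 < eps < 1.
Hypothesis lam_eps : 1 <= lam%:R * eps.
Hypothesis r0_eps : (r0.+1)%:R^-1 <= eps.

Let massg01 (rs : seq rnd) : 0 <= massg rs <= 1.
Proof.
have h x := wt01 mf kb false rs x.
rewrite /massg mean_ge0 ?mean_le1//; [exact: bm_wt|by move=> x; case/andP: (h x)|by move=> x; case/andP: (h x)].
Qed.

Let massu_bd (rs : seq rnd) : 0 <= massu rs <= lam%:R.
Proof.
have h x := wt01 mf kb true rs x.
rewrite /massu mulr_ge0 ?ler_piMr ?mean_ge0 ?mean_le1//; [exact: bm_wt|by move=> x; case/andP: (h x)|by move=> x; case/andP: (h x)].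
Qed.

(** Balance gives lam E_train u <= E_test g + 1 <= 2, and lam >= 1 / eps. *)
Lemma train_rej_le (rs : seq rnd) : `|massu rs - massg rs| <= 1 -> train_rej rs <= 2 * eps.
Proof.
move=> h; apply: (le_trans (reject_le_mass Dtrain mf kb rs)).
move: h (massg01 rs); rewrite /massu; move: (mean Dtrain _) (massg rs) => u g.
rewrite ler_norml => /andP[_ h] /andP[g0 g1].
case/andP: eps01 => e0 _.
have hu : lam%:R * u <= 2 by lra.
have l0 : (0 : R) <= lam%:R by [].
case: (lerP u 0) => u0; first by lra.
have := ler_wpM2l (ltW u0) lam_eps; rewrite mulr1 => h1; apply: (le_trans h1).
rewrite mulrCA mulrA mulrC [leRHS]mulrC; apply: ler_wpM2l; first lra.
exact: hu.
Qed.

Lemma bad_prob_small (rs : seq rnd) : `|massu rs - massg rs| <= 1 -> massg rs <= eps ->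
  bad_prob rs <= 0.
Proof.
move=> h1 h2; rewrite /bad_prob -[leRHS](mean3_cst Dtrain Dtest mf kb r0 rs 0).
apply: le_mean3; [exact: (bm_seed (bm_bad_out rs)) | exact: bm_cst | move=> z].
rewrite -[leRHS](mean_cst (seed_law A)).
apply: le_mean; [exact: (bm_seed1 _ (bm_bad_out rs)) | exact: bm_cst | move=> r].
rewrite (_ : bad_out _ _ = false)//; apply/negbTE/negPn/asboolP; split.
- exact: measurable_wrong1.
- apply: (@le_trans _ _ (massg rs)); last by case/andP: eps01 => ? _; lra.
  have bw := bm_indic (R := R) (measurable_wrong1 mf (z.1.1, z.2, r)).
  have bt := bm_wt mf kb false rs.
  apply: le_mean => // [|x]; first exact: bmM.
  by have /andP[? ?] := wt01 mf kb false rs x; rewrite ler_piMr//; case: (_ != _).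
- exact: train_rej_le.
Qed.

(** Soundness is applied to the law that the sampler produces. Returning to the weighted test law
    adds the sampler error 1 / (r0 + 1) <= eps, whence the 2 eps of [good_out]. *)
Lemma bad_out_le (rs : seq rnd) (z : sample) : `|massu rs - massg rs| <= 1 ->
  (bad_out rs (outz f z))%:R <= (rejz f z)%:R + (unsound f eps (Qlaw false rs) (outz f z))%:R :> R.
Proof.
move=> h1.
refine (@bool_natr_le R (bad_out rs (outz f z)) (rejz f z) (unsound f eps (Qlaw false rs) (outz f z)) _).
rewrite /bad_out => nb.
apply/negPn/negP; rewrite negb_or => /andP[rz uz].
move/negP: nb; apply; apply/asboolP.
have mw := measurable_wrong1 mf z; have bw := bm_indic (R := R) mw.
split => //; last exact: train_rej_le.
have bt := bm_wt mf kb false rs.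
have w01 (x : X) : 0 <= ((f x != concept_of (outz f z) x)%:R : R) <= 1.
  by case: (_ != _); rewrite ?ler01 ?lexx.
have := sampler_approx Dtest (bm_wt mf kb false rs) (wt01 mf kb false rs) bw w01 r0.
rewrite -/(test_err rs (outz f z)) -/(massg rs) ler_norml => /andP[h2 _].
have hq : mean (Qlaw false rs) (fun x => (f x != concept_of (outz f z) x)%:R) <= eps.
  rewrite -lee_fin mean_indic//; move: rz uz; rewrite /rejz /rejects -/(outz f z) /unsound.
  by case: (outz f z) => // h _ /negPn.
move: h2 hq (massg01 rs) r0_eps; rewrite /Qlaw /law.
move: (mean (sampler _ _ _) _) (massg rs) (test_err _ _) (_^-1) => q g t i h2 hq /andP[g0 g1] hi.
case/andP: eps01 => e0 _; have : g * q <= 1 * eps.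
  case: (lerP 0 q) => q0; first exact: ler_pM.
  by have := mulr_ge0_le0 g0 (ltW q0); lra.
lra.
Qed.

Lemma bad_prob_sound (rs : seq rnd) : `|massu rs - massg rs| <= 1 ->
  bad_prob rs <= hrej rs m + 1 / 100.
Proof.
move=> h1; rewrite hrej_all.
have br : bm (fun z : sample => (rejz f z)%:R : R) := bm_rejects A mf.
have bu := bm_unsound A mf eps (Qlaw false rs).
apply: (@le_trans _ _ (mean3 rs (fun z : trip => rej f z.1.1 z.2 + mean (seed_law A)
  (fun r => (unsound f eps (Qlaw false rs) (outz f (z.1.1, z.2, r)))%:R)))).
  apply: le_mean3; [exact: (bm_seed (bm_bad_out rs)) | | move=> z].
    by apply: bmD; [exact: bm_rej13 | exact: (bm_seed bu)].
  rewrite -meanD; [|exact: (bm_seed1 (z.1.1, z.2) br)|exact: (bm_seed1 _ bu)].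
  apply: le_mean; [exact: (bm_seed1 _ (bm_bad_out rs)) | |move=> r; exact: bad_out_le].
  by apply: bmD; [exact: (bm_seed1 (z.1.1, z.2) br)|exact: (bm_seed1 _ bu)].
rewrite mean3D; [|exact: bm_rej13|exact: (bm_seed bu)].
rewrite lerD2l (mean3_13 rs (fun Z Q => mean (seed_law A)
  (fun r => (unsound f eps (Qlaw false rs) (outz f (Z, Q, r)))%:R))).
exact: (tds_sound mf tds Cf).
Qed.

(** Completeness keeps [hrej rs 0] below 1/100. Splitting on whether [hrej rs m] exceeds 1/10 gives
    a sign of mean at least 9/100, or a bad round with probability at most 1/10 + 1/100. *)
Lemma bad_prob_cases (rs : seq rnd) : 1 < `|massu rs - massg rs| \/
  (eps < massg rs /\ 9 / 100 <= hrej rs m - hrej rs 0%N) \/ bad_prob rs <= 11 / 100.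
Proof.
case: (ltP 1 `|massu rs - massg rs|) => h1; [by left|right].
case: (ltP eps (massg rs)) => h2; last first.
  by right; apply: le_trans (bad_prob_small h1 h2) _; lra.
have h3 := bad_prob_sound h1; have h0 := hrej0_le rs.
move: (bad_prob rs) (hrej rs m) (hrej rs 0%N) h3 h0 => b x y h3 h0.
by case: (ltP (1 / 10) x) => h4; [left; split => //; lra | right; lra].
Qed.

Lemma gap_bound (rs : seq rnd) z : `|gap rs z| <= m%:R * (lam%:R + 1).
Proof.
rewrite /gap; apply: (le_trans (ler_norm_sum _ _ _)).
apply: (@le_trans _ _ (\sum_(i <- iota 0 m) (lam%:R + 1 : R))).
  apply: ler_sum => i _; apply: (le_trans (ler_normB _ _)).
  have h b (P : probability X R) : `|mean P (fun x => wt b rs x * rej f z.1.1 (hyb i z.1.2 z.2 x))| <= 1.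
    have h01 x : 0 <= wt b rs x * rej f z.1.1 (hyb i z.1.2 z.2 x) <= 1.
      have /andP[a0 a1] := wt01 mf kb b rs x; have /andP[b0 b1] := rej01 mf z.1.1 (hyb i z.1.2 z.2 x).
      by rewrite mulr_ge0//= mulr_ile1.
    rewrite ger0_norm; last by apply: mean_ge0 => x; case/andP: (h01 x).
    apply: mean_le1; last by move=> x; case/andP: (h01 x).
    by apply: bmM; [exact: bm_wt | exact: bm_hyb].
  move: (h true Dtrain) (h false Dtest); move: (mean Dtrain _) (mean Dtest _) => a b ha hb.
  by apply: lerD => //; rewrite normrM normr_nat -[leRHS]mulr1 ler_wpM2l.
by rewrite big_const_seq count_predT size_iota iter_addr_0 mulr_natl.
Qed.

Variable zeta : R.
Let gam : R := eps / 125.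
Let err : R := 2 * W%:R ^+ 2 / 2 ^+ kb.
Let C1 : R := 2 * W%:R * (lam%:R + 1) + (lam%:R + 1) * err.
Hypothesis zeta0 : 0 < zeta.
Hypothesis zC1 : zeta * C1 <= 1 / 100.
Hypothesis zC2 : 2 * zeta * C1 ^+ 2 <= gam / 1000.
Hypothesis hE : (lam%:R + 1) * err + m%:R * ((lam%:R + 1) / (r0.+1)%:R) <= gam / 1000.
Hypothesis mka : (m + 1 <= ka)%N.
Hypothesis m2ka : m%:R ^+ 2 <= ka%:R * gam / 250.

Let mu : R := zeta * gam.
Let rho : R := 1 + mu / 8.

(** With [t] rounds to go: every bad round multiplies by 1 + mu, every remaining round may still
    gain rho = 1 + mu / 8, and the energy term compensates the rounds in which a bad outcome is
    likely. [Cn] normalizes the terminal threshold to 1. *)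
Definition Phi (Cn : R) (t : nat) (rs : seq rnd) : R :=
  Cn * rho ^+ t * (1 + mu) ^+ nbad [::] rs * expR (zeta * energy rs).

Let mu0 : 0 < mu.
Proof. by rewrite mulr_gt0//; case/andP: eps01 => ? _; rewrite divr_gt0. Qed.

Let err0 : 0 <= err.
Proof. by rewrite /err !mulr_ge0// ?sqr_ge0// invr_ge0 exprn_ge0. Qed.

Let incr (rs : seq rnd) (r : rnd) : R := ((inc1 r)%:R - (inc0 r)%:R) * (massu rs - massg rs) +
   ((sgn1 r)%:R - (sgn0 r)%:R) * gap rs (rZ r, rP r, rQ r) + (lam%:R + 1) * err.

Lemma incr_bound rs r : rok W r -> `|incr rs r| <= C1.
Proof.
move=> [s1 s0 w1 w0]; apply: (incr_arith s1 s0 w1 w0); last exact: gap_bound.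
- by rewrite addr_ge0.
- by rewrite mulr_ge0// addr_ge0.
- have := massu_bd rs; have := massg01 rs.
  by move: (massu rs) (massg rs) => u g /andP[? ?] /andP[? ?]; rewrite ler_norml; lra.
Qed.

Lemma mean3_comb (rs : seq rnd) (c a b e : R) (g1 g2 g3 : trip -> R) : bm g1 -> bm g2 -> bm g3 ->
  mean3 rs (fun z => c + (a * g1 z + (b * g2 z + e * g3 z))) =
  c + (a * mean3 rs g1 + (b * mean3 rs g2 + e * mean3 rs g3)).
Proof.
move=> b1 b2 b3; have z1 := bmZ a b1; have z2 := bmZ b b2; have z3 := bmZ e b3.
have z23 := bmD z2 z3.
rewrite (mean3D _ _ _ _ _ _ (bm_cst c) (bmD z1 z23)) mean3_cst.
rewrite (mean3D _ _ _ _ _ _ z1 z23) (mean3D _ _ _ _ _ _ z2 z3).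
by rewrite !mean3Z.
Qed.

Lemma mean3_round_mean rs (c0 c1 c2 K : R) :
  mean3 rs (round_mean Dtrain Dtest mf kb r0 ka (ka * lam) c0 c1 c2 (gap rs)
     (fun o => K * (bad_out rs o)%:R) rs) =
  c0 + c1 * (ka%:R * massg rs - ka%:R * massu rs) +
  (c2 * mean3 rs (gap rs) * hrej rs m +
   (- (c2 * mean3 rs (gap rs)) * hrej rs 0%N + K * bad_prob rs)).
Proof.
have b13 : bm (fun z : trip => rej f z.1.1 z.2) by exact: bm_rej13.
have b12 : bm (fun z : trip => rej f z.1.1 z.1.2) by exact: bm_rej12.
have bs := bm_seed (bm_bad_out rs).
rewrite hrej_all hrej_none; symmetry.
apply: etrans (esym (mean3_comb rs _ _ _ _ b13 b12 bs)) _; apply: eq_mean3 => z.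
rewrite /round_mean /outB meanZ; last exact: (bm_seed1 (z.1.1, z.2) (bm_bad_out rs)).
rewrite /massu /massg natrM.
move: (mean3 rs (gap rs)) (rej _ _ z.2) (rej _ _ z.1.2) (mean (seed_law A) _) => M r1 r2 s.
move: (mean Dtest _) (mean Dtrain _) => g u; ring.
Qed.

Lemma Phi_round Cn t rs : 0 <= Cn ->
  round_bound Dtrain Dtest mf kb r0 W ka (ka * lam) rs (fun r => Phi Cn t (rcons rs r)) (Phi Cn t.+1 rs).
Proof.
move=> Cn0; pose K := Cn * rho ^+ t * (1 + mu) ^+ nbad [::] rs * expR (zeta * energy rs).
have rho0 : 0 <= rho by rewrite addr_ge0// divr_ge0// ltW.
have K0 : 0 <= K by rewrite !mulr_ge0// ?exprn_ge0// ?expR_ge0// addr_ge0// ltW.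
pose tau := 2 * (zeta * C1) ^+ 2; pose E := (lam%:R + 1) * err.
(* The witnesses are the coefficients of the first-order expansion of [Phi] about its current value
   [K], with [tau] absorbing the second-order term of the exponential. *)
exists (K * (1 + tau + zeta * E)), (K * zeta * (massu rs - massg rs)),
  (K * zeta), (gap rs), (fun o => K * mu * (51 / 50) * (bad_out rs o)%:R); split.
- exact: bm_gap.
- by apply: bmZ; exact: (bm_bad_out rs).
- move=> r rr; rewrite /round_value round_value_arith /Phi nbad_rcons cat0s.
  have H : energy (rcons rs r) <= energy rs + incr rs r by exact: energy_rcons.
  have hx : `|zeta * incr rs r| <= zeta * C1.
    by rewrite normrM (gtr0_norm zeta0) (ler_pM2l zeta0); exact: incr_bound.
  exact: (potential_step t (nbad [::] rs) (bad_out rs (rH r)) Cn0 rho0 (ltW mu0) (ltW zeta0) H hx zC1).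
- rewrite mean3_round_mean round_mean_arith.
  have -> : Phi Cn t.+1 rs = K * (1 + mu / 8).
    by rewrite /Phi /K exprSr -/rho; move: (rho ^+ t) (_ ^+ nbad _ _) (expR _) => x y w; ring.
  have hg := gap_upper Dtrain Dtest mf kb r0 lam rs.
  have hc := bad_prob_cases rs; have hb1 := bad_prob_le1 rs.
  have /andP[g0 _] := massg01 rs.
  have t2 : tau <= zeta * (gam / 1000).
    have := ler_wpM2l (ltW zeta0) zC2; apply: le_trans; rewrite /tau.
    by rewrite le_eqVlt; apply/orP; left; apply/eqP; ring.
  have km : m%:R + 1 <= ka%:R :> R by rewrite natr1 ler_nat -addn1.
  have hd := @drift_le R zeta gam eps `|massu rs - massg rs| m%:R ka%:R (massg rs)
    (hrej rs m - hrej rs 0%N) tau E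
    (m%:R * ((lam%:R + 1) / (r0.+1)%:R)) (bad_prob rs) zeta0 eps01 erefl (ler0n _ _) km m2ka t2 hE g0 hb1 hc
    (normr_ge0 _).
  exact: (round_mean_le K0 (ltW zeta0) erefl hg hd).
Qed.

End supermartingale.

(** * Evaluation of the majority vote and of the selector *)

Definition vote_loop := While (V 12 :-: V 27)
  (blk [:: Query (Cst 26) (flag 4) (V 31); 38 <~ V 38 :+: V 26; next_record]).

Definition vote := blk [:: 31 <~ V 0; 27 <~ Cst 64; 38 <~ Cst 0; vote_loop;
  0 <~ V 38 :+: V 38 :-: V 10].

(** The coin of each round is tossed at the counters of the rounds before it, during a single pass
    over the tape. The tosses share these counters and are dependent, so only linearity of
    expectation is used on them. *)
Definition select_loop := While (V 12 :-: V 27)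
  (blk [:: coin (weight false); If (V 20) Skip (38 <~ V 38 :+: Cst 1); update]).

(* Accepts unless more than a quarter of the rounds rejected the point. *)
Definition select := blk [:: 31 <~ V 0; 29 <~ Cst 0; 30 <~ Cst 0; 27 <~ Cst 64; 38 <~ Cst 0;
  select_loop; 0 <~ (V 10 :+: Cst 1) :-: (V 38 :+: V 38 :+: V 38 :+: V 38)].

(** Each entry of [al] gives what a round earns on acceptance and on rejection, so that one analysis
    serves both errors and rejections. *)
Fixpoint score (al : seq (bool * bool)) (g : seq bool) : nat :=
  match al, g with
  | a :: al', b :: g' => ((if b then a.1 else a.2) + score al' g')%N
  | _, _ => 0%N
  end.

Section evaluation.
Context {R : realType} {d : measure_display} {X : measurableType d}.
Variables (A : learner R X) (T : nat) (f : concept X).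
Variables (Dtrain Dtest : probability X R).
Variables (Post G : store X -> Prop).
Hypothesis mf : measurable_fun setT f.
Variables (kb r0 W : nat).

Notation J := (J A T f Dtrain Dtest Post G).
Notation Rep := (Rep f kb r0 W).
Let n := ntrain A.
Let m := ntest A.
Notation rnd := (rnd A).

Lemma J_query N a e1 e2 k m0 ps hs tr te nc nd t o x v :
  handle (Store m0 ps hs tr te nc nd t) (eval m0 e1) o -> onth ps (eval m0 e2) = Some x ->
  J N (k, Store (upd m0 (eval m0 a) (concept_of o x)) ps hs tr te nc nd (t.+1 + T)) v ->
  J N.+1 (Query a e1 e2 :: k, Store m0 ps hs tr te nc nd t) v.
Proof.
move=> ho hx; apply: J_det => -[[[? ?] ?] ?] /=; move: ho; rewrite hx.
by case: o => [h [i [/= -> ->]]|/= ->].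
Qed.

Lemma J_vote_loop N k (rs : seq rnd) x s v :
  tapeAt f W s (mem s 27) rs -> mem s 12 = (mem s 27 + size rs * reclen A)%N ->
  mem s 4 = n -> mem s 1 = m -> (64 <= mem s 27)%N -> onth (pts s) (mem s 31) = Some x ->
  (forall s', mem s' 38 = (mem s 38 + count (fun r => concept_of (rH r) x) rs)%N ->
    mem s' 10 = mem s 10 -> J N (k, s') v) ->
  J (size rs * 8 + 1 + N) (vote_loop :: k, s) v.
Proof.
elim: rs s => [|r rs IH] [m0 ps hs tr te nc nd t] tp m12 m4 m1 h27 px H.
  apply: J_while0; first by move: m12; rewrite /= mul0n addn0 => ->; rewrite subnn.
  by apply: H => //=; rewrite addn0.
case: tp => rr tp; rewrite /= in m12 m4 m1 h27 px.
rewrite (_ : (size (r :: rs) * 8 + 1 + N = 8 + (size rs * 8 + 1 + N))%N); last by rewrite /=; lia.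
apply: J_while1; first by rewrite /= m12 -lt0n subn_gt0 mulSn /reclen; lia.
jdet; apply: (J_query (o := rH r) (x := x)) => //.
  by rewrite /flag /= m4 m1; exact: (rec_H rr).
jdet; jdet; jdet; jdet; jdet; set s1 := Store _ _ _ _ _ _ _ _.
have E27 : mem s1 27 = (m0 27 + reclen A)%N by rewrite /s1 /= /upd /= m4 m1 /reclen; lia.
apply: IH.
- rewrite E27; apply: tapeAt_ext tp; first by split; exists [::]; rewrite cats0.
  move=> a /andP[Ha _]; have {}Ha : (m0 27 + reclen A <= a)%N := Ha.
  by rewrite /s1; updout.
- by rewrite E27 /s1 /= /upd /= m12 mulSn; lia.
- by [].
- by [].
- by rewrite E27; lia.
- by [].
- by move=> s' h38 h10; apply: H; rewrite ?h38 ?h10 /s1 /= /upd /= ?addnA.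
Qed.

Lemma J_vote N (rs : seq rnd) x s v : Rep s rs ->
  (forall s', mem s' 0 = (count (fun r => concept_of (rH r) x) rs +
     count (fun r => concept_of (rH r) x) rs - mem s 10)%N -> J N ([::], s') v) ->
  J (size rs * 8 + 11 + N) ([:: vote], query_store s x) v.
Proof.
case: s => m0 ps hs tr te nc nd t [/= m4 m1 m6 m7 m12 cl tp] H.
rewrite (_ : (size rs * 8 + 11 + N = 7 + (size rs * 8 + 1 + (3 + N)))%N); last by lia.
rewrite /query_store /=; jdet; jdet; jdet; jdet; jdet; jdet; jdet.
set s1 := Store _ _ _ _ _ _ _ _.
apply: (J_vote_loop (x := x)) => //.
- rewrite (_ : mem s1 27 = 64%N)//; apply: tapeAt_ext tp.
    by split; [exists [:: x]; rewrite cats1 | exists [::]; rewrite cats0].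
  by move=> a Ha; rewrite /s1; updout.
- by rewrite /s1 /= /upd /= -cats1 onth_size_cat.
case=> m2 ps2 hs2 tr2 te2 nc2 nd2 t2; rewrite {1 2}/s1 /= /upd /= add0n => h38 h10.
by jdet; jdet; jdet; apply: H; rewrite /= /upd /= h38 h10.
Qed.

(* The expected score when the tosses follow the coins of [g]. *)
Fixpoint selS (x : X) (al : seq (bool * bool)) (rs : seq rnd) (p q : nat) : R :=
  match al, rs with
  | a :: al', r :: rs' => incrE (rprobs f r x 0 m) (sgn1 r) (sgn0 r)
      (fun p q => selS x al' rs' (p + inc1 r) (q + inc0 r)) p q +
      ((a.1)%:R - (a.2)%:R) * bern kb false p q + (a.2)%:R
  | _, _ => 0
  end.

Lemma incrE_scale ps s1 s0 (K : nat -> nat -> R) (c be : R) p q :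
  incrE ps s1 s0 (fun p q => c + be * K p q) p q = c + be * incrE ps s1 s0 K p q.
Proof. by elim: ps p q => [//|a ps IH] p q /=; rewrite !IH; ring. Qed.

(** A terminal value proportional to the score turns the logic into a Markov inequality; [c]
    accumulates what was earned in the rounds already passed, and [B] bounds the counter for the
    cost of the coins. *)
Lemma J_select_loop N k (al : seq (bool * bool)) (rs : seq rnd) x s B (be c : R) :
  size al = size rs ->
  tapeAt f W s (mem s 27) rs -> mem s 12 = (mem s 27 + size rs * reclen A)%N ->
  mem s 4 = n -> mem s 1 = m -> mem s 6 = kb -> (64 <= mem s 27)%N -> clean s ->
  onth (pts s) (mem s 31) = Some x -> (mem s 29 + size rs * W <= B)%N ->
  (forall s' g, size g = size rs -> mem s' 38 = (mem s 38 + count negb g)%N ->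
    mem s' 10 = mem s 10 -> J N (k, s') (c + be * (score al g)%:R)) ->
  J (size rs * (coin_cost kb B + update_cost A + 12) + 1 + N) (select_loop :: k, s)
    (c + be * selS x al rs (mem s 29) (mem s 30)).
Proof.
set per := (coin_cost kb B + _ + _)%N.
elim: rs al s c => [|r rs IH] [|a al] [m0 ps hs tr te nc nd t] c //= sz.
  move=> _ m12 _ _ _ _ _ _ _ H.
  apply: J_while0; first by move: m12; rewrite /= mul0n addn0 => ->; rewrite subnn.
  by apply: (H _ [::]) => //=; rewrite addn0.
move=> [rr tp] m12 m4 m1 m6 h27 cl px hB H.
case: sz => sz; have E := @mulSn (size rs) per.
pose N2 := (update_cost A + (1 + (size rs * per + 1 + N)))%N.
have fin s2 (b : bool) : extends (Store m0 ps hs tr te nc nd t) s2 -> clean s2 ->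
    (forall a, (a < 20)%N || (25 <= a < 38)%N || (64 <= a)%N -> mem s2 a = m0 a) ->
    mem s2 38 = (m0 38 + ~~ b)%N ->
    J N2 ([:: update, Skip, select_loop & k], s2)
      (c + be * (if b then a.1 else a.2)%:R + be * incrE (rprobs f r x 0 m) (sgn1 r) (sgn0 r)
        (fun p q => selS x al rs (p + inc1 r) (q + inc0 r)) (m0 29%N) (m0 30%N)).
  move=> ex c2 e2 e38; set c' := c + be * _.
  rewrite -incrE_scale -(e2 29%N)// -(e2 30%N)//.
  have [e27 e31] : mem s2 27 = m0 27%N /\ mem s2 31 = m0 31%N by rewrite !e2.
  apply: (J_update mf (W := W) (x := x) (K := fun p q => c' + be * selS x al rs p q)).
  - rewrite e27; apply: recAt_ext ex _ rr => a' Ha; apply: e2; lia.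
  - by rewrite e2.
  - by rewrite e2.
  - by rewrite e27.
  - by [].
  - by case: ex => -[l ->] _; rewrite e31; exact: onth_cat_some.
  case=> m3 ps3 hs3 tr3 te3 nc3 nd3 t3 p q fr /= g27 cl3 g29 g30 hp hq.
  jdet; set s3 := Store _ _ _ _ _ _ _ _; rewrite -g29 -g30.
  have fm a' : ~~ (25 <= a' < 31)%N -> m3 a' = mem s2 a' by exact: (frame_mem fr).
  have ex3 : extends (Store m0 ps hs tr te nc nd t) s3 := extends_trans ex (extends_frame fr).
  apply: (IH al s3 c' sz) => //=.
  - rewrite g27 e27; apply: (tapeAt_ext ex3 _ tp) => a' /andP[Ha _].
    have {}Ha : (m0 27 + reclen A <= a')%N := Ha.
    by rewrite /= fm ?e2//; lia.
  - by rewrite fm// e2// g27 e27 m12 mulSn addnA.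
  - by rewrite fm// e2.
  - by rewrite fm// e2.
  - by rewrite fm// e2.
  - by rewrite g27 e27; lia.
  - rewrite fm// e31; case: ex3 => -[l /= ->] _; exact: onth_cat_some.
  - by rewrite g29; rewrite (e2 29%N) // in hp; lia.
  move=> s' g sg h38 h10; have := H s' (b :: g); rewrite /= sg => /(_ erefl _ _) H'.
  suff -> : c' + be * (score al g)%:R = c + be * ((if b then a.1 else a.2) + score al g)%:R.
    by apply: H'; [rewrite h38 fm// e38 addnA | rewrite h10 fm// e2].
  by rewrite /c' natrD; ring.
rewrite E (_ : (per + size rs * per + 1 + N = 2 + (coin_cost kb B + (9 + N2)))%N); last first.
  by rewrite /N2 /per; lia.
apply: J_while1; first by rewrite /= m12 -lt0n subn_gt0 mulSn /reclen; lia.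
jdet; set s0 := Store _ _ _ _ _ _ _ _.
have mB : (m0 29 - m0 30 <= B)%N by lia.
pose S' := incrE (rprobs f r x 0 m) (sgn1 r) (sgn0 r)
        (fun p q => selS x al rs (p + inc1 r) (q + inc0 r)) (m0 29%N) (m0 30%N).
have Hc := @J_coin _ _ _ A T f Dtrain Dtest Post G (9 + N2) kb (weight false) (m0 29 - m0 30)%N
  [:: blk [:: If (V 20) Skip (38 <~ V 38 :+: Cst 1); update], select_loop & k] s0
  (c + be * (a.1)%:R + be * S') (c + be * (a.2)%:R + be * S') m6 erefl.
apply: (J_weak (Hc _ _)).
- case=> m2 ps2 hs2 tr2 te2 nc2 nd2 t2 fr c2 /= m20.
  jdet; apply: J_if; rewrite /= m20; jdet; jdet.
  apply: (J_weak (n := N2)) => //; last by lia.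
  apply: (fin _ true) => //; first exact: (extends_frame fr).
  + exact: (c2 cl).
  + by move=> a' Ha; apply: (frame_mem fr); lia.
  + by rewrite /= addn0; exact: (frame_mem fr).
- case=> m2 ps2 hs2 tr2 te2 nc2 nd2 t2 fr c2 /= m20.
  jdet; apply: J_if; rewrite /= m20 /=; jdet; jdet.
  apply: (J_weak (n := N2)) => //; last by lia.
  have fm a' : ~~ (20 <= a' < 25)%N -> m2 a' = m0 a' by exact: (frame_mem fr).
  apply: (fin _ false) => //.
  + by have [h1 h2] := extends_frame fr; split.
  + exact: (c2 cl).
  + by move=> a' Ha /=; rewrite upd_neq ?fm//; [lia | apply/eqP; lia].
  + by rewrite /= upd_eq fm.
- by rewrite leq_add2r /coin_cost leq_add2r leq_mul2r mB orbT.
- clear Hc fin; rewrite /= -/S' /bern; move: ((1 - 2^-1 ^+ kb) ^+ _) S' ((a.1)%:R) ((a.2)%:R) => w S a1 a0.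
  by rewrite le_eqVlt; apply/orP; left; apply/eqP; ring.
Qed.

Definition select_cost t := (t * (coin_cost kb (t * W) + update_cost A + 12) + 15)%N.

Lemma J_select N (al : seq (bool * bool)) (rs : seq rnd) x s (be : R) : Rep s rs ->
  size al = size rs ->
  (forall s' g, size g = size rs ->
    mem s' 0 = (mem s 10 + 1 - (count negb g + count negb g + count negb g + count negb g))%N ->
    J N ([::], s') (be * (score al g)%:R)) ->
  J (select_cost (size rs) + N) ([:: select], query_store s x) (be * selS x al rs 0 0).
Proof.
case: s => m0 ps hs tr te nc nd t [/= m4 m1 m6 m7 m12 cl tp] sz H.
set per := (coin_cost kb (size rs * W) + update_cost A + 12)%N.
rewrite (_ : (select_cost (size rs) + N = 11 + (size rs * per + 1 + (3 + N)))%N); last first.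
  by rewrite /select_cost -/per; lia.
rewrite /query_store /=; do 11 jdet.
set s1 := Store _ _ _ _ _ _ _ _.
have -> : be * selS x al rs 0 0 = 0 + be * selS x al rs (mem s1 29) (mem s1 30) by rewrite add0r.
apply: (J_select_loop (x := x) (B := size rs * W)) => //.
- rewrite (_ : mem s1 27 = 64%N)//; apply: tapeAt_ext tp.
    by split; [exists [:: x]; rewrite cats1 | exists [::]; rewrite cats0].
  by move=> a Ha; rewrite /s1; updout.
- by rewrite /s1 /= /upd /= -cats1 onth_size_cat.
case=> m2 ps2 hs2 tr2 te2 nc2 nd2 t2 g sg; rewrite {1 2}/s1 /= /upd /= add0n => h38 h10.
by jdet; jdet; jdet; rewrite add0r; apply: H => //; rewrite /= /upd /= h38 h10.
Qed.

Fixpoint selT (x : X) (pre : seq rnd) (al : seq (bool * bool)) (rs : seq rnd) : R :=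
  match al, rs with
  | a :: al', r :: rs' => selT x (rcons pre r) al' rs' +
      ((a.1)%:R - (a.2)%:R) * wt f kb false pre x + (a.2)%:R
  | _, _ => 0
  end.

(** Although the tosses are correlated, the expected score is a sum in which each round enters only
    through the mean weight after its own prefix. *)
Lemma selST x pre al (rs : seq rnd) : EV f pre x (selS x al rs) 0 0 = selT x pre al rs.
Proof.
elim: rs pre al => [|r rs IH] pre [|a al] /=; rewrite ?EV_cst//.
by rewrite EV_lin -IH EV_rcons.
Qed.

End evaluation.

(** * Few bad rounds imply the guarantee of the vote *)

Section guarantee.
Context {R : realType} {d : measure_display} {X : measurableType d}.
Variables (A : learner R X) (T : nat) (f : concept X) (eps : R).
Variables (Dtrain Dtest : probability X R).
Hypothesis mf : measurable_fun setT f.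
Hypothesis eps0 : 0 <= eps.
Variables (kb r0 W : nat).
Notation Rep := (Rep f kb r0 W).
Notation rnd := (rnd A).
Notation bad_out := (bad_out f eps Dtrain Dtest kb).
Notation nbad := (nbad f eps Dtrain Dtest kb).
Notation selT := (selT f kb).
Notation wt := (wt f kb).

(** Bad rounds score nothing here, since their error is not controlled; they are charged to [nbad]
    instead. *)
Fixpoint errs (x : X) (pre rs : seq rnd) : seq (bool * bool) :=
  if rs is r :: rs' then
    (~~ bad_out pre (rH r) && (f x != concept_of (rH r) x), false) :: errs x (rcons pre r) rs'
  else [::].

Fixpoint rejs (pre rs : seq rnd) : seq (bool * bool) :=
  if rs is r :: rs' then (false, ~~ bad_out pre (rH r)) :: rejs (rcons pre r) rs' else [::].

Lemma size_errs x pre rs : size (errs x pre rs) = size rs.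
Proof. by elim: rs pre => //= r rs IH pre; rewrite IH. Qed.

Lemma size_rejs pre rs : size (rejs pre rs) = size rs.
Proof. by elim: rs pre => //= r rs IH pre; rewrite IH. Qed.

(** A round that errs at x is bad, or rejects x, or is good and accepts x; only the last kind
    scores. *)
Lemma score_errs x pre rs g : size g = size rs ->
  (count (fun r => f x != concept_of (rH r) x) rs <=
   score (errs x pre rs) g + count negb g + nbad pre rs)%N.
Proof.
elim: rs pre g => [|r rs IH] pre [|b g] //= [sg]; have := IH (rcons pre r) g sg.
case: b; case: (bad_out pre (rH r)); case: (f x != _) => /=; lia.
Qed.

Lemma score_rejs pre rs g : size g = size rs ->
  (count negb g <= score (rejs pre rs) g + nbad pre rs)%N.
Proof.
elim: rs pre g => [|r rs IH] pre [|b g] //= [sg]; have := IH (rcons pre r) g sg.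
case: b; case: (bad_out pre (rH r)) => /=; lia.
Qed.

Lemma count_right x (rs : seq rnd) :
  (count (fun r => concept_of (rH r) x) rs + count (fun r => ~~ concept_of (rH r) x) rs)%N = size rs.
Proof. exact: count_predC. Qed.

Lemma selT_errs_bound pre rs :
  bm (fun x => selT x pre (errs x pre rs) rs) /\
  mean Dtest (fun x => selT x pre (errs x pre rs) rs) <= (size rs)%:R * (2 * eps).
Proof.
elim: rs pre => [|r rs IH] pre /=.
  by split; [exact: bm_cst | rewrite mean_cst mul0r].
have [b1 h1] := IH (rcons pre r).
pose F x := ((~~ bad_out pre (rH r) && (f x != concept_of (rH r) x))%:R - 0) * wt false pre x + 0.
suff [b2 h2] : bm F /\ mean Dtest F <= 2 * eps.
  have E : (fun x => selT x (rcons pre r) (errs x (rcons pre r) rs) rs +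
      ((~~ bad_out pre (rH r) && (f x != concept_of (rH r) x))%:R - 0%:R) * wt false pre x + 0%:R) =
    (fun x => selT x (rcons pre r) (errs x (rcons pre r) rs) rs + F x).
    by apply/funext => x; rewrite /F addrA.
  rewrite E; split; first exact: bmD.
  by rewrite meanD// -natr1 mulrDl mul1r lerD.
rewrite /F; case hb : (bad_out pre (rH r)) => /=.
  rewrite (_ : (fun x => _) = (fun=> 0 : R)); last by apply/funext => x; rewrite subrr mul0r addr0.
  by split; [exact: bm_cst | rewrite mean_cst mulr_ge0].
move: hb => /negbFE/asboolP[mw ht _].
rewrite (_ : (fun x => _) = (fun x => wt false pre x * (f x != concept_of (rH r) x)%:R)); last first.
  by apply/funext => x; rewrite subr0 addr0 mulrC.
by split => //; apply: bmM; [exact: bm_wt | exact: bm_indic].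
Qed.

Lemma selT_rejs_bound pre rs :
  bm (fun x => selT x pre (rejs pre rs) rs) /\
  mean Dtrain (fun x => selT x pre (rejs pre rs) rs) <= (size rs)%:R * (2 * eps).
Proof.
elim: rs pre => [|r rs IH] pre /=.
  by split; [exact: bm_cst | rewrite mean_cst mul0r].
have [b1 h1] := IH (rcons pre r).
pose F x := (0 - (~~ bad_out pre (rH r))%:R) * wt false pre x + (~~ bad_out pre (rH r))%:R.
suff [b2 h2] : bm F /\ mean Dtrain F <= 2 * eps.
  have E : (fun x => selT x (rcons pre r) (rejs (rcons pre r) rs) rs +
      (0%:R - (~~ bad_out pre (rH r))%:R) * wt false pre x + (~~ bad_out pre (rH r))%:R) =
    (fun x => selT x (rcons pre r) (rejs (rcons pre r) rs) rs + F x).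
    by apply/funext => x; rewrite /F addrA.
  rewrite E; split; first exact: bmD.
  by rewrite meanD// -natr1 mulrDl mul1r lerD.
rewrite /F; case hb : (bad_out pre (rH r)) => /=.
  rewrite (_ : (fun x => _) = (fun=> 0 : R)); last by apply/funext => x; rewrite subrr mul0r addr0.
  by split; [exact: bm_cst | rewrite mean_cst mulr_ge0].
move: hb => /negbFE/asboolP[_ _ ht].
rewrite (_ : (fun x => _) = (fun x => 1 - wt false pre x)); last first.
  by apply/funext => x; rewrite sub0r mulN1r addrC.
by split => //; apply: bmB; [exact: bm_cst | exact: bm_wt].
Qed.

Lemma prod_section d1 d2 (T1 : measurableType d1) (T2 : measurableType d2)
    (P1 : probability T1 R) (P2 : probability T2 R) (S : set (T1 * T2)) :
  (P1 \x P2)%E S = (\int[P1]_z P2 [set w | S (z, w)])%E.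
Proof.
apply: eq_integral => z _; congr (P2 _).
by apply/seteqP; split => w /=; rewrite /xsection/= inE.
Qed.

Variables (rs : seq rnd) (s : store X) (T6 N : nat).
Hypotheses (T60 : (0 < T6)%N) (rep : Rep s rs) (srs : size rs = (6 * T6)%N).
Hypotheses (s10 : mem s 10 = (6 * T6)%N) (few : (nbad [::] rs <= T6)%N).
Hypothesis vN : ((size rs) * 8 + 11 <= N)%N.
Hypothesis sN : (select_cost A kb W (size rs) <= N)%N.

(** Markov inequality at the level T6 / 2. A wrong majority has at least 3 T6 erring rounds, of
    which acceptance leaves at most 3 T6 / 2 rejecting and at most T6 are bad; a rejected point has
    more than 3 T6 / 2 rejecting rounds, at most T6 of them bad. The mean score is at most 6 T6 * 2
    eps, which gives 24 eps. *)
Let be : R := 2 / T6%:R.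
Let be0 : 0 <= be. Proof. by rewrite divr_ge0. Qed.

Let be_ge1 k : (T6 <= 2 * k)%N -> 1 <= be * k%:R.
Proof.
move=> h; rewrite /be mulrAC ler_pdivlMr ?ltr0n// mul1r -natrM ler_nat; exact: h.
Qed.

Let be_mass : be * ((size rs)%:R * (2 * eps)) = 24 * eps.
Proof.
have t0 : (T6%:R : R) != 0 by rewrite pnatr_eq0; lia.
by rewrite /be srs natrM; field.
Qed.

Let Q := iid (noise_law A Dtrain Dtest) N.

Lemma evaluate_vote (w : N.-tuple (noise A)) x :
  evaluate T f vote s w x =
  (6 * T6 < 2 * count (fun r => concept_of (rH r) x) rs)%N.
Proof.
pose Post (s' : store X) := mem s' 0 = (count (fun r => concept_of (rH r) x) rs +
     count (fun r => concept_of (rH r) x) rs - mem s 10)%N.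
(* With an impossible bad event the logic is used for its postcondition alone: the vote depends on
   no randomness. *)
have H : J A T f Dtrain Dtest Post (fun=> False) (size rs * 8 + 11 + 0)
    ([:: vote], query_store s x) 0.
  by apply: J_vote rep _ => s' h; apply: J_halt.
have [|_ + _] := J_halts H (ws := w); first by rewrite size_tuple addn0.
rewrite /Post s10 /evaluate /run => ->; apply/idP/idP; lia.
Qed.

Lemma wrong_majority (w : N.-tuple (noise A)) x : f x != evaluate T f vote s w x ->
  (3 * T6 <= count (fun r => f x != concept_of (rH r) x) rs)%N.
Proof.
rewrite evaluate_vote; have := count_right x rs; rewrite srs.
case: (f x); case: ltnP => // h hc _.
  rewrite (eq_count (a2 := fun r => ~~ concept_of (rH r) x)); last by move=> r /=; case: (concept_of _ _).
  by lia.
rewrite (eq_count (a2 := fun r => concept_of (rH r) x)); last by move=> r /=; case: (concept_of _ _).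
by lia.
Qed.

Let val x := be * selS f kb x (errs x [::] rs) rs 0 0.
Let valr x := be * selS f kb x (rejs [::] rs) rs 0 0.

Let valE : val = fun x => be * selT x [::] (errs x [::] rs) rs.
Proof. by apply/funext => x; rewrite /val -selST. Qed.

Let valrE : valr = fun x => be * selT x [::] (rejs [::] rs) rs.
Proof. by apply/funext => x; rewrite /valr -selST. Qed.

Lemma select_accept x : (3 * T6 <= count (fun r => f x != concept_of (rH r) x) rs)%N ->
  (Q [set w | evaluate T f select s (w : N.-tuple (noise A)) x] <= (val x)%:E)%E.
Proof.
move=> h.
have H : J A T f Dtrain Dtest (fun=> True) (fun s' => mem s' 0 != 0%N : Prop) (select_cost A kb W (size rs) + 0)
    ([:: select], query_store s x) (val x).
  rewrite /val; apply: (@J_select _ _ _ A T f Dtrain Dtest _ _ mf kb r0 W 0 (errs x [::] rs) rs x s be rep (size_errs x [::] rs)) => s' g sg e; apply: J_halt => //.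
    by rewrite mulr_ge0.
  rewrite e s10 => acc; apply: be_ge1; have := score_errs x [::] sg; lia.
by apply: (J_upper H); rewrite addn0.
Qed.

Lemma select_reject x :
  (Q [set w | ~~ evaluate T f select s (w : N.-tuple (noise A)) x] <= (valr x)%:E)%E.
Proof.
have H : J A T f Dtrain Dtest (fun=> True) (fun s' => ~~ (mem s' 0 != 0%N) : Prop) (select_cost A kb W (size rs) + 0)
    ([:: select], query_store s x) (valr x).
  rewrite /valr; apply: (@J_select _ _ _ A T f Dtrain Dtest _ _ mf kb r0 W 0 (rejs [::] rs) rs x s be rep (size_rejs [::] rs)) => s' g sg e; apply: J_halt => //.
    by rewrite mulr_ge0.
  rewrite e s10 => acc; apply: be_ge1; have := score_rejs [::] sg; lia.
by apply: (J_upper H); rewrite addn0.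
Qed.

Lemma selS_ge0 x al rs' p q : 0 <= selS f kb x al (rs' : seq rnd) p q.
Proof.
elim: rs' al p q => [|r rs' IH] [|a al] p q //=.
rewrite -addrA addr_ge0//.
  rewrite -(incrE_cst (rprobs f r x 0 (ntest A)) (sgn1 r) (sgn0 r) 0 p q); apply: le_incrE => //.
  by move=> b; exact: rprobs01.
have /andP[b0 b1] : 0 <= (bern kb false p q : R) <= 1 by exact: bern01.
by move: (bern kb false p q) b0 b1 => w; case: (a.1); case: (a.2) => /=; lra.
Qed.

Lemma guarantee : PQ_guarantee Dtrain Dtest f Q
  (evaluate T f vote s) (evaluate T f select s) (24 * eps) (24 * eps).
Proof.
have [be1 he1] := selT_errs_bound [::] rs; have [br1 hr1] := selT_rejs_bound [::] rs.
have bv : bm val by rewrite valE; exact: bmZ.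
have bvr : bm valr by rewrite valrE; exact: bmZ.
split.
  rewrite prod_section.
  have bv1 : bm (fun z : X * N.-tuple (noise A) => val z.1) by exact: (bm_comp measurable_fst bv).
  apply: (@le_trans _ _ (mean (Dtest \x Q)%E (fun z => val z.1))%:E); last first.
    have -> : mean (Dtest \x Q)%E (fun z => val z.1) = mean Dtest val.
      by rewrite mean_prod//; apply: eq_mean => x; exact: (mean_cst Q (val x)).
    rewrite lee_fin.
    by rewrite valE meanZ// -be_mass ler_wpM2l.
  rewrite -EFin_mean//; apply: le_integral_nonmeas => z; first exact: measure_ge0.
  case: z => x w /=; case: (boolP (f x != evaluate T f vote s w x)) => hw.
    apply: le_trans (select_accept (wrong_majority hw)).
    rewrite le_eqVlt; apply/orP; left; apply/eqP; congr (Q _).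
    by apply/seteqP; split => w2 /= => [[]|].
  rewrite [X in Q X](_ : _ = set0) ?measure0.
    by rewrite lee_fin mulr_ge0// selS_ge0.
  by apply/seteqP; split => w2 //= -[].
rewrite prod_section.
apply: (@le_trans _ _ (mean Dtrain valr)%:E); last first.
  by rewrite lee_fin valrE meanZ// -be_mass ler_wpM2l.
rewrite -EFin_mean//; apply: le_integral_nonmeas => x; first exact: measure_ge0.
exact: select_reject.
Qed.

End guarantee.

(** * Computation and arithmetic of the parameters *)

Lemma two_pow3 : (2 ^ 3 = 8)%N. Proof. by []. Qed.
Lemma two_pow8 : (2 ^ 8 = 256)%N. Proof. by []. Qed.

Local Opaque expn.

Fixpoint times (k : nat) (e : expr) : expr := if k is k'.+1 then e :+: times k' e else Cst 0.

Definition log_loop a b := While (V a :-: V 15)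
  (blk [:: 15 <~ V 15 :+: V 15; b <~ V b :+: Cst 1]).

Definition double_loop a := While (V 14) (blk [:: a <~ V a :+: V a; 14 <~ V 14 :-: Cst 1]).

Definition double a e := blk [:: 14 <~ e; double_loop a].

(* With j and L the binary logarithms of ntrain + ntest + 1/eps + 1 and of
   1/delta, and S = 2^j: q = 1 - 2^-52 S^-10, 2^19 S^3 tries per sample,
   kappa = 2^15 S^3, lambda = S and 6 (L + 1) 2^67 S^12 rounds. *)
Definition learning := blk [:: 4 <~ V 0; 18 <~ V 0 :+: V 1 :+: V 2 :+: Cst 1;
  15 <~ Cst 1; log_loop 18 16; 15 <~ Cst 1; log_loop 3 17;
  6 <~ Cst 52 :+: times 10 (V 16);
  7 <~ Cst 1; double 7 (Cst 19 :+: times 3 (V 16));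
  8 <~ Cst 1; double 8 (Cst 15 :+: times 3 (V 16));
  9 <~ Cst 1; double 9 (Cst 15 :+: times 4 (V 16));
  10 <~ times 6 (V 17 :+: Cst 1); double 10 (Cst 67 :+: times 12 (V 16));
  12 <~ Cst 64; 13 <~ V 10; rounds].

Section parameters.
Context {R : realType} {d : measure_display} {X : measurableType d}.
Variables (A : learner R X) (T : nat) (f : concept X).
Variables (Dtrain Dtest : probability X R).
Variables (Post G : store X -> Prop).
Notation J := (J A T f Dtrain Dtest Post G).

Lemma J_log N a b k m0 ps hs tr te nc nd t v i : a != 15%N -> b != 15%N -> a != b ->
  m0 15%N = (2 ^ i)%N -> m0 b = i -> (i <= up_log 2 (m0 a))%N ->
  (forall m' t', m' b = up_log 2 (m0 a) -> (forall c, c != 15%N -> c != b -> m' c = m0 c) ->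
    J N (k, Store m' ps hs tr te nc nd t') v) ->
  J (6 * (up_log 2 (m0 a) - i) + 1 + N) (log_loop a b :: k, Store m0 ps hs tr te nc nd t) v.
Proof.
move=> a15 b15 ab; move El : (up_log 2 (m0 a) - i)%N => l.
elim: l i m0 t El => [|l IH] i m0 t El m15 mb iL H.
  have iE : i = up_log 2 (m0 a) by lia.
  rewrite muln0 add0n; apply: J_while0; last by apply: H; rewrite ?mb.
  by apply/eqP; rewrite /= m15 iE subn_eq0; apply: up_logP.
rewrite (_ : (6 * l.+1 + 1 + N = 6 + (6 * l + 1 + N))%N); last by lia.
apply: J_while1.
  rewrite /= m15 subn_eq0; apply/negP => h; have : (up_log 2 (m0 a) <= i)%N by exact: up_log_min.
  by lia.
jdet; jdet; jdet; jdet; jdet.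
have Ea : upd (upd m0 15 (m0 15 + m0 15)%N) b (upd m0 15 (m0 15 + m0 15)%N b + 1)%N a = m0 a.
  by rewrite !upd_neq.
apply: (IH i.+1); rewrite ?Ea.
- by lia.
- by rewrite upd_neq 1?eq_sym// upd_eq m15 expnS; lia.
- by rewrite upd_eq upd_neq// mb addn1.
- by lia.
- by move=> m' t' h1 h2; apply: H => // c c1 c2; rewrite h2// !upd_neq.
Qed.

Lemma J_double N a e E k m0 ps hs tr te nc nd t v : a != 14%N -> eval m0 e = E ->
  (forall m' t', m' a = (m0 a * 2 ^ E)%N -> (forall c, c != 14%N -> c != a -> m' c = m0 c) ->
    J N (k, Store m' ps hs tr te nc nd t') v) ->
  J (6 * E + 5 + N) (double a e :: k, Store m0 ps hs tr te nc nd t) v.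
Proof.
move=> a14 eE H; rewrite (_ : (6 * E + 5 + N = 3 + (6 * E + 1 + (1 + N)))%N); last by lia.
jdet; jdet; jdet; rewrite eE.
suff L m1 t1 (l : nat) : m1 14%N = l -> (m1 a * 2 ^ l = m0 a * 2 ^ E)%N ->
    (forall c, c != 14%N -> c != a -> m1 c = m0 c) ->
    J (6 * l + 1 + (1 + N)) ([:: double_loop a, Skip & k], Store m1 ps hs tr te nc nd t1) v.
  by apply: L => [||c c14 ca]; rewrite ?upd_eq ?upd_neq.
elim: l m1 t1 => [|l IH] m1 t1 m14 ma mo.
  rewrite muln0 add0n; apply: J_while0 => //=; jdet; apply: H => //.
  by move: ma; rewrite expn0 muln1.
rewrite (_ : (6 * l.+1 + 1 + (1 + N) = 6 + (6 * l + 1 + (1 + N)))%N); last by lia.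
apply: J_while1; first by rewrite /= m14.
jdet; jdet; jdet; jdet; jdet; apply: IH.
- by rewrite upd_eq upd_neq 1?eq_sym// m14 subn1.
- by rewrite upd_neq// upd_eq -ma expnS; lia.
- by move=> c c14 ca; rewrite !upd_neq// mo.
Qed.

Definition learning_cost (j L : nat) := (6 * j + 6 * L + 6 * (19 + 3 * j) + 6 * (15 + 3 * j) +
  6 * (15 + 4 * j) + 6 * (67 + 12 * j) + 100)%N.

Lemma J_learning N m0 ps hs tr te nc nd t v : m0 16%N = 0%N -> m0 17%N = 0%N ->
  let j := up_log 2 (m0 0%N + m0 1%N + m0 2%N + 1)%N in let L := up_log 2 (m0 3%N) in
  (forall m' t', [/\ m' 4%N = m0 0%N, m' 1%N = m0 1%N, m' 6%N = (52 + 10 * j)%N,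
     m' 7%N = (2 ^ (19 + 3 * j))%N & m' 8%N = (2 ^ (15 + 3 * j))%N] ->
     [/\ m' 9%N = (2 ^ (15 + 4 * j))%N, m' 10%N = (6 * (L + 1) * 2 ^ (67 + 12 * j))%N,
      m' 12%N = 64%N & m' 13%N = m' 10%N] ->
     J N ([:: rounds; Skip], Store m' ps hs tr te nc nd t') v) ->
  J (learning_cost j L + N) ([:: learning], Store m0 ps hs tr te nc nd t) v.
Proof.
move=> m16 m17 j L H.
apply: (J_weak (n := 7 + (6 * (j - 0) + 1 + (3 + (6 * (L - 0) + 1 + (5 + (6 * (19 + 3 * j) + 5 +
  (3 + (6 * (15 + 3 * j) + 5 + (3 + (6 * (15 + 4 * j) + 5 + (3 + (6 * (67 + 12 * j) + 5 +
  (5 + N))))))))))))) _ _ (lexx v)); last by rewrite /learning_cost; lia.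
do 7 jdet.
set m1 := upd _ 15 _; have e18 : m1 18%N = (m0 0%N + m0 1%N + m0 2%N + 1)%N by rewrite /m1 /upd.
have Ej : up_log 2 (m1 18%N) = j by rewrite e18.
rewrite -{1}Ej; apply: J_log => //.
rewrite Ej => m2 t2 g16 g; have {}g c : c != 15%N -> c != 16%N -> m2 c = m1 c by exact: g.
do 3 jdet; set m3 := upd m2 15 _.
have e3 : m3 3%N = m0 3%N by rewrite /m3 /upd /= g// /m1 /upd.
have EL : up_log 2 (m3 3%N) = L by rewrite e3.
rewrite -{1}EL; apply: J_log => //; first by rewrite /m3 /upd /= g// /m1 /upd /= m17.
rewrite EL => m4 t4 h17 h.
have a16 : m4 16%N = j by rewrite h// /m3 /upd.
have a1 : m4 1%N = m0 1%N by rewrite h// /m3 /upd /= g// /m1 /upd.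
have a4 : m4 4%N = m0 0%N by rewrite h// /m3 /upd /= g// /m1 /upd.
clear g g16 h EL e3 Ej e18; clearbody m3; clear m3; clearbody m1; clear m1.
do 5 jdet; apply: J_double => //; first by rewrite /= /upd /= a16; lia.
move=> m5 t5 h7; rewrite {1}/upd /= mul1n in h7 => h5.
do 3 jdet; apply: J_double => //; first by rewrite /= /upd /= h5// /upd /= a16; lia.
move=> m6 t6 h8; rewrite {1}/upd /= mul1n in h8 => h6.
do 3 jdet; apply: J_double => //; first by rewrite /= /upd /= h6// /upd /= h5// /upd /= a16; lia.
move=> m7 t7 h9; rewrite {1}/upd /= mul1n in h9 => h7'.
do 3 jdet; apply: J_double => //.
  by rewrite /= /upd /= h7'// /upd /= h6// /upd /= h5// /upd /= a16; lia.
move=> m8 t8 h10 h8'; do 5 jdet; apply: H; split.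
- by rewrite /upd /= h8'// /upd /= h7'// /upd /= h6// /upd /= h5// /upd /= a4.
- by rewrite /upd /= h8'// /upd /= h7'// /upd /= h6// /upd /= h5// /upd /= a1.
- by rewrite /upd /= h8'// /upd /= h7'// /upd /= h6// /upd /= h5// /upd /= a16; lia.
- by rewrite /upd /= h8'// /upd /= h7'// /upd /= h6// /upd /= h7.
- by rewrite /upd /= h8'// /upd /= h7'// /upd /= h8.
- by rewrite /upd /= h8'// /upd /= h9.
- rewrite /upd /= h10; congr (_ * _)%N; rewrite /= ?upd_eq.
  by rewrite /= h7'// /upd /= h6// /upd /= h5// /upd /= h17; lia.
- by rewrite /upd.
- by rewrite /upd.
Qed.

End parameters.


Section arithmetic.
Context {R : realType}.
Implicit Types (b s eps m : R).

(** Stated for a variable base in place of 2, so that [field] handles the large powers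
    symbolically. *)
Lemma err_scale b s : b != 0 -> s != 0 ->
  b * s * (b * (b ^+ 16 * s ^+ 4) ^+ 2 / (b ^+ 52 * s ^+ 10)) = (b ^+ 18)^-1 * s^-1.
Proof. by move=> b0 s0; field; rewrite b0 s0. Qed.

Lemma try_scale b s : b != 0 -> s != 0 ->
  s * (b * s / (b ^+ 19 * s ^+ 3)) = (b ^+ 18)^-1 * s^-1.
Proof. by move=> b0 s0; field; rewrite b0 s0. Qed.

Lemma zeta_scale b s : b != 0 -> s != 0 ->
  b * (b ^+ 56 * s ^+ 11)^-1 * (b ^+ 19 * s ^+ 5) ^+ 2 = (b ^+ 17)^-1 * s^-1.
Proof. by move=> b0 s0; field; rewrite b0 s0. Qed.

Lemma energy_scale b s : b != 0 -> s != 0 ->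
  (b ^+ 56 * s ^+ 11)^-1 * (b * s * (b ^+ 52 * s ^+ 10)) = (b ^+ 3)^-1.
Proof. by move=> b0 s0; field; rewrite b0 s0. Qed.

Lemma round_scale b s eps l : b != 0 -> s != 0 ->
  (b ^+ 56 * s ^+ 11)^-1 * eps * (l * (b ^+ 67 * s ^+ 12)) = b ^+ 11 * l * (s * eps).
Proof. by move=> b0 s0; field; rewrite b0 s0. Qed.

Lemma half_pow b k : b != 0 -> b * (b ^+ k.+1)^-1 = (b ^+ k)^-1.
Proof. by move=> b0; rewrite exprS invfM mulrA divff// mul1r. Qed.

Let two0 : (2 : R) != 0. Proof. by rewrite pnatr_eq0. Qed.
Let p0 k : 0 < 2 ^+ k :> R. Proof. by apply: exprn_gt0; lra. Qed.
Let p1 k : 1 <= 2 ^+ k :> R. Proof. by apply: exprn_ege1; lra. Qed.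

(** 2^17 = 131072 exceeds 125 * 1000, the denominators of gam and of its error budget; in
    [params_err] two errors of size 2^-18 / s add up to this bound. *)
Lemma pow17 : (2 ^+ 17)^-1 <= 125^-1 / 1000 :> R.
Proof.
rewrite -invfM lef_pV2; [lra | rewrite posrE; exact: p0 | rewrite posrE; lra].
Qed.

Lemma inv_le_eps s eps : 1 <= s -> 1 <= s * eps -> s^-1 <= eps.
Proof. by move=> s1 h; rewrite -[s^-1]mul1r ler_pdivrMr 1?mulrC//; lra. Qed.

(* The parameters are passed as variables tied by equations, so that no tactic
   unfolds the large powers of two. *)
Lemma params_err s eps m W Q r : 1 <= s -> 1 <= s * eps -> 0 <= m <= s ->
  W = 2 ^+ 16 * s ^+ 4 -> Q = 2 ^+ 52 * s ^+ 10 -> r = 2 ^+ 19 * s ^+ 3 ->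
  (s + 1) * (2 * W ^+ 2 / Q) + m * ((s + 1) / r) <= eps / 125 / 1000.
Proof.
move=> s1 se /andP[m0 ms] EW EQ Er; have ie := inv_le_eps s1 se.
have s0 : 0 < s by lra. have sn0 : s != 0 by rewrite gt_eqF.
have i0 : 0 < s^-1 by rewrite invr_gt0.
have W0 : 0 < W by rewrite EW; apply: mulr_gt0; [exact: p0 | exact: exprn_gt0].
have Q0 : 0 < Q by rewrite EQ; apply: mulr_gt0; [exact: p0 | exact: exprn_gt0].
have r0 : 0 < r by rewrite Er; apply: mulr_gt0; [exact: p0 | exact: exprn_gt0].
have E1 : 2 * s * (2 * W ^+ 2 / Q) = (2 ^+ 18)^-1 * s^-1 by rewrite EW EQ; exact: err_scale.
have E2 : s * (2 * s / r) = (2 ^+ 18)^-1 * s^-1 by rewrite Er; exact: try_scale.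
have P := pow17; rewrite -(half_pow 17 two0) in P.
clear EW EQ Er; move: ((2 ^+ 18)^-1 : R) E1 E2 P => c E1 E2 P.
have e0 : 0 <= 2 * W ^+ 2 / Q.
  by apply: divr_ge0; [apply: mulr_ge0 => //; exact: sqr_ge0 | exact: ltW].
have h1 : (s + 1) * (2 * W ^+ 2 / Q) <= 2 * s * (2 * W ^+ 2 / Q) by apply: ler_wpM2r => //; lra.
have h2 : m * ((s + 1) / r) <= s * (2 * s / r).
  apply: ler_pM => //; first by apply: divr_ge0; lra.
  by rewrite ler_pM2r ?invr_gt0//; lra.
rewrite E1 in h1; rewrite E2 in h2.
have h3 := ler_wpM2r (ltW i0) P; have p : 0 <= (125^-1 / 1000 : R) by lra.
have h4 := ler_wpM2l p ie; move: h1 h2 h3 h4.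
move: (_ * (2 * W ^+ 2 / Q)) (m * _) => x y; lra.
Qed.

Lemma params_ka s eps m ka : 1 <= s -> 1 <= s * eps -> 0 <= m <= s ->
  ka = 2 ^+ 15 * s ^+ 3 -> m ^+ 2 <= ka * (eps / 125) / 250.
Proof.
move=> s1 se /andP[m0 ms] Ek.
have h : m ^+ 2 <= s ^+ 2 by apply: lerXn2r => //; rewrite nnegrE; lra.
apply: (le_trans h).
have h2 : s ^+ 2 * (s * eps) = s ^+ 3 * eps by rewrite [s ^+ 3]exprSr mulrA.
have h4 : 0 <= s ^+ 2 by exact: sqr_ge0.
have h3 : s ^+ 2 <= s ^+ 2 * (s * eps) by exact: ler_peMr.
rewrite h2 in h3; have hp : 125 * 250 <= 2 ^+ 15 :> R by lra.
have E : ka * eps = 2 ^+ 15 * (s ^+ 3 * eps) by rewrite Ek mulrA.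
clear Ek h2 h; move: (s ^+ 2) (s ^+ 3 * eps) (2 ^+ 15 : R) hp E h3 h4 => x y p hp E h3 h4.
have : 125 * 250 * x <= p * y by apply: ler_pM => //; lra.
lra.
Qed.

Lemma params_zeta s eps W Q C1 zeta : 1 <= s -> 1 <= s * eps -> eps < 1 ->
  W = 2 ^+ 16 * s ^+ 4 -> Q = 2 ^+ 52 * s ^+ 10 -> zeta = (2 ^+ 56 * s ^+ 11)^-1 ->
  C1 = 2 * W * (s + 1) + (s + 1) * (2 * W ^+ 2 / Q) ->
  zeta * C1 <= 1 / 100 /\ 2 * zeta * C1 ^+ 2 <= eps / 125 / 1000.
Proof.
move=> s1 se e1 EW EQ Ez EC; have ie := inv_le_eps s1 se.
have s0 : 0 < s by lra. have sn0 : s != 0 by rewrite gt_eqF.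
have i0 : 0 < s^-1 by rewrite invr_gt0.
have W0 : 1 <= W by rewrite EW; apply: mulr_ege1; [exact: p1 | exact: exprn_ege1].
have Q0 : 0 < Q by rewrite EQ; apply: mulr_gt0; [exact: p0 | exact: exprn_gt0].
have z0 : 0 < zeta by rewrite Ez invr_gt0; apply: mulr_gt0; [exact: p0 | exact: exprn_gt0].
have e0 : 0 <= (s + 1) * (2 * W ^+ 2 / Q).
  apply: mulr_ge0; first by lra.
  by apply: divr_ge0; [apply: mulr_ge0 => //; exact: sqr_ge0 | exact: ltW].
have h0 : (s + 1) * (2 * W ^+ 2 / Q) <= 1.
  have h00 : 0 <= (0 : R) <= s by rewrite lexx ltW.
  by have := params_err s1 se h00 EW EQ erefl; rewrite mul0r addr0; lra.
have hC1 : 1 <= C1.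
  have : 1 * 1 <= W * (s + 1) by apply: ler_pM => //; lra.
  by rewrite EC -mulrA; lra.
have hC2 : C1 <= 2 ^+ 19 * s ^+ 5.
  have hW : W * (s + 1) <= W * (2 * s) by apply: ler_wpM2l; lra.
  have E5 : W * (2 * s) = 2 ^+ 17 * s ^+ 5.
    by rewrite EW [2 ^+ 17]exprS [s ^+ 5]exprS; move: (2 ^+ 16 : R) (s ^+ 4) => x y; ring.
  have h5 : 1 <= 2 ^+ 17 * s ^+ 5 by apply: mulr_ege1; [exact: p1 | exact: exprn_ege1].
  have E19 : 2 ^+ 19 * s ^+ 5 = 2 * (2 * (2 ^+ 17 * s ^+ 5)) by rewrite 2!exprS !mulrA.
  rewrite E19 EC; rewrite E5 in hW; move: hW h5 h0.
  move: (2 ^+ 17 * s ^+ 5) ((s + 1) * (2 * W ^+ 2 / Q)) => x y.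
  by rewrite -mulrA; move: (W * (s + 1)) => w; lra.
have hz2 : 2 * zeta * C1 ^+ 2 <= eps / 125 / 1000.
  have hsq : C1 ^+ 2 <= (2 ^+ 19 * s ^+ 5) ^+ 2.
    by apply: lerXn2r => //; rewrite nnegrE; apply: (le_trans _ hC2) || idtac; lra.
  have z20 : 0 <= 2 * zeta by lra.
  apply: (le_trans (ler_wpM2l z20 hsq)).
  rewrite Ez (zeta_scale two0 sn0).
  have h3 := ler_wpM2r (ltW i0) pow17; have p : 0 <= (125^-1 / 1000 : R) by lra.
  have h4 := ler_wpM2l p ie; move: h3 h4; move: ((2 ^+ 17)^-1 : R) => c; lra.
split => //.
have : zeta * (1 * C1) <= zeta * (C1 ^+ 2).
  by apply: ler_wpM2l; [exact: ltW | rewrite expr2; apply: ler_wpM2r => //; lra].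
rewrite mul1r; lra.
Qed.

Lemma zeta_energy s Q zeta : 1 <= s -> Q = 2 ^+ 52 * s ^+ 10 ->
  zeta = (2 ^+ 56 * s ^+ 11)^-1 -> zeta * ((s + 1) * Q) <= 1.
Proof.
move=> s1 EQ Ez; have s0 : 0 < s by lra. have sn0 : s != 0 by rewrite gt_eqF.
have z0 : 0 < zeta by rewrite Ez invr_gt0; apply: mulr_gt0; [exact: p0 | exact: exprn_gt0].
have Q0 : 0 < Q by rewrite EQ; apply: mulr_gt0; [exact: p0 | exact: exprn_gt0].
have E : zeta * (2 * s * Q) = (2 ^+ 3)^-1 by rewrite EQ Ez; exact: energy_scale.
apply: (@le_trans _ _ (zeta * (2 * s * Q))).
  by apply: ler_wpM2l; [exact: ltW | apply: ler_wpM2r; [exact: ltW | lra]].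
by rewrite E invf_le1; [exact: p1 | exact: p0].
Qed.

(** The number of rounds exceeds 1 / zeta by the factor 2^11 l s, where 2^11 >= 16 * 125. *)
Lemma mu_rounds s eps l zeta t : 1 <= s -> 1 <= s * eps -> 0 <= l ->
  zeta = (2 ^+ 56 * s ^+ 11)^-1 -> t = l * (2 ^+ 67 * s ^+ 12) ->
  16 * l <= zeta * (eps / 125) * t.
Proof.
move=> s1 se l0 Ez Et; have s0 : 0 < s by lra. have sn0 : s != 0 by rewrite gt_eqF.
have E : zeta * eps * t = 2 ^+ 11 * l * (s * eps) by rewrite Ez Et; exact: round_scale.
have h : 16 * 125 <= (2 ^+ 11 : R) by lra.
have h1 := ler_wpM2r l0 h.
have h2 : 2 ^+ 11 * l <= 2 ^+ 11 * l * (s * eps).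
  by apply: ler_peMr => //; apply: mulr_ge0 => //; exact: ltW.
clear Ez Et; move: (2 ^+ 11 : R) E h1 h2 => p E h1 h2; rewrite -E in h2.
have -> : zeta * (eps / 125) * t = zeta * eps * t / 125 by rewrite mulrA mulrAC.
lra.
Qed.

Lemma zeta_le1 s zeta : 1 <= s -> zeta = (2 ^+ 56 * s ^+ 11)^-1 -> 0 < zeta <= 1.
Proof.
move=> s1 ->; have h : 1 <= 2 ^+ 56 * s ^+ 11.
  by apply: mulr_ege1; [exact: p1 | exact: exprn_ege1].
move: (2 ^+ 56 * s ^+ 11) h => x h; have x0 : 0 < x by lra.
by rewrite invr_gt0 x0 invf_le1.
Qed.

(** The allowed growth over 6 T6 rounds is at most exp(3/4 mu T6), and the threshold (1 + mu)^T6 is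
    at least exp(15/16 mu T6). The margin of 3/16 mu T6 pays for the initial energy and for
    ln(1/delta). *)
Lemma tail_le (mu e dl : R) (T6 : nat) : 0 < mu <= 1 / 32 -> e <= 1 -> 0 < dl ->
  1 + ln dl^-1 <= 3 / 16 * mu * T6%:R ->
  ((1 + mu) ^+ T6)^-1 * (1 + mu / 8) ^+ (6 * T6) * expR e <= dl.
Proof.
move=> /andP[mu0 mu1] e1 dl0 h.
have h1 : (1 + mu / 8) ^+ (6 * T6) <= expR (mu / 8 * (6 * T6)%:R).
  rewrite expRM_natr; apply: lerXn2r; rewrite ?nnegrE ?expR_ge0//; first by lra.
  exact: expR_ge1Dx.
have h2 : expR (15 / 16 * mu * T6%:R) <= (1 + mu) ^+ T6.
  rewrite expRM_natr; have h3 : expR (15 / 16 * mu) <= 1 + mu.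
    apply: (@le_trans _ _ (1 + 15 / 16 * mu + 2 * (15 / 16 * mu) ^+ 2)).
      by apply: expR_le1DxDx2; rewrite ger0_norm; lra.
    by rewrite expr2; nra.
  by apply: lerXn2r => //; rewrite nnegrE ?expR_ge0//; lra.
have q0 : 0 < (1 + mu) ^+ T6 by apply: exprn_gt0; lra.
apply: (@le_trans _ _ (expR (- (15 / 16 * mu * T6%:R)) * expR (mu / 8 * (6 * T6)%:R) * expR 1)).
  apply: ler_pM; [| exact: expR_ge0 | | by rewrite ler_expR].
    by apply: mulr_ge0; [rewrite invr_ge0 ltW | apply: exprn_ge0; lra].
  apply: ler_pM => //; [by rewrite invr_ge0 ltW | by apply: exprn_ge0; lra |].
  by rewrite expRN lef_pV2 ?posrE ?expR_gt0.
rewrite -!expRD; apply: (@le_trans _ _ (expR (- ln dl^-1))).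
  by rewrite ler_expR natrM; lra.
by rewrite expRN lnK ?posrE ?invr_gt0// invrK.
Qed.

End arithmetic.


Lemma ceiln_itv (R : realType) (x : R) : 0 < x -> x <= (ceiln x)%:R <= x + 1.
Proof.
move=> x0; rewrite /ceiln natr_absz ger0_norm; last by rewrite ceil_ge0; lra.
by have := ceil_itv x; rewrite rmorphB rmorph1 => /andP[? ?]; apply/andP; split; lra.
Qed.

Lemma inv_le_trans (R : realType) (x y e : R) : 0 < x -> x <= y -> x^-1 <= e -> y^-1 <= e.
Proof.
move=> x0 xy; apply: le_trans; rewrite lef_pV2 ?posrE//; exact: lt_le_trans xy.
Qed.

Lemma pow_ge j a b : (0 < b)%N -> (2 ^ j <= 2 ^ (a + b * j))%N.
Proof.
by move=> b0; rewrite leq_pexp2l// (leq_trans (leq_pmull j b0))// leq_addl.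
Qed.

Lemma pow_le j a b a' b' : (a <= a')%N -> (b <= b')%N -> (2 ^ (a + b * j) <= 2 ^ (a' + b' * j))%N.
Proof. by move=> ha hb; rewrite leq_pexp2l// leq_add// leq_mul2r hb orbT. Qed.

Lemma pow_mul j a b : (2 ^ (a + b * j) * 2 ^ j = 2 ^ (a + b.+1 * j))%N.
Proof. by rewrite -expnD -addnA mulSn [(j + _)%N]addnC. Qed.

Lemma tail_arith (R : realType) (y l x : R) : 0 <= x -> l <= x -> 16 * (x + 1) <= y ->
  1 + l <= 3 / 16 * y.
Proof. lra. Qed.

(** * The learning phase with its parameters instantiated *)

Section learn.
Context {R : realType} {d : measure_display} {X : measurableType d}.
Variables (C : set (concept X)) (A : learner R X) (T : nat) (f : concept X) (eps delta : R).
Variables (Dtrain Dtest : probability X R).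
Hypothesis mf : measurable_fun setT f.
Hypotheses (tds : TDS_learner C A eps (1 / 100)) (Cf : C f).
Hypotheses (eps01 : 0 < eps < 1) (dl01 : 0 < delta < 1).

Variables j L : nat.
Hypothesis jE : j = up_log 2 (ntrain A + ntest A + ceiln eps^-1 + 1).
Hypothesis LE : L = up_log 2 (ceiln delta^-1).
Let kb := (52 + 10 * j)%N.
Let r0 := (2 ^ (19 + 3 * j)).-1.
Let W := (2 ^ (16 + 4 * j))%N.
Let ka := (2 ^ (15 + 3 * j))%N.
Let T6 := ((L + 1) * 2 ^ (67 + 12 * j))%N.
Let s : R := (2 ^ j)%:R.
Let zeta : R := (2 ^+ 56 * s ^+ 11)^-1.

Let jP : (ntrain A + ntest A + ceiln eps^-1 + 1 <= 2 ^ j)%N.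
Proof. by rewrite jE; exact: up_logP. Qed.

Lemma powE a b : (2 ^ (a + b * j))%:R = 2 ^+ a * s ^+ b :> R.
Proof. by rewrite natrX exprD /s natrX -exprM (mulnC j). Qed.

Let s1 : 1 <= s. Proof. by rewrite /s ler1n expn_gt0. Qed.

Let se : 1 <= s * eps.
Proof.
case/andP: eps01 => e0 _; have ei : 0 < eps^-1 by rewrite invr_gt0.
have /andP[h _] := ceiln_itv ei.
have h2 : eps^-1 <= s by apply: (le_trans h); rewrite /s ler_nat; lia.
have E : eps^-1 * eps = 1 by rewrite mulVf// gt_eqF.
by rewrite -[leLHS]E; apply: ler_wpM2r => //; exact: ltW.
Qed.

Let ms : (0 : R) <= (ntest A)%:R <= s.
Proof. by rewrite ler0n /s ler_nat; lia. Qed.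

Let r0E : r0.+1 = (2 ^ (19 + 3 * j))%N.
Proof. by rewrite /r0 prednK// expn_gt0. Qed.

Let log_delta : ln delta^-1 <= L%:R.
Proof.
case/andP: dl01 => dl0 _; have di : 0 < delta^-1 by rewrite invr_gt0.
have h1 : delta^-1 <= expR L%:R.
  have /andP[h _] := ceiln_itv di; apply: (le_trans h).
  apply: (@le_trans _ _ (2 ^+ L)); first by rewrite -natrX ler_nat LE; exact: up_logP.
  rewrite -[L%:R]mul1r expRM_natr; apply: lerXn2r; rewrite ?nnegrE ?expR_ge0//.
  by have := expR_ge1Dx (1 : R); lra.
by rewrite -[leRHS]expRK ler_ln// posrE expR_gt0.
Qed.

Let mj : (ntest A + 1 <= 2 ^ j)%N.
Proof. by lia. Qed.

Let W_ge (a : nat) : (a <= 2 ^ (15 + 4 * j))%N -> (a + ntest A <= W)%N.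
Proof.
move=> h; have -> : W = (2 ^ (15 + 4 * j) + 2 ^ (15 + 4 * j))%N.
  by rewrite addnn -mul2n -expnS.
apply: leq_add => //; apply: (@leq_trans (2 ^ j)); last exact: pow_ge.
by apply: leq_trans mj; exact: leq_addr.
Qed.

Let mu : R := zeta * (eps / 125).
Let Cn : R := ((1 + mu) ^+ T6)^-1.

Lemma mu_itv : 0 < mu <= 1 / 32.
Proof.
case/andP: eps01 => e0 e1; have /andP[z0 z1] := zeta_le1 s1 (erefl zeta).
rewrite /mu; move: zeta z0 z1 => z z0 z1; have h : 0 < eps / 125 by lra.
rewrite mulr_gt0//=; have : z * (eps / 125) <= 1 * (eps / 125) by apply: ler_wpM2r => //; exact: ltW.
lra.
Qed.

Lemma Cn_ge0 : 0 <= Cn.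
Proof.
by case/andP: mu_itv => mu0 _; rewrite invr_ge0; apply: exprn_ge0; move: mu mu0 => x; lra.
Qed.

Lemma natr_W : W%:R = 2 ^+ 16 * s ^+ 4 :> R. Proof. exact: powE. Qed.
Lemma natr_Q : 2 ^+ kb = 2 ^+ 52 * s ^+ 10 :> R. Proof. by rewrite -powE natrX. Qed.
Lemma natr_r : (r0.+1)%:R = 2 ^+ 19 * s ^+ 3 :> R. Proof. by rewrite r0E powE. Qed.
Lemma natr_ka : ka%:R = 2 ^+ 15 * s ^+ 3 :> R. Proof. exact: powE. Qed.
Lemma natr_T6 : T6%:R = (L%:R + 1) * (2 ^+ 67 * s ^+ 12) :> R.
Proof. by rewrite /T6 natrM natrD powE. Qed.

Lemma tries_eps : (r0.+1)%:R^-1 <= eps.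
Proof.
have h : (2 ^ j <= r0.+1)%N by rewrite r0E; exact: pow_ge.
have h' : s <= (r0.+1)%:R by rewrite /s ler_nat.
exact: (inv_le_trans (lt_le_trans ltr01 s1) h' (inv_le_eps s1 se)).
Qed.

Lemma round_bound_Phi t (rs : seq (rnd A)) :
  round_bound Dtrain Dtest mf kb r0 W ka (2 ^ (15 + 4 * j)) rs
    (fun r => Phi f eps Dtrain Dtest kb (2 ^ j) zeta Cn t (rcons rs r))
    (Phi f eps Dtrain Dtest kb (2 ^ j) zeta Cn t.+1 rs).
Proof.
have /andP[z0 _] := zeta_le1 s1 (erefl zeta); have /andP[_ e1] := eps01.
have hE := params_err s1 se ms natr_W natr_Q natr_r.
have [hz1 hz2] := params_zeta s1 se e1 natr_W natr_Q (erefl zeta) erefl.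
have mka : (ntest A + 1 <= ka)%N by apply: (leq_trans mj); exact: pow_ge.
have kl : (ka * 2 ^ j = 2 ^ (15 + 4 * j))%N by exact: pow_mul.
rewrite -kl.
exact: (Phi_round Dtrain Dtest mf tds Cf eps01 se tries_eps z0 hz1 hz2 hE mka
  (params_ka s1 se ms natr_ka) t rs Cn_ge0).
Qed.

Lemma Phi_start : Phi f eps Dtrain Dtest kb (2 ^ j) zeta Cn (6 * T6) ([::] : seq (rnd A)) <= delta.
Proof.
case/andP: (dl01) => dl0 _.
rewrite /Phi /= expr0 mulr1 energy0 -/s -/mu; apply: (tail_le mu_itv) => //.
  exact: zeta_energy s1 natr_Q erefl.
have L0 : 0 <= L%:R :> R by [].
have l0 : 0 <= L%:R + 1 :> R by exact: addr_ge0.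
rewrite -mulrA; exact: (tail_arith L0 log_delta (mu_rounds s1 se l0 (erefl zeta) natr_T6)).
Qed.

Lemma Phi_end (rs : seq (rnd A)) : 0 <= Phi f eps Dtrain Dtest kb (2 ^ j) zeta Cn 0 rs /\
  ((T6 < nbad f eps Dtrain Dtest kb [::] rs)%N -> 1 <= Phi f eps Dtrain Dtest kb (2 ^ j) zeta Cn 0 rs).
Proof.
have /andP[z0 _] := zeta_le1 s1 (erefl zeta); have /andP[m0 _] := mu_itv.
have ez : 0 <= zeta * energy f Dtrain Dtest kb (2 ^ j) rs.
  by apply: mulr_ge0; [exact: ltW | exact: energy_ge0].
have m1 : 1 <= 1 + mu by rewrite lerDl ltW.
have mp : 0 < 1 + mu by exact: lt_le_trans m1.
have ee : 1 <= expR (zeta * energy f Dtrain Dtest kb (2 ^ j) rs) by rewrite -expR0 ler_expR.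
rewrite /Phi expr0 mulr1 -/mu; move: (nbad _ _ _ _ _ _ _) (expR _) ee => nb e ee; split.
  apply: mulr_ge0; last exact: le_trans ee.
  by apply: mulr_ge0; [exact: Cn_ge0 | apply: exprn_ge0; exact: ltW].
move=> hb; apply: mulr_ege1 => //; rewrite /Cn mulrC ler_pdivlMr ?mul1r ?exprn_gt0//.
by apply: ler_weXn2l => //; exact: ltnW.
Qed.

Lemma J_learn (G : store X -> Prop) :
  (forall st (rs : seq (rnd A)), Rep f kb r0 W st rs -> size rs = (6 * T6)%N -> mem st 10 = (6 * T6)%N ->
    (nbad f eps Dtrain Dtest kb [::] rs <= T6)%N -> ~ G st) ->
  J A T f Dtrain Dtest
    (fun st => exists rs : seq (rnd A),
      [/\ Rep f kb r0 W st rs, size rs = (6 * T6)%N & mem st 10 = (6 * T6)%N]) G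
    (learning_cost j L + (6 * T6 * (round_cost A kb r0 W (6 * T6) + 1) + 1 + 1))
    ([:: learning], init_store A eps delta) delta.
Proof.
move=> HG; have T10 : (6 * (L + 1) * 2 ^ (67 + 12 * j) = 6 * T6)%N by rewrite /T6 mulnA.
pose m0 := nth 0%N [:: ntrain A; ntest A; ceiln eps^-1; ceiln delta^-1].
apply: (J_weak (v := Phi f eps Dtrain Dtest kb (2 ^ j) zeta Cn (6 * T6) ([::] : seq (rnd A))) _ (leqnn _) Phi_start).
rewrite {1}LE {1}jE; apply: (J_learning (m0 := m0)) => // m' t'; rewrite -[up_log 2 (m0 3%N)]LE -[up_log 2 (m0 0%N + m0 1%N + m0 2%N + 1)%N]jE => -[h4 h1 h6 h7 h8] [h9 h10 h12 h13].
apply: (J_rounds (mf := mf) (W := W) (kb := kb) (r0 := r0) (ka := ka) (kl := (2 ^ (15 + 4 * j))%N)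
  (Tt := (6 * T6)%N) (rs := [::])
  (Phi := fun t rs => Phi f eps Dtrain Dtest kb (2 ^ j) zeta Cn t rs)) => //.
- by apply: W_ge; exact: pow_le.
- exact: W_ge.
- exact: round_bound_Phi.
- by split => //; rewrite /= h7 r0E.
- by rewrite /= h13 h10 T10.
case=> m2 ps2 hs2 tr2 te2 nc2 nd2 t2 rs' rep' sz' hm.
have m10 : m2 10%N = (6 * T6)%N by have /= -> := hm 10%N isT; rewrite h10 T10.
jdet; set st := Store _ _ _ _ _ _ _ _.
have rep2 : Rep f kb r0 W st rs'.
  apply: (Rep_ext _ _ _ rep') => //; last exact: (rep_clean rep').
  by split; exists [::]; rewrite cats0.
have [p0 p1] := Phi_end rs'; apply: J_halt => //; first by exists rs'.
move=> Gs; apply: p1; rewrite ltnNge; apply/negP => hb.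
exact: (HG st rs' rep2 sz' m10 hb).
Qed.

End learn.

(** * Polynomial bounds on the resources *)

Record inst := Inst {
  i_R : realType; i_d : measure_display; i_X : measurableType i_d; i_A : learner i_R i_X;
  i_v : nat -> nat;
  i_ok : [/\ (256 <= i_v 0)%N, (ntrain i_A <= i_v 0)%N, (ntest i_A <= i_v 0)%N
    & forall i, (i_v i <= i_v 0)%N] }.

(** Packing the space, the learner and the parameters into [inst] makes the exponent uniform over
    all of them. The entry [i_v p 0] dominates all other quantities and the numerical constants up
    to 256. *)
Definition poly_bounded (F : inst -> nat) := exists k, forall p, (F p <= i_v p 0 ^ k)%N.

Section poly.
Implicit Types F : inst -> nat.

Let Z2 p : (1 < i_v p 0)%N. Proof. by have [h _ _ _] := i_ok p; apply: leq_trans h. Qed.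

Lemma pbD F1 F2 : poly_bounded F1 -> poly_bounded F2 -> poly_bounded (fun p => F1 p + F2 p)%N.
Proof.
move=> [k1 h1] [k2 h2]; exists (k1 + k2).+1 => p; have z2 := Z2 p.
have e1 : (i_v p 0 ^ k1 <= i_v p 0 ^ (k1 + k2))%N by rewrite leq_pexp2l ?leq_addr//; lia.
have e2 : (i_v p 0 ^ k2 <= i_v p 0 ^ (k1 + k2))%N by rewrite leq_pexp2l ?leq_addl//; lia.
rewrite expnS; move: (h1 p) (h2 p) (i_v p 0 ^ (k1 + k2))%N e1 e2 => a1 a2 z e1 e2; nia.
Qed.

Lemma pbM F1 F2 : poly_bounded F1 -> poly_bounded F2 -> poly_bounded (fun p => F1 p * F2 p)%N.
Proof. by move=> [k1 h1] [k2 h2]; exists (k1 + k2)%N => p; rewrite expnD leq_mul. Qed.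

Lemma pbV i : poly_bounded (fun p => i_v p i).
Proof. by exists 1%N => p; rewrite expn1; have [_ _ _] := i_ok p. Qed.

Lemma pbn : poly_bounded (fun p => ntrain (i_A p)).
Proof. by exists 1%N => p; rewrite expn1; have [_] := i_ok p. Qed.

Lemma pbm : poly_bounded (fun p => ntest (i_A p)).
Proof. by exists 1%N => p; rewrite expn1; have [_ _] := i_ok p. Qed.

Lemma pbC c : (c <= 256)%N -> poly_bounded (fun=> c).
Proof. by move=> h; exists 1%N => p; rewrite expn1; have [h2 _ _ _] := i_ok p; exact: leq_trans h2. Qed.

Lemma pbS F : poly_bounded F -> poly_bounded (fun p => (F p).+1).
Proof.
move=> h; have [k hk] := pbD h (pbC (isT : 1 <= 256)%N).
by exists k => p; have := hk p; rewrite addn1.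
Qed.

End poly.

(** Learning, vote and selector are offered noise of one common length, so the sum of their step
    bounds is taken. *)
Definition total_cost {R : realType} {d : measure_display} {X : measurableType d} (A : learner R X)
    (j L kb r0 W t : nat) :=
  (learning_cost j L + (t * (round_cost A kb r0 W t + 1) + 1 + 1) +
   (t * 8 + 11) + select_cost A kb W t)%N.

Lemma total_cost_poly : poly_bounded (fun p =>
  total_cost (i_A p) (i_v p 1) (i_v p 2) (i_v p 3) (i_v p 4) (i_v p 5) (i_v p 6)).
Proof.
rewrite /total_cost /learning_cost /round_cost /select_cost /record_sample_cost /many_cost
  /sample_cost /try_cost /toss_cost /evalv_cost /coin_cost /update_cost /record_cost /hybrid_cost.
repeat first [exact: pbn | exact: pbm | exact: pbV | (apply: pbC; exact: isT) |
  apply: pbD | apply: pbM | apply: pbS].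
Qed.

Section size_bounds.
Context {R : realType}.
Implicit Types (Y eps delta : R).

Lemma log_size (k : nat) Y (x : nat) : k = up_log 2 x -> x%:R <= 2 * Y -> 1 <= Y ->
  (2 ^ k)%:R <= 4 * Y.
Proof.
move=> -> hx Y1; case: (leqP x 1) => x1.
  have -> : up_log 2 x = 0%N by case: x x1 {hx} => [|[|x]].
  by rewrite expn0; lra.
have /andP[h _] := up_log_bounds (isT : 1 < 2)%N x1.
have k0 : (0 < up_log 2 x)%N by rewrite up_log_gt0.
have : (2 ^ up_log 2 x <= 2 * x)%N.
  by rewrite -(prednK k0) expnS leq_mul2l /= ltnW.
by rewrite -(ler_nat R) natrM => hh; apply: (le_trans hh); lra.
Qed.

(** If L is positive, 2^(L-1) is below the ceiling of 1/delta, hence at most 2/delta <= exp(1 +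
    ln(1/delta)); comparing with exp((L-1)/2) <= 2^(L-1) avoids any estimate of ln 2. *)
Lemma log_delta_size delta : 0 < delta < 1 ->
  (up_log 2 (ceiln delta^-1))%:R <= 3 + 2 * ln delta^-1.
Proof.
move=> /andP[dl0 dl1]; have di : 1 <= delta^-1 by rewrite invf_ge1// ltW.
have ln0 : 0 <= ln delta^-1 by exact: ln_ge0.
have [_ h] := andP (ceiln_itv (lt_le_trans ltr01 di)).
set x := ceiln _ in h *; case: (leqP x 1) => x1.
  have -> : up_log 2 x = 0%N by case: x x1 {h} => [|[|x]].
  by lra.
have /andP[hx _] := up_log_bounds (isT : 1 < 2)%N x1.
set k := up_log 2 x in hx *; have k0 : (0 < k)%N by rewrite up_log_gt0.
have h1 : expR (2^-1 * k.-1%:R) <= (2 * delta^-1 : R).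
  rewrite expRM_natr; apply: (@le_trans _ _ (2 ^+ k.-1)).
    apply: lerXn2r; rewrite ?nnegrE ?expR_ge0//.
    apply: (@le_trans _ _ (1 + 2^-1 + 2 * (2^-1) ^+ 2)); last by rewrite expr2; lra.
    by apply: expR_le1DxDx2; rewrite ger0_norm//; lra.
  rewrite -natrX; apply: (@le_trans _ _ x%:R); first by rewrite ler_nat ltnW.
  by apply: (le_trans h); lra.
have h2 : 2 * delta^-1 <= expR (1 + ln delta^-1).
  rewrite expRD lnK ?posrE; last by lra.
  by apply: ler_wpM2r; [lra | have := expR_ge1Dx (1 : R); lra].
have Ek : k%:R = k.-1%:R + 1 :> R by rewrite natr1 prednK.
by have := le_trans h1 h2; rewrite ler_expR Ek; lra.
Qed.

End size_bounds.

(** Thirteen factors are bounded by 4 Y, twelve from s and one from l, and 96 = 70 + 2 * 13. *)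
Lemma size_bound (R : realType) (Y s l Z : R) : 1 <= Y -> 1 <= s <= 4 * Y -> 0 <= l <= 4 * Y ->
  Z = l * (2 ^+ 70 * s ^+ 12) -> Z <= 2 ^+ 96 * Y ^+ 13.
Proof.
move=> Y1 /andP[s1 s4] /andP[l0 l4] ->.
have h : s ^+ 12 <= (4 * Y) ^+ 12 by apply: lerXn2r => //; rewrite nnegrE; lra.
have p0 : 0 <= 2 ^+ 70 :> R by apply: exprn_ge0.
have s0 : 0 <= s ^+ 12 by apply: exprn_ge0; lra.
have h2 := ler_pM l0 (mulr_ge0 p0 s0) l4 (ler_wpM2l p0 h).
apply: (le_trans h2); rewrite le_eqVlt; apply/orP; left; apply/eqP.
have -> : (4 : R) = 2 ^+ 2 by rewrite expr2; lra.
move: (2 : R) => b; ring.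
Qed.

Lemma cost_bound (R : realType) (Z N k : nat) (Y : R) : (N <= Z ^ k)%N -> 0 <= Y ->
  Z%:R <= 2 ^+ 96 * Y ^+ 13 ->
  (N * 2)%:R <= (2 * (2 ^ 96) ^ k)%N%:R * Y ^+ (13 * k).
Proof.
move=> NZ Y0 hZ; apply: (@le_trans _ _ ((Z ^ k) * 2)%:R); first by rewrite ler_nat leq_mul2r NZ orbT.
rewrite natrM [in leRHS]natrM !natrX mulrC -mulrA; apply: ler_wpM2l => //.
rewrite (exprM Y) -exprMn; apply: lerXn2r => //; rewrite nnegrE//.
by apply: mulr_ge0; apply: exprn_ge0.
Qed.

Section sizes.
Context {R : realType} {d : measure_display} {X : measurableType d}.
Variables (A : learner R X) (eps delta : R) (j L : nat).
Hypotheses (eps01 : 0 < eps < 1) (dl01 : 0 < delta < 1).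
Hypothesis jE : j = up_log 2 (ntrain A + ntest A + ceiln eps^-1 + 1).
Hypothesis LE : L = up_log 2 (ceiln delta^-1).

(** Chosen to dominate the number of rounds, 6 (L + 1) 2^(67 + 12 j), through 6 <= 2^3; all other
    parameters are below it as well. *)
Definition size_param := ((L + 1) * 2 ^ (70 + 12 * j))%N.

Let kb := (52 + 10 * j)%N.
Let r0 := (2 ^ (19 + 3 * j)).-1.
Let W := (2 ^ (16 + 4 * j))%N.
Let T6 := ((L + 1) * 2 ^ (67 + 12 * j))%N.

Let pow_size a b : (a <= 70)%N -> (b <= 12)%N -> (2 ^ (a + b * j) <= size_param)%N.
Proof.
move=> ha hb; apply: (leq_trans (pow_le j ha hb)); rewrite /size_param addn1; exact: leq_pmull.
Qed.

Let index_of i : nat := nth 0%N [:: size_param; j; L; kb; r0; W; (6 * T6)%N] i.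

Let jP : (ntrain A + ntest A + ceiln eps^-1 + 1 <= 2 ^ j)%N.
Proof. by rewrite jE; exact: up_logP. Qed.

Lemma size_param_ok : [/\ (256 <= index_of 0)%N, (ntrain A <= index_of 0)%N,
  (ntest A <= index_of 0)%N & forall i, (index_of i <= index_of 0)%N].
Proof.
have h256 : (256 * 2 ^ j <= size_param)%N.
  by rewrite -two_pow8 -expnD; have := @pow_size 8 1 isT isT; rewrite mul1n.
have pj : (0 < 2 ^ j)%N by rewrite expn_gt0.
have h1 : (2 ^ j <= size_param)%N by apply: leq_trans h256; exact: leq_pmull.
have ej : (j < 2 ^ j)%N by exact: ltn_expl.
have hL : (L <= size_param)%N.
  by apply: (@leq_trans (L + 1)); [exact: leq_addr | rewrite /size_param leq_pmulr// expn_gt0].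
have hk : (kb <= size_param)%N.
  apply: leq_trans h256; rewrite /kb; move: (2 ^ j)%N ej pj; clear; lia.
have hr : (r0 <= size_param)%N.
  by apply: (leq_trans (leq_pred _)); exact: pow_size.
have hW : (W <= size_param)%N by exact: pow_size.
have hT : (6 * T6 <= size_param)%N.
  have E : (2 ^ (70 + 12 * j) = 8 * 2 ^ (67 + 12 * j))%N by rewrite -two_pow3 -expnD.
  by rewrite /T6 /size_param E mulnCA leq_mul2l leq_mul2r !orbT.
split.
- by apply: leq_trans h256; rewrite leq_pmulr.
- by apply: leq_trans h1; apply: leq_trans jP; rewrite -!addnA leq_addr.
- by apply: leq_trans h1; apply: leq_trans jP; rewrite -!addnA addnCA leq_addr.
case=> [|[|[|[|[|[|[|i]]]]]]] //.
- by apply: leq_trans h1; exact: ltnW.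
- by rewrite /index_of /= nth_nil.
Qed.

Lemma natr_size : size_param%:R <=
  2 ^+ 96 * (1 + (sample_complexity A)%:R + eps^-1 + ln delta^-1) ^+ 13.
Proof.
case/andP: eps01 => e0 e1; case/andP: (dl01) => dl0 dl1.
have ei : 1 <= eps^-1 by rewrite invf_ge1// ltW.
have di : 1 <= delta^-1 by rewrite invf_ge1// ltW.
have l0 : 0 <= ln delta^-1 by exact: ln_ge0.
have hL := log_delta_size dl01; rewrite -LE in hL.
have [_ hM] := andP (ceiln_itv (lt_le_trans ltr01 ei)).
have n0 : 0 <= (ntrain A)%:R :> R by []. have m0 : 0 <= (ntest A)%:R :> R by [].
set Y := _ + ln _; have EY : Y = 1 + ((ntrain A)%:R + (ntest A)%:R) + eps^-1 + ln delta^-1.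
  by rewrite /Y /sample_complexity natrD.
have Y1 : 1 <= Y by rewrite EY; move: (eps^-1) (ln _) ei l0 n0 m0; move=> *; lra.
apply: (@size_bound _ Y (2 ^ j)%:R (L%:R + 1)) => //.
- rewrite ler1n expn_gt0 /=; apply: (log_size jE) => //.
  rewrite !natrD EY; move: (eps^-1) (ln _) (ceiln _)%:R hM ei l0 n0 m0; move=> *; lra.
- have L0 : 0 <= L%:R :> R by [].
  by apply/andP; split; rewrite ?EY; move: (eps^-1) (ln _) (L%:R) hL ei l0 n0 m0 L0; move=> *; lra.
- by rewrite /size_param natrM natrD !natrX exprD -exprM (mulnC 12%N).
Qed.

Lemma total_cost_le k :
  (forall p, (total_cost (i_A p) (i_v p 1) (i_v p 2) (i_v p 3) (i_v p 4) (i_v p 5) (i_v p 6)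
    <= i_v p 0 ^ k)%N) ->
  (total_cost A j L kb r0 W (6 * T6) <= size_param ^ k)%N.
Proof. by move=> hk; exact: (hk (Inst size_param_ok)). Qed.

End sizes.

Theorem theorem3p5 :
  exists (P : PQ_program) (K c k : nat),
  forall (R : realType) (d : measure_display) (X : measurableType d)
    (C : set (concept X)) (A : learner R X) (T : nat) (eps : R),
  (forall f : concept X, C f -> measurable_fun setT f) ->
  0 < eps < 1 -> (0 < T)%N ->
  TDS_learner C A eps (1 / 100) ->
  forall delta : R, 0 < delta < 1 ->
  exists N : nat,
    PQ_learner C P A T N eps (K%:R * eps) (K%:R * eps) delta /\
    resources_within C P A T N eps delta
      (c%:R * (1 + (sample_complexity A)%:R + eps^-1 + ln delta^-1) ^+ k).
Proof.
have [k hk] := total_cost_poly.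
exists (@PQProgram learning vote select isT isT), 24%N, (2 * (2 ^ 96) ^ k)%N, (13 * k)%N.
move=> R d X C A T eps mC eps01 T0 tds delta dl01.
(* The parameters are introduced as variables tied by equations, so that no tactic tries to compute
   the powers of two built from them. *)
have [j jE] : {j | j = up_log 2 (ntrain A + ntest A + ceiln eps^-1 + 1)} by eexists.
have [L LE] : {L | L = up_log 2 (ceiln delta^-1)} by eexists.
have hN : (total_cost A j L (52 + 10 * j) (2 ^ (19 + 3 * j)).-1 (2 ^ (16 + 4 * j))
    (6 * ((L + 1) * 2 ^ (67 + 12 * j))) <= size_param j L ^ k)%N.
  exact: (total_cost_le L jE hk).
have hZ := natr_size eps01 dl01 jE LE.
have hJ D1 D2 f Cf (G : store X -> Prop) := J_learn T (Dtrain := D1) (Dtest := D2) (mC f Cf) tds Cf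
  eps01 dl01 jE LE (G := G).
set kb := (52 + 10 * j)%N in hJ hN; set r0 := (2 ^ (19 + 3 * j)).-1 in hJ hN.
set W := (2 ^ (16 + 4 * j))%N in hJ hN.
have [T6 [T6E T60]] : {T6 | T6 = ((L + 1) * 2 ^ (67 + 12 * j))%N /\ (0 < T6)%N}.
  by eexists; split; first reflexivity; rewrite muln_gt0 addn1 expn_gt0.
rewrite -T6E in hJ hN.
set N := total_cost A j L kb r0 W (6 * T6) in hN.
have n1 : (learning_cost j L + (6 * T6 * (round_cost A kb r0 W (6 * T6) + 1) + 1 + 1) <= N)%N.
  by rewrite /N /total_cost -!addnA !leq_add2l leq_addr.
have n2 : (6 * T6 * 8 + 11 <= N)%N by rewrite /N /total_cost -addnA addnCA leq_addr.
have n3 : (select_cost A kb W (6 * T6) <= N)%N by rewrite /N /total_cost leq_addl.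
have e0 : 0 <= eps by case/andP: eps01 => /ltW.
have Y0 : 0 <= 1 + (sample_complexity A)%:R + eps^-1 + ln delta^-1.
  case/andP: (dl01) => d0 d1; rewrite !addr_ge0// ?invr_ge0//.
  by apply: ln_ge0; rewrite invf_ge1// ltW.
have hB := cost_bound hN Y0 hZ.
set B := (_ * _ ^+ (13 * k)) in hB *; exists N; clearbody N B kb r0 W; clear hk hN hZ; split.
  move=> Dtrain Dtest f Cf /=.
  (* The bad event is the failure of the guarantee itself. It is not known to be measurable, and
     [J_lower] does not ask for it. *)
  pose G (st : store X) := ~ PQ_guarantee Dtrain Dtest f (iid (noise_law A Dtrain Dtest) N)
    (fun w : N.-tuple (noise A) => evaluate T f vote st w)
    (fun w : N.-tuple (noise A) => evaluate T f select st w) (24%:R * eps) (24%:R * eps).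
  have HJ := hJ Dtrain Dtest f Cf G; apply: le_trans (J_lower (HJ _) n1) _; last first.
    rewrite le_eqVlt; apply/orP; left; apply/eqP; congr (iid _ _ _).
    by apply/seteqP; split => w /=; [exact: contrapT | move=> h; apply].
  move=> st rs rep sz m10 hb; apply; apply: (guarantee T (mC f Cf) e0 T60 rep sz m10 hb).
    by rewrite sz.
  by rewrite sz.
move=> f w Cf /=.
have N0 : (0 < N)%N by apply: leq_trans n2; rewrite addnS.
(* The resource bounds mention no distribution while the logic requires one; the noise at hand
   supplies a point that can carry a Dirac mass. *)
pose x0 := (tnth w (Ordinal N0)).1.1.1.
pose D : probability X R := dirac x0.
have HJ := hJ D D f Cf (fun=> False) (fun _ _ _ _ _ _ => id).
have cB c : (c <= N)%N -> (c * 2)%:R <= B.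
  by move=> h; apply: le_trans hB; rewrite ler_nat leq_mul2r h orbT.
split; first exact: (J_resources w HJ n1 erefl erefl erefl T0 (cB _ n1)).
have sw : (learning_cost j L + (6 * T6 * (round_cost A kb r0 W (6 * T6) + 1) + 1 + 1) <= size w)%N.
  by rewrite size_tuple.
have [_ [rs [rep sz m10]] _] := J_halts HJ sw.
move=> x v; split.
  have HV : J A T f D D (fun=> True) (fun=> False) (size rs * 8 + 11 + 0)
      ([:: vote], query_store (run T f learning (init_store A eps delta) w).2 x) 0.
    by apply: (J_vote rep) => s' _; apply: J_halt.
  have h : (size rs * 8 + 11 + 0 <= N)%N by rewrite addn0 sz.
  exact: (J_resources v HV h erefl erefl erefl T0 (cB _ h)).
(* Only termination is wanted, so the score is scaled by 0 and the choice of its entries is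
   immaterial. *)
have HS : J A T f D D (fun=> True) (fun=> False) (select_cost A kb W (size rs) + 0)
    ([:: select], query_store (run T f learning (init_store A eps delta) w).2 x)
    (0 * selS f kb x (nseq (size rs) (false, false)) rs 0 0).
  apply: (@J_select _ _ _ A T f D D _ _ (mC f Cf) kb r0 W 0 _ rs x _ 0 rep).
    exact: size_nseq.
  by move=> s' g _ _; rewrite mul0r; apply: J_halt.
have h : (select_cost A kb W (size rs) + 0 <= N)%N by rewrite addn0 sz.
exact: (J_resources v HS h erefl erefl erefl T0 (cB _ h)).
Qed.
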